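(* Let $\mathbb{K}$ be a perfect field and let $(S,W)$ be a self-injective $\mathbb{K}$-species with potential, with associated quiver with cycles $Q=(Q_0,Q_1,Q_2)$. Then every cut $C\subseteq Q_1$ is algebraic. Moreover, every arrow in $Q$ appears at least once in $Q_2$ (i.e. in some cycle belonging to $Q_2$).
   Context: Modules are left modules; arrows compose from right to left; quivers are finite and connected. Species. A $\mathbb{K}$-species $S$ over a quiver $Q$ without multiple arrows consists of finite-dimensional division $\mathbb{K}$-algebras $D_i$ ($i\in Q_0$) and finite-dimensional $D_j$-$D_i$-bimodules $M_\alpha$ (for $\alpha:i\to j$) on which $\mathbb{K}$ acts centrally. Put $D=\bigoplus_iD_i$, $M=\bigoplus_\alpha M_\alpha$, $T(S)=\bigoplus_{k\ge0}M^{\otimes_Dk}$, $\widehat T(S)=\prod_{k\ge0}M^{\otimes_Dk}$, $M^*=\mathrm{Hom}_{\mathbb{K}}(M,\mathbb{K})$; $e_i=1_{D_i}$. Fix a $\mathbb{K}$-linear $\mathfrak t:D\to\mathbb{K}$ with $\mathfrak t(ab)=\mathfrak t(ba)$ and no nonzero ideal in its kernel. Composition with $\mathfrak t$ gives isomorphisms $\mathfrak t_l:\mathrm{Hom}_D(M,D)\to M^*$, $\mathfrak t_r:\mathrm{Hom}_{D^{op}}(M,D)\to M^*$; put $\mathfrak b(x\otimes\xi)=\mathfrak t_l^{-1}(\xi)(x)$, $\mathfrak b(\xi\otimes x)=\mathfrak t_r^{-1}(\xi)(x)$ for $x\in M$, $\xi\in M^*$. For each arrow $\alpha$ fix finite sets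 $\underline\alpha,\overline\alpha\subseteq M_\alpha$ with dual elements $a^*\in M_\alpha^*$ such that $\sum_{a\in\underline\alpha}a\otimes a^*\in M_\alpha\otimes_{D_{s(\alpha)}}M_\alpha^*$ and $\sum_{a'\in\overline\alpha}a'^*\otimes a'\in M_\alpha^*\otimes_{D_{t(\alpha)}}M_\alpha$ are the Casimir elements, i.e. $\sum_{a\in\underline\alpha}a\,\mathfrak b(a^*\otimes x)=x=\sum_{a'\in\overline\alpha}\mathfrak b(x\otimes a'^* )a'$ for all $x\in M_\alpha$ (take $\underline\alpha$, $\overline\alpha$ to be a right $D_{s(\alpha)}$-basis, respectively a left $D_{t(\alpha)}$-basis, of $M_\alpha$). Put $\overline{\alpha^*}=\{a^*\mid a\in\underline\alpha\}$, $\underline{\alpha^*}=\{a'^*\mid a'\in\overline\alpha\}$. Potentials. A potential is $W\in T(S)$ with components only in tensor degrees $\ge2$ and $dW=Wd$ for all $d\in D$. For $\xi\in M^*$, $\partial^l_\xi(a\otimes u)=\mathfrak b(\xi\otimes a)u$ and $\partial^r_\xi(u\otimes a)=u\,\mathfrak b(a\otimes\xi)$ ($a\in M$). With $\sum_ix_i^*\otimes x_i\in M^*\otimes_DM$ the Casimir element of $M$, $\varepsilon_l(W)=\sum_i\partial^l_{x_i^*}(W)x_i$, and $\varepsilon_c(W)=\sum_{k=0}^d\varepsilon_l^k(W)$ for $W$ homogeneous of degree $d+1$ (extended additively), put $\partial_\xi(W)=\partial^l_\xi(\varepsilon_c(W))$. The Jacobian algebra is $\mathcal P(S,W)=\widehat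 T(S)/\overline{\langle\partial_\xi(W)\mid\xi\in M^*\rangle}$; $(S,W)$ is self-injective if $\mathcal P(S,W)$ is a finite-dimensional self-injective algebra. Cuts. $Q_2$ is a minimal set of cycles in $Q$ such that $W$ lies in the sum, over all $\alpha_n\cdots\alpha_1\in Q_2$ and $1\le i\le n$, of $M_{\alpha_i}\otimes_D\cdots\otimes_DM_{\alpha_1}\otimes_DM_{\alpha_n}\otimes_D\cdots\otimes_DM_{\alpha_{i+1}}$. $C\subseteq Q_1$ is a cut if $g_C(c)=1$ for all $c\in Q_2$, where $g_C$ counts the arrows of a path lying in $C$. $S_C$ is the restriction of $S$ to $(Q_0,Q_1\setminus C)$ and $\mathcal P(S,W,C)=\widehat T(S_C)/\overline{\langle\partial_\xi(W)\mid\xi\in M_\alpha^*,\alpha\in C\rangle}$. Algebraic cut. Let $\Lambda=\mathcal P(S,W,C)$, $P_i=\Lambda e_i$, and $S_i$ the simple top of $P_i$. The cut $C$ is algebraic if $\dim_{\mathbb{K}}\Lambda<\infty$ and for each $i\in Q_0$ the sequence of left $\Lambda$-modules $$0\to\bigoplus_{\beta\in C,\,t(\beta)=i}P_{s(\beta)}^{|\underline\beta|}\xrightarrow{(\partial_{\overline{\beta^*},\underline{\alpha^*}}W)_{\alpha,\beta}}\bigoplus_{\alpha\notin C,\,s(\alpha)=i}P_{t(\alpha)}^{|\overline\alpha|}\xrightarrow{(\overline\alpha)_\alpha}P_i\to S_i\to0$$ is exact. Here the second map is right multiplication by $a'$ on the component indexed by $a'\in\overline\alpha$, and the first map is given, on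 the components indexed by $b\in\underline\beta$ and $a'\in\overline\alpha$, by right multiplication with the class of $\partial^r_{a'^*}(\partial_{b^*}(W))\in e_{s(\beta)}\widehat T(S_C)e_{t(\alpha)}$.
   Formalization: The claim that every arrow appears in Q_2 is stated for arrows whose bimodule M_α is nonzero; it fails for an arrow carrying the zero bimodule (one vertex, D = K, a loop with M = 0, W = 0), which can never occur in a minimal Q_2. *)

(* Defs.v *)
From HB Require Import structures.
From mathcomp Require Import all_boot all_order all_algebra all_field.
From mathcomp Require Import ring_quotient generic_quotient.
From mathcomp Require Import boolp classical_sets.

Set Implicit Arguments.
Unset Strict Implicit.
Unset Printing Implicit Defensive.

Import GRing.Theory.
Local Open Scope ring_scope.
Local Open Scope quotient_scope.

Definition perfect_field (K : fieldType) : Prop :=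
  forall p : {poly K}, irreducible_poly p -> separable_poly p.

(* Products of families; for a finite index type these are the direct sums. *)

Definition dprod (I : Type) (V : I -> Type) : Type := forall i, V i.

HB.instance Definition _ (I : Type) (V : I -> choiceType) :=
  gen_eqMixin (dprod V).
HB.instance Definition _ (I : Type) (V : I -> choiceType) :=
  gen_choiceMixin (dprod V).

Section DprodZmod.
Variables (I : Type) (V : I -> zmodType).
Implicit Types f g h : dprod V.

Definition dprod_add f g : dprod V := fun i => f i + g i.
Definition dprod_opp f : dprod V := fun i => - f i.
Definition dprod_zero : dprod V := fun=> 0.

Fact dprod_addA : associative dprod_add.
Proof. by move=> f g h; apply: functional_extensionality_dep => i; apply: addrA. Qed.
Fact dprod_addC : commutative dprod_add.
Proof. by move=> f g; apply: functional_extensionality_dep => i; apply: addrC. Qed.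
Fact dprod_add0 : left_id dprod_zero dprod_add.
Proof. by move=> f; apply: functional_extensionality_dep => i; apply: add0r. Qed.
Fact dprod_addN : left_inverse dprod_zero dprod_opp dprod_add.
Proof. by move=> f; apply: functional_extensionality_dep => i; apply: addNr. Qed.

HB.instance Definition _ := GRing.isZmodule.Build (dprod V)
  dprod_addA dprod_addC dprod_add0 dprod_addN.

Lemma dprodD f g i : (f + g) i = f i + g i. Proof. by []. Qed.
Lemma dprodN f i : (- f) i = - f i. Proof. by []. Qed.
Lemma dprod0 i : (0 : dprod V) i = 0. Proof. by []. Qed.
Lemma dprod_sum (J : Type) (r : seq J) (P : pred J) (F : J -> dprod V) i :
  (\sum_(j <- r | P j) F j) i = \sum_(j <- r | P j) F j i.
Proof. by elim/big_rec2: _ => //= j x y _ <-. Qed.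
End DprodZmod.

Section DprodRing.
Variables (I : Type) (V : I -> pzRingType).
Implicit Types f g h : dprod V.

Definition dprod_mul f g : dprod V := fun i => f i * g i.
Definition dprod_one : dprod V := fun=> 1.

Fact dprod_mulA : associative dprod_mul.
Proof. by move=> f g h; apply: functional_extensionality_dep => i; apply: mulrA. Qed.
Fact dprod_mul1 : left_id dprod_one dprod_mul.
Proof. by move=> f; apply: functional_extensionality_dep => i; apply: mul1r. Qed.
Fact dprod_1mul : right_id dprod_one dprod_mul.
Proof. by move=> f; apply: functional_extensionality_dep => i; apply: mulr1. Qed.
Fact dprod_mulDl : left_distributive dprod_mul +%R.
Proof. by move=> f g h; apply: functional_extensionality_dep => i; apply: mulrDl. Qed.
Fact dprod_mulDr : right_distributive dprod_mul +%R.
Proof. by move=> f g h; apply: functional_extensionality_dep => i; apply: mulrDr. Qed.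

HB.instance Definition _ := GRing.Zmodule_isPzRing.Build (dprod V)
  dprod_mulA dprod_mul1 dprod_1mul dprod_mulDl dprod_mulDr.

Lemma dprodM f g i : (f * g) i = f i * g i. Proof. by []. Qed.
End DprodRing.

Section DprodLmod.
Variables (R : pzRingType) (I : Type) (V : I -> lmodType R).
Implicit Types f g : dprod V.

Definition dprod_scale (a : R) f : dprod V := fun i => a *: f i.

Fact dprod_scaleA a b f : dprod_scale a (dprod_scale b f) = dprod_scale (a * b) f.
Proof. by apply: functional_extensionality_dep => i; apply: scalerA. Qed.
Fact dprod_scale1 : left_id 1 dprod_scale.
Proof. by move=> f; apply: functional_extensionality_dep => i; apply: scale1r. Qed.
Fact dprod_scaleDr : right_distributive dprod_scale +%R.
Proof. by move=> a f g; apply: functional_extensionality_dep => i; apply: scalerDr. Qed.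
Fact dprod_scaleDl f : {morph dprod_scale^~ f : a b / a + b}.
Proof. by move=> a b; apply: functional_extensionality_dep => i; apply: scalerDl. Qed.

HB.instance Definition _ := GRing.Zmodule_isLmodule.Build R (dprod V)
  dprod_scaleA dprod_scale1 dprod_scaleDr dprod_scaleDl.

Lemma dprodZ a f i : (a *: f) i = a *: f i. Proof. by []. Qed.
End DprodLmod.

Record ideal (R : pzRingType) := Ideal {
  ideal_car :> R -> Prop;
  ideal0 : ideal_car 0;
  idealB : forall x y, ideal_car x -> ideal_car y -> ideal_car (x - y);
  idealMl : forall a x, ideal_car x -> ideal_car (a * x);
  idealMr : forall a x, ideal_car x -> ideal_car (x * a)
}.

Section RingQuotient.
Variables (R : pzRingType) (J : ideal R).

Definition ideal_pred : pred R := fun x => `[< J x >].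

Fact ideal_pred_closed : zmod_closed ideal_pred.
Proof.
split; first by apply/asboolP; apply: ideal0.
by move=> x y /asboolP Jx /asboolP Jy; apply/asboolP; apply: idealB.
Qed.
HB.instance Definition _ := GRing.isZmodClosed.Build R ideal_pred ideal_pred_closed.
Definition ideal_zmod : zmodClosed R := GRing.ZmodClosed.clone R ideal_pred _.

Definition rquot : Type := Quotient.quot ideal_zmod.
HB.instance Definition _ := GRing.Zmodule.on rquot.

Definition rcls (x : R) : rquot := \pi_(Quotient.quot ideal_zmod) x.

Lemma rcls_eq x y : (rcls x = rcls y) <-> J (x - y).
Proof.
split=> [/eqP|Jxy]; last apply/eqP.
  by rewrite /rcls -Quotient.idealrBE => /asboolP.
by rewrite /rcls -Quotient.idealrBE; apply/asboolP.
Qed.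

Lemma rcls_surj (X : rquot) : exists x, rcls x = X.
Proof. by exists (repr (X : Quotient.quot ideal_zmod)); apply: reprK. Qed.

Lemma rclsD x y : rcls (x + y) = rcls x + rcls y.
Proof. exact: Quotient.pi_add. Qed.

Definition rquot_repr (X : rquot) : R := repr (X : Quotient.quot ideal_zmod).
Definition rquot_mul (X Y : rquot) : rquot := rcls (rquot_repr X * rquot_repr Y).

Lemma rquot_reprK X : rcls (rquot_repr X) = X.
Proof. exact: reprK. Qed.

Lemma rquot_mulE x y : rquot_mul (rcls x) (rcls y) = rcls (x * y).
Proof.
apply/rcls_eq; set x' := rquot_repr _; set y' := rquot_repr _.
have Jx : J (x' - x) by apply/rcls_eq; apply: rquot_reprK.
have Jy : J (y' - y) by apply/rcls_eq; apply: rquot_reprK.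
have -> : x' * y' - x * y = (x' - x) * y' - - (x * (y' - y)).
  by rewrite mulrBl mulrBr opprK addrA subrK.
apply: idealB; first exact: idealMr.
rewrite -[X in J X]add0r; apply: idealB; first exact: ideal0.
exact: idealMl.
Qed.

Fact rquot_mulA : associative rquot_mul.
Proof.
move=> X Y Z; case: (rcls_surj X) (rcls_surj Y) (rcls_surj Z) => [x <-] [y <-] [z <-].
by rewrite !rquot_mulE mulrA.
Qed.
Fact rquot_mul1 : left_id (rcls 1) rquot_mul.
Proof. by move=> X; case: (rcls_surj X) => [x <-]; rewrite rquot_mulE mul1r. Qed.
Fact rquot_1mul : right_id (rcls 1) rquot_mul.
Proof. by move=> X; case: (rcls_surj X) => [x <-]; rewrite rquot_mulE mulr1. Qed.
Fact rquot_mulDl : left_distributive rquot_mul +%R.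
Proof.
move=> X Y Z; case: (rcls_surj X) (rcls_surj Y) (rcls_surj Z) => [x <-] [y <-] [z <-].
by rewrite -rclsD !rquot_mulE mulrDl rclsD.
Qed.
Fact rquot_mulDr : right_distributive rquot_mul +%R.
Proof.
move=> X Y Z; case: (rcls_surj X) (rcls_surj Y) (rcls_surj Z) => [x <-] [y <-] [z <-].
by rewrite -rclsD !rquot_mulE mulrDr rclsD.
Qed.
HB.instance Definition _ := GRing.Zmodule_isPzRing.Build rquot
  rquot_mulA rquot_mul1 rquot_1mul rquot_mulDl rquot_mulDr.

Lemma rclsM x y : rcls (x * y) = rcls x * rcls y.
Proof. by rewrite -rquot_mulE. Qed.
Lemma rcls1 : rcls 1 = 1. Proof. by []. Qed.

End RingQuotient.

Section ModuleQuotient.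
Variables (R : pzRingType) (V : lmodType R) (U : submodClosed V).

Definition submod_pred : pred V := fun x => x \in U.

Fact submod_pred_closed : zmod_closed submod_pred.
Proof.
split; first exact: rpred0.
by move=> x y Ux Uy; rewrite -[y]scale1r -scaleNr; apply: rpredD => //; apply: rpredZ.
Qed.
HB.instance Definition _ := GRing.isZmodClosed.Build V submod_pred submod_pred_closed.
Definition submod_zmod : zmodClosed V := GRing.ZmodClosed.clone V submod_pred _.

Definition lquot : Type := Quotient.quot submod_zmod.
HB.instance Definition _ := GRing.Zmodule.on lquot.

Definition lcls (x : V) : lquot := \pi_(Quotient.quot submod_zmod) x.

Lemma lcls_eq x y : (lcls x = lcls y) <-> (x - y \in U).
Proof.
split=> [/eqP|Uxy]; last apply/eqP.
  by rewrite /lcls -Quotient.idealrBE.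
by rewrite /lcls -Quotient.idealrBE.
Qed.

Lemma lcls_surj (X : lquot) : exists x, lcls x = X.
Proof. by exists (repr (X : Quotient.quot submod_zmod)); apply: reprK. Qed.

Lemma lclsD x y : lcls (x + y) = lcls x + lcls y.
Proof. exact: Quotient.pi_add. Qed.

Definition lquot_scale (a : R) (X : lquot) : lquot :=
  lcls (a *: repr (X : Quotient.quot submod_zmod)).

Lemma lquot_scaleE a x : lquot_scale a (lcls x) = lcls (a *: x).
Proof.
apply/lcls_eq; rewrite -scalerBr; apply: rpredZ; apply/lcls_eq; exact: reprK.
Qed.

Fact lquot_scaleA a b X : lquot_scale a (lquot_scale b X) = lquot_scale (a * b) X.
Proof. by case: (lcls_surj X) => [x <-]; rewrite !lquot_scaleE scalerA. Qed.
Fact lquot_scale1 : left_id 1 lquot_scale.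
Proof. by move=> X; case: (lcls_surj X) => [x <-]; rewrite lquot_scaleE scale1r. Qed.
Fact lquot_scaleDr : right_distributive lquot_scale +%R.
Proof.
move=> a X Y; case: (lcls_surj X) (lcls_surj Y) => [x <-] [y <-].
by rewrite -lclsD !lquot_scaleE scalerDr lclsD.
Qed.
Fact lquot_scaleDl X : {morph lquot_scale^~ X : a b / a + b}.
Proof.
by move=> a b; case: (lcls_surj X) => [x <-]; rewrite !lquot_scaleE scalerDl lclsD.
Qed.
HB.instance Definition _ := GRing.Zmodule_isLmodule.Build R lquot
  lquot_scaleA lquot_scale1 lquot_scaleDr lquot_scaleDl.

End ModuleQuotient.

Section Radical.
Variables (R : pzRingType) (V : lmodType R).

Definition maximal_submod (N : submodClosed V) : Prop :=
  (exists x, x \notin N) /\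
  forall N' : submodClosed V, {subset N <= N'} ->
    {subset N' <= N} \/ (forall x, x \in N').

Definition radical : pred V :=
  fun x => `[< forall N : submodClosed V, maximal_submod N -> x \in N >].

Fact radical_closed : submod_closed radical.
Proof.
split; first by apply/asboolP => N _; apply: rpred0.
move=> a x y /asboolP rx /asboolP ry; apply/asboolP => N mN.
by rewrite rpredD ?rpredZ ?rx ?ry.
Qed.
HB.instance Definition _ := GRing.isSubmodClosed.Build R V radical radical_closed.
Definition radical_submod : submodClosed V :=
  GRing.SubmodClosed.clone R V radical _.

Definition mod_top : lmodType R := lquot radical_submod.
Definition mod_top_proj : V -> mod_top := @lcls R V radical_submod.

End Radical.

Definition exact_at (A : Type) (B C : zmodType) (f : A -> B) (g : B -> C) : Prop :=
  forall y, g y = 0 <-> exists x, f x = y.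

(* R is injective as a left module over itself. *)
Definition self_injective (R : pzRingType) : Prop :=
  forall (U V : lmodType R) (i : {linear U -> V}) (f : {linear U -> R^o}),
    injective i -> exists g : {linear V -> R^o}, forall x, g (i x) = f x.

(* A K-algebra is here a ring R with a structure map eta : K -> R. *)
Definition finite_dim (K R : pzRingType) (eta : K -> R) : Prop :=
  exists n (v : 'I_n -> R),
    forall x, exists c : 'I_n -> K, x = \sum_i eta (c i) * v i.

Section LeftIdeal.
Variables (R : pzRingType) (e : R).

Definition left_ideal : pred R^o := fun x => `[< exists y : R, x = y * e >].

Fact left_ideal_closed : submod_closed left_ideal.
Proof.
split; first by apply/asboolP; exists 0; rewrite mul0r.
move=> a x y /asboolP [x' ->] /asboolP [y' ->]; apply/asboolP.
by exists (a * x' + y'); rewrite mulrDl -mulrA.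
Qed.
HB.instance Definition _ := GRing.isSubmodClosed.Build R R^o left_ideal left_ideal_closed.

Record lideal := Lideal { lideal_val :> R^o; _ : lideal_val \in left_ideal }.
HB.instance Definition _ := [isSub for lideal_val].
HB.instance Definition _ := [Choice of lideal by <:].
HB.instance Definition _ := [SubChoice_isSubLmodule of lideal by <:].

Fact lideal_mul_proof (x : R) : (x * e : R^o) \in left_ideal.
Proof. by apply/asboolP; exists x. Qed.
Definition lideal_mul (x : R) : lideal := Lideal (lideal_mul_proof x).

End LeftIdeal.

Record bimod (A B : pzRingType) (V : zmodType) := Bimod {
  lact : A -> V -> V;
  ract : V -> B -> V;
  lactA : forall a b x, lact a (lact b x) = lact (a * b) x;
  lact1 : forall x, lact 1 x = x;
  lactDl : forall a b x, lact (a + b) x = lact a x + lact b x;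
  lactDr : forall a x y, lact a (x + y) = lact a x + lact a y;
  ractA : forall a b x, ract (ract x a) b = ract x (a * b);
  ract1 : forall x, ract x 1 = x;
  ractDl : forall a b x, ract x (a + b) = ract x a + ract x b;
  ractDr : forall a x y, ract (x + y) a = ract x a + ract y a;
  lractA : forall a b x, lact a (ract x b) = ract (lact a x) b
}.

Section Tensor.
Variables (A D : pzRingType) (V : zmodType) (M : bimod A D V) (N : lmodType D).

(* The list [:: (m1, n1); ..; (mk, nk)] stands for m1 (x) n1 + .. + mk (x) nk. *)
Inductive tens_rel : seq (V * N) -> seq (V * N) -> Prop :=
| tens_refl s : tens_rel s s
| tens_sym s s' : tens_rel s s' -> tens_rel s' s
| tens_trans s s' s'' : tens_rel s s' -> tens_rel s' s'' -> tens_rel s s''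
| tens_cat s s' u u' : tens_rel s s' -> tens_rel u u' -> tens_rel (s ++ u) (s' ++ u')
| tens_comm s u : tens_rel (s ++ u) (u ++ s)
| tens_zero n : tens_rel [:: (0, n)] [::]
| tens_addl m m' n : tens_rel [:: (m + m', n)] [:: (m, n); (m', n)]
| tens_addr m n n' : tens_rel [:: (m, n + n')] [:: (m, n); (m, n')]
| tens_bal m d n : tens_rel [:: (ract M m d, n)] [:: (m, d *: n)].

Definition tens_relb s s' : bool := `[< tens_rel s s' >].

Fact tens_equiv : equiv_class_of tens_relb.
Proof.
split=> [s|s s'|s' s s''].
- by apply/asboolP; apply: tens_refl.
- by apply/idP/idP => /asboolP h; apply/asboolP; apply: tens_sym.
- by move=> /asboolP h /asboolP h'; apply/asboolP; apply: tens_trans h h'.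
Qed.
Canonical tens_equivRel := EquivRelPack tens_equiv.
Canonical tens_encModRel := defaultEncModRel tens_relb.

Definition tens : Type := {eq_quot tens_relb}.
HB.instance Definition _ := Choice.on tens.

Definition tcls (s : seq (V * N)) : tens := \pi_({eq_quot tens_relb}) s.
Definition trepr (x : tens) : seq (V * N) := repr (x : {eq_quot tens_relb}).
Definition tpure (m : V) (n : N) : tens := tcls [:: (m, n)].

Lemma tclsP s s' : tcls s = tcls s' <-> tens_rel s s'.
Proof.
split=> [/eqmodP/asboolP //|h]; apply/eqmodP; exact/asboolP.
Qed.
Lemma treprK x : tcls (trepr x) = x. Proof. exact: reprK. Qed.
Lemma trepr_rel s : tens_rel (trepr (tcls s)) s.
Proof. by apply/tclsP; rewrite treprK. Qed.

Definition tens_add (x y : tens) : tens := tcls (trepr x ++ trepr y).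
Definition tens_map (f : V -> V) (x : tens) : tens :=
  tcls [seq (f p.1, p.2) | p <- trepr x].
Definition tens_opp : tens -> tens := tens_map -%R.
Definition tens_scale (a : A) : tens -> tens := tens_map (lact M a).

Lemma tens_addE s s' : tens_add (tcls s) (tcls s') = tcls (s ++ s').
Proof. by apply/tclsP; apply: tens_cat; apply: trepr_rel. Qed.

Lemma tens_mapE f s : {morph f : x y / x + y} ->
  (forall x d, f (ract M x d) = ract M (f x) d) ->
  tens_map f (tcls s) = tcls [seq (f p.1, p.2) | p <- s].
Proof.
move=> fD fd; apply/tclsP.
have f0 : f 0 = 0 by apply: (addrI (f 0)); rewrite -fD !addr0.
have := trepr_rel s; move: (trepr _) => s'; elim=> {s s'} /=.
- by move=> s; apply: tens_refl.
- by move=> s s' _ h; apply: tens_sym.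
- by move=> s1 s2 s3 _ h _ h'; apply: tens_trans h h'.
- by move=> *; rewrite !map_cat; apply: tens_cat.
- by move=> *; rewrite !map_cat; apply: tens_comm.
- by move=> *; rewrite f0; apply: tens_zero.
- by move=> *; rewrite fD; apply: tens_addl.
- by move=> *; apply: tens_addr.
- by move=> *; rewrite fd; apply: tens_bal.
Qed.

Lemma tens_oppE s : tens_opp (tcls s) = tcls [seq (- p.1, p.2) | p <- s].
Proof.
apply: tens_mapE => [x y|x d]; first exact: opprD.
by apply: (addrI (ract M x d)); rewrite subrr -ractDr subrr;
  apply: (addrI (ract M 0 d)); rewrite -ractDr !addr0.
Qed.

Lemma tens_scaleE a s : tens_scale a (tcls s) = tcls [seq (lact M a p.1, p.2) | p <- s].
Proof. by apply: tens_mapE => *; [apply: lactDr | apply: lractA]. Qed.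

Fact tens_addA : associative tens_add.
Proof.
by move=> x y z; rewrite -[x]treprK -[y]treprK -[z]treprK !tens_addE catA.
Qed.
Fact tens_addC : commutative tens_add.
Proof.
move=> x y; rewrite -[x]treprK -[y]treprK !tens_addE; apply/tclsP; exact: tens_comm.
Qed.
Fact tens_add0 : left_id (tcls [::]) tens_add.
Proof. by move=> x; rewrite -[x]treprK tens_addE. Qed.
Fact tens_addN : left_inverse (tcls [::]) tens_opp tens_add.
Proof.
move=> x; rewrite -[x]treprK tens_oppE tens_addE; apply/tclsP.
elim: (trepr x) => [|[m n] s IH] /=; first exact: tens_refl.
apply: (tens_trans (s' := [:: (- m, n)] ++ ([:: (m, n)] ++ s ++
    [seq (- p.1, p.2) | p <- s]))).
  apply: (@tens_cat [:: (- m, n)] [:: (- m, n)]); first exact: tens_refl.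
  exact: (tens_comm _ ((m, n) :: s)).
rewrite (catA [:: (- m, n)] [:: (m, n)]); apply: (tens_trans (s' := [::] ++ [::])); last exact: tens_refl.
apply: tens_cat; last first.
  exact: tens_trans (tens_comm _ _) IH.
apply: tens_trans (tens_zero n); apply: tens_sym.
by have := tens_addl (- m) m n; rewrite addNr.
Qed.

HB.instance Definition _ := GRing.isZmodule.Build tens
  tens_addA tens_addC tens_add0 tens_addN.

Lemma tclsD s s' : tcls (s ++ s') = tcls s + tcls s'.
Proof. by rewrite -tens_addE. Qed.

Lemma tcls_sum s : tcls s = \sum_(p <- s) tpure p.1 p.2.
Proof.
elim: s => [|[m n] s IH]; first by rewrite big_nil.
by rewrite big_cons -IH -tclsD.
Qed.

Lemma tpureDl m m' n : tpure (m + m') n = tpure m n + tpure m' n.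
Proof. by rewrite -tclsD; apply/tclsP; apply: tens_addl. Qed.
Lemma tpureDr m n n' : tpure m (n + n') = tpure m n + tpure m n'.
Proof. by rewrite -tclsD; apply/tclsP; apply: tens_addr. Qed.
Lemma tpure_bal m d n : tpure (ract M m d) n = tpure m (d *: n).
Proof. by apply/tclsP; apply: tens_bal. Qed.
Lemma tpure0r m : tpure m 0 = 0.
Proof. by apply: (addrI (tpure m 0)); rewrite -tpureDr !addr0. Qed.
Lemma tpure_sumr m (J : Type) (r : seq J) (P : pred J) F :
  tpure m (\sum_(j <- r | P j) F j) = \sum_(j <- r | P j) tpure m (F j).
Proof. exact: (big_morph (tpure m) (tpureDr m) (tpure0r m)). Qed.

Fact tens_scaleA a b x : tens_scale a (tens_scale b x) = tens_scale (a * b) x.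
Proof.
rewrite -[x]treprK !tens_scaleE; congr tcls; rewrite -map_comp.
by apply: eq_map => p /=; rewrite lactA.
Qed.
Fact tens_scale1 : left_id 1 tens_scale.
Proof.
move=> x; rewrite -[x]treprK tens_scaleE; congr tcls; rewrite -[RHS]map_id.
by apply: eq_map => -[m n] /=; rewrite lact1.
Qed.
Fact tens_scaleDr : right_distributive tens_scale +%R.
Proof.
by move=> a x y; rewrite -[x]treprK -[y]treprK -tclsD !tens_scaleE map_cat tclsD.
Qed.
Fact tens_scaleDl x : {morph tens_scale^~ x : a b / a + b}.
Proof.
move=> a b; rewrite -[x]treprK !tens_scaleE !tcls_sum !big_map -big_split /=.
by apply: eq_bigr => p _; rewrite lactDl tpureDl.
Qed.
HB.instance Definition _ := GRing.Zmodule_isLmodule.Build A tens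
  tens_scaleA tens_scale1 tens_scaleDr tens_scaleDl.

Lemma tpureZ a m n : a *: tpure m n = tpure (lact M a m) n.
Proof. exact: tens_scaleE. Qed.

Lemma tens_ind (P : tens -> Prop) :
  P 0 -> (forall m n x, P x -> P (tpure m n + x)) -> forall x, P x.
Proof.
move=> P0 PD x; rewrite -[x]treprK; elim: (trepr x) => [|[m n] s IH]; first exact: P0.
by rewrite -cat1s tclsD; apply: PD.
Qed.

(* The additive map induced by a balanced map f; it is only meaningful when f *)
(* is balanced, see tliftE.                                                    *)
Definition tlift (W : zmodType) (f : V -> N -> W) (x : tens) : W :=
  \sum_(p <- trepr x) f p.1 p.2.

Definition balanced (W : zmodType) (f : V -> N -> W) : Prop :=
  [/\ forall m m' n, f (m + m') n = f m n + f m' n,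
      forall m n n', f m (n + n') = f m n + f m n'
    & forall m d n, f (ract M m d) n = f m (d *: n)].

Section Lift.
Variables (W : zmodType) (f : V -> N -> W).
Hypothesis fb : balanced f.

Lemma tlift_rel s s' : tens_rel s s' ->
  \sum_(p <- s) f p.1 p.2 = \sum_(p <- s') f p.1 p.2.
Proof.
case: fb => fl fr fd.
elim=> {s s'} //=.
- by move=> s1 s2 s3 _ -> _.
- by move=> s s' u u' _ hs _ hu; rewrite !big_cat hs hu.
- by move=> s u; rewrite !big_cat /= addrC.
- move=> n; rewrite big_seq1 big_nil /=.
  by apply: (addrI (f 0 n)); rewrite -fl !addr0.
- by move=> m m' n; rewrite big_seq1 big_cons big_seq1 /=.
- by move=> m n n'; rewrite big_seq1 big_cons big_seq1 /=.
- by move=> m d n; rewrite !big_seq1 /=.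
Qed.

Lemma tlift_cls s : tlift f (tcls s) = \sum_(p <- s) f p.1 p.2.
Proof. exact: tlift_rel (trepr_rel s). Qed.
Lemma tliftE m n : tlift f (tpure m n) = f m n.
Proof. by rewrite tlift_cls big_seq1. Qed.
Lemma tlift0 : tlift f 0 = 0.
Proof. by rewrite (tlift_cls [::]) big_nil. Qed.
Lemma tliftD x y : tlift f (x + y) = tlift f x + tlift f y.
Proof. by rewrite -[x]treprK -[y]treprK -tclsD !tlift_cls big_cat. Qed.
End Lift.

End Tensor.

Section TensorAlgebra.
Variables (D : pzRingType) (V : zmodType) (M : bimod D D V).

(* The k-fold tensor power of V over D, bracketed to the right, with D as     *)
(* 0-th power: m1 (x) (m2 (x) ... (mk (x) d)).                                 *)
Fixpoint tpow (k : nat) : lmodType D :=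
  if k is k'.+1 then tens M (tpow k') else D^o.

(* The completed tensor algebra, the product of all tensor powers. *)
Definition ctens : Type := dprod tpow.
HB.instance Definition _ := GRing.Zmodule.on ctens.

Implicit Types f g h : ctens.

Definition tshift (m : V) (g : ctens) : ctens :=
  fun n => if n is n'.+1 then tpure M m (g n') else 0.

(* For u of degree k, tact u g is the product u (x) g. *)
Fixpoint tact (k : nat) : tpow k -> ctens -> ctens :=
  match k return tpow k -> ctens -> ctens with
  | 0 => fun d g n => (d : D) *: g n
  | k'.+1 => fun x g => tlift (fun m u => tshift m (tact u g)) x
  end.

(* The degree n part of f g; the terms with i <= n are the only nonzero ones. *)
Definition ctens_mul f g : ctens := fun n => \sum_(i < n.+1) tact (f i) g n.

Definition ctens_D (d : D) : ctens :=
  fun n => match n return tpow n with 0 => d | _.+1 => 0 end.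
Definition ctens_M (m : V) : ctens := tshift m (ctens_D 1).

Lemma ctensD f g n : (f + g) n = f n + g n. Proof. by []. Qed.
Lemma ctens0 n : (0 : ctens) n = 0. Proof. by []. Qed.

Lemma ctens_ext f g : (forall n, f n = g n) -> f = g.
Proof. exact: functional_extensionality_dep. Qed.

Lemma ctens_sumE (J : Type) (r : seq J) (P : pred J) (F : J -> ctens) n :
  (\sum_(j <- r | P j) F j) n = \sum_(j <- r | P j) F j n.
Proof. exact: (@dprod_sum nat tpow). Qed.

Lemma tshiftDl m m' g : tshift (m + m') g = tshift m g + tshift m' g.
Proof.
by apply: ctens_ext => -[|n] /=; rewrite ctensD /= ?addr0 // tpureDl.
Qed.
Lemma tshiftDr m g g' : tshift m (g + g') = tshift m g + tshift m g'.
Proof.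
by apply: ctens_ext => -[|n] /=; rewrite ctensD /= ?addr0 // tpureDr.
Qed.

Lemma tact_linear k :
  (forall (u u' : tpow k) g, tact (u + u') g = tact u g + tact u' g) /\
  (forall (u : tpow k) g g', tact u (g + g') = tact u g + tact u g') /\
  (forall d (u : tpow k) g n, tact (d *: u) g n = d *: tact u g n) /\
  (forall g, tact (0 : tpow k) g = 0).
Proof.
elim: k => [|k [IH1 [IH2 [IH3 IH4]]]].
  split=> [u u' g|]; first by apply: ctens_ext => n; rewrite ctensD /= scalerDl.
  split=> [u g g'|]; first by apply: ctens_ext => n; rewrite !ctensD /= scalerDr.
  split=> [d u g n|g]; first by rewrite /= scalerA.
  by apply: ctens_ext => n; rewrite /= scale0r.
have bal g : balanced M (fun m (u : tpow k) => tshift m (tact u g)).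
  split=> [m m' u|m u u'|m d u]; first exact: tshiftDl.
    by rewrite IH1 tshiftDr.
  by apply: ctens_ext => -[|n] //=; rewrite tpure_bal IH3.
have D1 (u u' : tpow k.+1) g : tact (u + u') g = tact u g + tact u' g.
  exact: (tliftD (bal g)).
have Z0 g : tact (0 : tpow k.+1) g = 0 by exact: (tlift0 (bal g)).
have pE m (u : tpow k) g : tact (tpure M m u : tpow k.+1) g = tshift m (tact u g).
  exact: (tliftE (bal g)).
split; first exact: D1.
split.
  move=> u g g'; elim/tens_ind: u => [|m u x IH]; first by rewrite !Z0 addr0.
  by rewrite !D1 IH !pE IH2 tshiftDr addrACA.
split; last exact: Z0.
move=> d u g n; elim/tens_ind: u => [|m u x IH].
  by rewrite scaler0 Z0 ctens0 scaler0.
rewrite scalerDr !D1 !ctensD IH scalerDr; congr (_ + _).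
by rewrite tpureZ !pE; case: n {IH} => [|n] /=; rewrite ?scaler0 ?tpureZ.
Qed.

Lemma tactDl k (u u' : tpow k) g : tact (u + u') g = tact u g + tact u' g.
Proof. by case: (tact_linear k). Qed.
Lemma tactDr k (u : tpow k) g g' : tact u (g + g') = tact u g + tact u g'.
Proof. by case: (tact_linear k) => _ []. Qed.
Lemma tactZ k d (u : tpow k) g n : tact (d *: u) g n = d *: tact u g n.
Proof. by case: (tact_linear k) => _ [_ []]. Qed.
Lemma tact0l k g : tact (0 : tpow k) g = 0.
Proof. by case: (tact_linear k) => _ [_ [_]]. Qed.
Lemma tact0r k (u : tpow k) : tact u 0 = 0.
Proof. by apply: (addrI (tact u 0)); rewrite -tactDr !addr0. Qed.

Lemma tact_balanced k g : balanced M (fun m (u : tpow k) => tshift m (tact u g)).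
Proof.
split=> [m m' u|m u u'|m d u]; first exact: tshiftDl.
  by rewrite tactDl tshiftDr.
by apply: ctens_ext => -[|n] //=; rewrite tpure_bal tactZ.
Qed.

Lemma tactS k m (u : tpow k) g : tact (tpure M m u : tpow k.+1) g = tshift m (tact u g).
Proof. exact: (tliftE (@tact_balanced k g)). Qed.

Lemma tpowS_ind k (P : tpow k.+1 -> Prop) :
  P 0 -> (forall m (u : tpow k) (x : tpow k.+1), P x -> P ((tpure M m u : tpow k.+1) + x)) ->
  forall x, P x.
Proof. exact: (@tens_ind D D V M (tpow k) P). Qed.

Lemma tact_low k (u : tpow k) g n : (n < k)%N -> tact u g n = 0.
Proof.
elim: k u g n => [//|k IH] u g n; elim/tpowS_ind: u => [|m u x IHx] nk.
  by rewrite tact0l.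
rewrite tactDl ctensD IHx // addr0 tactS; case: n nk {IHx} => [//|n] nk /=.
by rewrite IH // tpure0r.
Qed.

Lemma ctens_mulDl : left_distributive ctens_mul +%R.
Proof.
move=> f g h; apply: ctens_ext => n; rewrite ctensD /ctens_mul -big_split /=.
by apply: eq_bigr => i _; rewrite ctensD tactDl ctensD.
Qed.
Lemma ctens_mulDr : right_distributive ctens_mul +%R.
Proof.
move=> f g h; apply: ctens_ext => n; rewrite ctensD /ctens_mul -big_split /=.
by apply: eq_bigr => i _; rewrite tactDr ctensD.
Qed.

Lemma ctens_mul0l g : ctens_mul 0 g = 0.
Proof.
by apply: ctens_ext => n; rewrite /ctens_mul big1 // => i _; rewrite ctens0 tact0l.
Qed.

Lemma ctens_mulZ d g h n :
  ctens_mul (fun k => d *: g k) h n = d *: ctens_mul g h n.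
Proof. by rewrite /ctens_mul scaler_sumr; apply: eq_bigr => i _; rewrite tactZ. Qed.

Lemma ctens_mul_shift m g h : ctens_mul (tshift m g) h = tshift m (ctens_mul g h).
Proof.
apply: ctens_ext => -[|n]; rewrite /ctens_mul big_ord_recl /= scale0r add0r.
  by rewrite big_ord0.
rewrite tpure_sumr; apply: eq_bigr => i _.
exact: (congr1 (fun w : ctens => w n.+1) (tactS m (g i) h)).
Qed.

Lemma tact_mul k (u : tpow k) g h : tact u (ctens_mul g h) = ctens_mul (tact u g) h.
Proof.
elim: k u g h => [|k IH] u g h.
  by apply: ctens_ext => n; rewrite /= ctens_mulZ.
elim/tpowS_ind: u => [|m u x IHx]; first by rewrite !tact0l ctens_mul0l.
by rewrite !tactDl ctens_mulDl IHx !tactS IH ctens_mul_shift.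
Qed.

Fact ctens_mulA : associative ctens_mul.
Proof.
move=> f g h; apply: ctens_ext => n.
have -> : ctens_mul f (ctens_mul g h) n =
    \sum_(j < n.+1) \sum_(i < n.+1) tact (tact (f j) g i) h n.
  by apply: eq_bigr => j _; rewrite tact_mul.
rewrite exchange_big; apply: eq_bigr => i _ /=.
have -> : ctens_mul f g i = \sum_(j < n.+1) tact (f j) g i.
  rewrite /ctens_mul (big_ord_widen n.+1 (fun j => tact (f j) g i)) ?ltn_ord //.
  rewrite [RHS](bigID (fun j : 'I_n.+1 => (j < i.+1)%N)) /= [X in _ + X]big1 ?addr0 //.
  by move=> j; rewrite -leqNgt => ij; rewrite tact_low.
have tact_sum (F : 'I_n.+1 -> tpow i) : tact (\sum_j F j) h = \sum_j tact (F j) h.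
  exact: (big_morph (fun u : tpow i => tact u h) (fun u u' => tactDl u u' h)
            (tact0l i h)).
by rewrite tact_sum ctens_sumE.
Qed.

Fact ctens_mul1 : left_id (ctens_D 1) ctens_mul.
Proof.
move=> f; apply: ctens_ext => n; rewrite /ctens_mul big_ord_recl /= scale1r.
by rewrite big1 ?addr0 // => i _; exact: (congr1 (fun w : ctens => w n) (tact0l i.+1 f)).
Qed.

Lemma tact1_diag k (u : tpow k) : tact u (ctens_D 1) k = u.
Proof.
elim: k u => [u|k IH u]; first by rewrite /= [LHS]mulr1.
elim/tpowS_ind: u => [|m u x IHx]; first by rewrite tact0l.
by rewrite tactDl ctensD IHx tactS /= IH.
Qed.

Lemma tact1_off k (u : tpow k) n : n != k -> tact u (ctens_D 1) n = 0.
Proof.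
elim: k u n => [u [|n]|k IH u n nk] //; first by rewrite /= scaler0.
elim/tpowS_ind: u => [|m u x IHx]; first by rewrite tact0l.
rewrite tactDl ctensD IHx addr0 tactS; case: n nk {IHx} => [//|n] nk /=.
by rewrite IH // tpure0r.
Qed.

Fact ctens_1mul : right_id (ctens_D 1) ctens_mul.
Proof.
move=> f; apply: ctens_ext => n; rewrite /ctens_mul big_ord_recr /= tact1_diag.
by rewrite big1 ?add0r // => i _; rewrite tact1_off // gtn_eqF.
Qed.

HB.instance Definition _ := GRing.Zmodule_isPzRing.Build ctens
  ctens_mulA ctens_mul1 ctens_1mul ctens_mulDl ctens_mulDr.

Lemma ctens_mul_trunc f f' g g' n :
  (forall k, (k <= n)%N -> f k = f' k) -> (forall k, (k <= n)%N -> g k = g' k) ->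
  (f * g) n = (f' * g') n.
Proof.
move=> ff' gg'.
have act_trunc k (u : tpow k) : forall j, (j <= n)%N -> tact u g j = tact u g' j.
  elim: k u => [|k IH] u j jn; first by rewrite /= gg'.
  elim/tpowS_ind: u => [|m u x IHx]; first by rewrite !tact0l.
  rewrite !tactDl !ctensD IHx !tactS; congr (_ + _).
  by case: j jn {IHx} => [//|j] jn /=; rewrite IH // ltnW.
rewrite -[LHS]/(ctens_mul f g n) -[RHS]/(ctens_mul f' g' n) /ctens_mul.
apply: eq_bigr => i _.
by rewrite (ff' i (leq_ord i)) act_trunc.
Qed.

(* The closure, for the product topology of discrete factors, of the ideal    *)
(* generated by X.                                                             *)
Definition gen_ideal (X : ctens -> Prop) (x : ctens) : Prop :=
  forall J : ideal ctens, (forall y, X y -> J y) -> J x.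

Definition closed_gen (X : ctens -> Prop) (x : ctens) : Prop :=
  forall n, exists2 y, gen_ideal X y & forall k, (k <= n)%N -> x k = y k.

Fact closed_gen0 X : closed_gen X 0.
Proof. by move=> n; exists 0 => // J _; apply: ideal0. Qed.
Fact closed_genB X x y : closed_gen X x -> closed_gen X y -> closed_gen X (x - y).
Proof.
move=> cx cy n; have [x' gx xx'] := cx n; have [y' gy yy'] := cy n.
exists (x' - y') => [J JX|k kn]; first by apply: idealB; [apply: gx | apply: gy].
by rewrite [LHS]/(x k - y k) xx' // yy'.
Qed.
Fact closed_genMl X a x : closed_gen X x -> closed_gen X (a * x).
Proof.
move=> cx n; have [x' gx xx'] := cx n.
exists (a * x') => [J JX|k kn]; first by apply: idealMl; apply: gx.
by apply: ctens_mul_trunc => // j jk; apply: xx'; apply: leq_trans kn.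
Qed.
Fact closed_genMr X a x : closed_gen X x -> closed_gen X (x * a).
Proof.
move=> cx n; have [x' gx xx'] := cx n.
exists (x' * a) => [J JX|k kn]; first by apply: idealMr; apply: gx.
by apply: ctens_mul_trunc => // j jk; apply: xx'; apply: leq_trans kn.
Qed.

Definition closed_ideal (X : ctens -> Prop) : ideal ctens :=
  Ideal (closed_gen0 X) (@closed_genB X) (@closed_genMl X) (@closed_genMr X).

(* The left derivative a (x) u |-> b(a) u, for b : V -> D right D-linear, and  *)
(* the right derivative u (x) a |-> u b(a), for b left D-linear; both are 0 in *)
(* degree 0.                                                                   *)
Definition dl_pow (b : V -> D) (k : nat) (x : tpow k.+1) : tpow k :=
  tlift (M := M) (fun m u => b m *: u) x.

Fixpoint dr_pow (b : V -> D) (k : nat) : tpow k.+1 -> tpow k :=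
  match k return tpow k.+1 -> tpow k with
  | 0 => fun x => tlift (M := M) (fun m (d : D^o) => b (ract M m d) : D^o) x
  | k'.+1 => fun x =>
      tlift (M := M) (fun m (u : tpow k'.+1) => tpure M m (dr_pow b u)) x
  end.

Definition dl (b : V -> D) (f : ctens) : ctens := fun k => dl_pow b (f k.+1).
Definition dr (b : V -> D) (f : ctens) : ctens := fun k => dr_pow b (f k.+1).

End TensorAlgebra.

(* The map induced on tensor powers by a D-bimodule map p : V -> V'. *)
Section TensorMap.
Variables (D : pzRingType) (V V' : zmodType).
Variables (M : bimod D D V) (M' : bimod D D V') (p : V -> V').

Fixpoint tpow_map (k : nat) : tpow M k -> tpow M' k :=
  match k return tpow M k -> tpow M' k with
  | 0 => id
  | k'.+1 => fun x => tlift (M := M)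
      (fun m (u : tpow M k') => tpure M' (p m) (tpow_map u) : tpow M' k'.+1) x
  end.

Definition ctens_map (f : ctens M) : ctens M' := fun k => tpow_map (f k).

End TensorMap.

Record quiver := Quiver {
  Q0 : finType;
  Q1 : finType;
  src : Q1 -> Q0;
  tgt : Q1 -> Q0
}.
Arguments src {q}.
Arguments tgt {q}.

Definition no_multiple_arrows (Q : quiver) : Prop :=
  injective (fun a : Q1 Q => (src a, tgt a)).

Definition quiver_adj (Q : quiver) : rel (Q0 Q) := fun i j =>
  [exists a : Q1 Q, ((src a == i) && (tgt a == j)) || ((src a == j) && (tgt a == i))].

Definition quiver_connected (Q : quiver) : Prop :=
  (0 < #|Q0 Q|)%N /\ forall i j, connect (@quiver_adj Q) i j.

(* Paths compose from right to left: the path a_n ... a_1 is the list          *)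
(* [:: a_n; ..; a_1].                                                          *)
Definition is_cycle (Q : quiver) (c : seq (Q1 Q)) : bool :=
  (c != [::]) && cycle (fun a b : Q1 Q => src a == tgt b) c.

Record species (K : fieldType) (Q : quiver) := Species {
  sdiv : Q0 Q -> falgType K;
  sdivP : forall i (x : sdiv i), x != 0 -> x \is a GRing.unit;
  smod : Q1 Q -> vectType K;
  sbim : forall a : Q1 Q, bimod (sdiv (tgt a)) (sdiv (src a)) (smod a);
  sbim_lK : forall (a : Q1 Q) (k : K) (m : smod a), lact (sbim a) k%:A m = k *: m;
  sbim_rK : forall (a : Q1 Q) (k : K) (m : smod a), ract (sbim a) m k%:A = k *: m
}.

Section Species.
Variables (K : fieldType) (Q : quiver) (S : species K Q).

Definition sD : Type := dprod (sdiv S).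
HB.instance Definition _ := GRing.PzRing.on sD.
HB.instance Definition _ := GRing.Lmodule.on sD.

Definition sM : Type := dprod (smod S).
HB.instance Definition _ := GRing.Lmodule.on sM.

Definition sM_lact (d : sD) (m : sM) : sM := fun a => lact (sbim S a) (d (tgt a)) (m a).
Definition sM_ract (m : sM) (d : sD) : sM := fun a => ract (sbim S a) (m a) (d (src a)).

Definition sM_bimod : bimod sD sD sM.
Proof.
apply: (@Bimod _ _ _ sM_lact sM_ract) => *;
  apply: functional_extensionality_dep => i.
- exact: lactA.
- exact: lact1.
- exact: lactDl.
- exact: lactDr.
- exact: ractA.
- exact: ract1.
- exact: ractDl.
- exact: ractDr.
- exact: lractA.
Defined.

Definition scalar_D (k : K) : sD := k *: (1 : sD).
Definition idem (i : Q0 Q) : sD := fun j => (j == i)%:R.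

Definition inM (a : Q1 Q) (m : smod S a) : sM := fun b =>
  if @eqP _ a b is ReflectT e then ecast b (smod S b) e m else 0.

Definition sT : Type := ctens sM_bimod.
HB.instance Definition _ := GRing.PzRing.on sT.

(* The inclusions of D and M in degrees 0 and 1. *)
Definition sT_D (d : sD) : sT := ctens_D sM_bimod d.
Definition sT_M (m : sM) : sT := ctens_M sM_bimod m.

(* The dual M^*, and its direct summand M_a^*. *)
Definition sMdual : Type := {linear sM -> K^o}.
Definition in_dual (a : Q1 Q) (xi : sMdual) : Prop := forall m : sM, m a = 0 -> xi m = 0.

Definition symmetrizing (t : {linear sD -> K^o}) : Prop :=
  (forall a b, t (a * b) = t (b * a)) /\
  forall J : ideal sD, (forall x, J x -> t x = 0) -> forall x, J x -> x = 0.

(* The inverses of the isomorphisms t_l : Hom_D(M,D) -> M^* and                *)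
(* t_r : Hom_{D^op}(M,D) -> M^* given by composition with t; so                *)
(* b(x (x) xi) = tl_inv t xi x and b(xi (x) x) = tr_inv t xi x.                *)
Definition tl_inv (t : {linear sD -> K^o}) (xi : sMdual) : sM -> sD :=
  xget (fun=> 0) [set g : sM -> sD |
    [/\ forall x y, g (x + y) = g x + g y,
        forall d x, g (sM_lact d x) = d * g x
      & forall x, t (g x) = xi x]].

Definition tr_inv (t : {linear sD -> K^o}) (xi : sMdual) : sM -> sD :=
  xget (fun=> 0) [set g : sM -> sD |
    [/\ forall x y, g (x + y) = g x + g y,
        forall d x, g (sM_ract x d) = g x * d
      & forall x, t (g x) = xi x]].

(* und a and ovr a enumerate the sets written with a lower, respectively an    *)
(* upper bar; the duals are the elements x^* of M_a^*.                         *)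
Record bases := Bases {
  und_size : Q1 Q -> nat;
  und : forall a, 'I_(und_size a) -> smod S a;
  und_dual : forall a, 'I_(und_size a) -> sMdual;
  ovr_size : Q1 Q -> nat;
  ovr : forall a, 'I_(ovr_size a) -> smod S a;
  ovr_dual : forall a, 'I_(ovr_size a) -> sMdual
}.

Arguments und b {a}.
Arguments und_dual b {a}.
Arguments ovr b {a}.
Arguments ovr_dual b {a}.

Definition dual_bases (t : {linear sD -> K^o}) (B : bases) : Prop := forall a : Q1 Q,
  [/\ (forall x : smod S a, exists! d : 'I_(und_size B a) -> sdiv S (src a),
         x = \sum_j ract (sbim S a) (und B j) (d j)),
      (forall j : 'I_(und_size B a), in_dual a (und_dual B j))
    & (forall x : smod S a,
         \sum_(j < und_size B a) sM_ract (inM (und B j)) (tr_inv t (und_dual B j) (inM x)) = inM x)]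
  /\
  [/\ (forall x : smod S a, exists! d : 'I_(ovr_size B a) -> sdiv S (tgt a),
         x = \sum_j lact (sbim S a) (d j) (ovr B j)),
      (forall j : 'I_(ovr_size B a), in_dual a (ovr_dual B j))
    & (forall x : smod S a,
         \sum_(j < ovr_size B a) sM_lact (tl_inv t (ovr_dual B j) (inM x)) (inM (ovr B j)) = inM x)].

(* T(S) is the subring of finitely supported elements of its completion. *)
Definition is_potential (W : sT) : Prop :=
  [/\ exists N, forall k, (N < k)%N -> W k = 0,
      W 0%N = 0, W 1%N = 0
    & forall d, sT_D d * W = W * sT_D d].

Section Derivatives.
Variables (t : {linear sD -> K^o}) (B : bases).

(* The Casimir element of M in M^* (x)_D M is the sum over the arrows a and    *)
(* the elements x of ovr a of x^* (x) x.                                       *)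
Definition eps_l (W : sT) : sT :=
  \sum_(a : Q1 Q) \sum_(j < ovr_size B a)
     (dl (tr_inv t (ovr_dual B j)) W : sT) * sT_M (inM (ovr B j)).

Definition eps_c (W : sT) : sT :=
  fun n => \sum_(k < n) iter k eps_l W n.

Definition dcyc (xi : sMdual) (W : sT) : sT := dl (tr_inv t xi) (eps_c W).

Definition jacobian_ideal (W : sT) : ideal sT :=
  closed_ideal (fun y : sT => exists xi, y = dcyc xi W).

Definition jacobian (W : sT) : Type := rquot (jacobian_ideal W).
HB.instance Definition _ W := GRing.PzRing.on (jacobian W).

Definition jacobian_scalar (W : sT) (k : K) : jacobian W :=
  rcls (jacobian_ideal W) (sT_D (scalar_D k)).

Definition self_injective_species (W : sT) : Prop :=
  finite_dim (@jacobian_scalar W) /\ self_injective (jacobian W).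

End Derivatives.

(* Elementary tensors in M_{c1} (x) .. (x) M_{cn}, for c = [:: c1; ..; cn]. *)
Fixpoint path_tensor (c : seq (Q1 Q)) (w : sT) : Prop :=
  if c is a :: c' then
    exists m w', path_tensor c' w' /\ w = sT_M (@inM a m) * w'
  else w = 1.

Definition carried_by (P : seq (Q1 Q) -> Prop) (W : sT) : Prop :=
  exists n (c : 'I_n -> seq (Q1 Q)) (r : 'I_n -> nat) (w : 'I_n -> sT),
    (forall j, P (c j) /\ path_tensor (rot (r j) (c j)) (w j)) /\ W = \sum_j w j.

Definition minimal_cycles (W : sT) (Q2 : seq (Q1 Q) -> Prop) : Prop :=
  [/\ forall c, Q2 c -> is_cycle c,
      carried_by Q2 W
    & forall P : seq (Q1 Q) -> Prop, (forall c, P c -> Q2 c) ->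
        carried_by P W -> forall c, Q2 c -> P c].

Definition is_cut (Q2 : seq (Q1 Q) -> Prop) (C : {set Q1 Q}) : Prop :=
  forall c, Q2 c -> count (mem C) c = 1%N.

End Species.

Arguments und {K Q S} b {a}.
Arguments und_dual {K Q S} b {a}.
Arguments ovr {K Q S} b {a}.
Arguments ovr_dual {K Q S} b {a}.

Definition cut_quiver (Q : quiver) (C : {set Q1 Q}) : quiver :=
  @Quiver (Q0 Q) {a : Q1 Q | a \notin C}
    (fun a => src (val a)) (fun a => tgt (val a)).

Definition cut_species (K : fieldType) (Q : quiver) (S : species K Q) (C : {set Q1 Q}) :
    species K (cut_quiver C) :=
  @Species K (cut_quiver C) (sdiv S) (@sdivP K Q S) (fun a => smod S (val a))
    (fun a => sbim S (val a))
    (fun a => @sbim_lK K Q S (val a)) (fun a => @sbim_rK K Q S (val a)).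

Section Cut.
Variables (K : fieldType) (Q : quiver) (S : species K Q).
Variables (t : {linear sD S -> K^o}) (B : bases S) (W : sT S) (C : {set Q1 Q}).

(* The retraction of the completed tensor algebra of S onto the one of S_C,    *)
(* killing C. When C is a cut, each dcyc t B xi W with xi in M_a^*, a in C,    *)
(* only involves arrows outside C, and cut_res merely views it as an element   *)
(* of the completed tensor algebra of S_C.                                     *)
Definition cut_proj (m : sM S) : sM (cut_species S C) := fun a => m (val a).
Definition cut_res (w : sT S) : sT (cut_species S C) :=
  ctens_map (sM_bimod (cut_species S C)) cut_proj w.

Definition cut_ideal : ideal (sT (cut_species S C)) :=
  closed_ideal (fun y : sT (cut_species S C) =>
    exists a (xi : sMdual S), [/\ a \in C, in_dual a xi & y = cut_res (dcyc t B xi W)]).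

Definition cut_jacobian : Type := rquot cut_ideal.
HB.instance Definition _ := GRing.PzRing.on cut_jacobian.

Definition ccls (w : sT (cut_species S C)) : cut_jacobian := rcls cut_ideal w.

Definition cut_scalar (k : K) : cut_jacobian := ccls (@sT_D _ _ (cut_species S C) (scalar_D S k)).

Definition cidem (i : Q0 Q) : cut_jacobian := ccls (@sT_D _ _ (cut_species S C) (idem S i)).

Definition cproj (i : Q0 Q) : Type := lideal (cidem i).
HB.instance Definition _ i := GRing.Lmodule.on (cproj i).

Definition csimple (i : Q0 Q) : lmodType cut_jacobian := mod_top (cproj i).

Definition alg_term2 (i : Q0 Q) : Type :=
  dprod (fun b : {b : Q1 Q | (b \in C) && (tgt b == i)} =>
    dprod (fun _ : 'I_(und_size B (val b)) => cproj (src (val b)))).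
HB.instance Definition _ i := GRing.Lmodule.on (alg_term2 i).

Definition alg_term1 (i : Q0 Q) : Type :=
  dprod (fun a : {a : Q1 Q | (a \notin C) && (src a == i)} =>
    dprod (fun _ : 'I_(ovr_size B (val a)) => cproj (tgt (val a)))).
HB.instance Definition _ i := GRing.Lmodule.on (alg_term1 i).

(* lideal_mul e x is x e as an element of the left ideal generated by e; in    *)
(* the maps below the argument x lies in that ideal, so that x e = x.          *)
Definition alg_map2 (i : Q0 Q) (x : alg_term2 i) : alg_term1 i := fun a j =>
  lideal_mul (cidem (tgt (val a)))
    (\sum_b \sum_(k < und_size B (val b))
       (lideal_val (x b k) : cut_jacobian) *
       ccls (cut_res (dr (tl_inv t (ovr_dual B j)) (dcyc t B (und_dual B k) W)))).

Definition alg_map1 (i : Q0 Q) (y : alg_term1 i) : cproj i :=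
  lideal_mul (cidem i)
    (\sum_a \sum_(j < ovr_size B (val a))
       (lideal_val (y a j) : cut_jacobian) * ccls (cut_res (sT_M (inM (ovr B j))))).

Definition alg_map0 (i : Q0 Q) : cproj i -> csimple i := @mod_top_proj _ (cproj i).

Definition algebraic_cut : Prop :=
  finite_dim cut_scalar /\
  forall i : Q0 Q,
    [/\ injective (@alg_map2 i),
        exact_at (@alg_map2 i) (@alg_map1 i),
        exact_at (@alg_map1 i) (@alg_map0 i)
      & forall y : csimple i, exists x, alg_map0 x = y].

End Cut.

(* Main.v *)
Require Import Defs.
From HB Require Import structures.
From mathcomp Require Import all_boot all_order all_algebra all_field.
From mathcomp Require Import boolp classical_sets.

(* The Jacobian algebra A and the cut algebra L are both shown to be quotients   *)
(* by ideals containing all tensors of high degree.  The cyclic sum V of W is    *)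
(* invariant under rotation, which gives the symmetry                            *)
(* dl_b (dl_a V) = dr_a (dl_b V) of the second derivatives.  Hence the complex   *)
(*   A e_i -> sum_b A e_s(b) -> sum_a A e_t(a)                                   *)
(* is dual to a presentation by generators and relations of right modules, and   *)
(* it is exact because in the self-injective algebra A every left submodule of a *)
(* free module is an annihilator: the socle of A meets every e_i A, since the    *)
(* socles of the A e_j live at distinct vertices.                                *)
(* If C is a cut, W has degree 1 for the grading counting arrows in C, so L is a *)
(* retract of A.  An element x of L killed by the first map of the cut complex   *)
(* thus has the form x_b = y b over A, and the retraction kills b in C, so x = 0.*)
(* Exactness at the other places is the presentation of L by its relations.      *)
(* If an arrow a avoids Q_2, its relations vanish, and exactness over A applied  *)
(* to the unit vector at a would make an idempotent nilpotent.                   *)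

Set Implicit Arguments.
Unset Strict Implicit.
Unset Printing Implicit Defensive.
Import Order.TTheory GRing.Theory Num.Theory.
Local Open Scope ring_scope.

(** * Derivatives in the completed tensor algebra *)

(** The cut algebra L is compared with the Jacobian algebra A, where self-injectivity forces
    exactness. Let V be the cyclic sum of W and r_xi = [dcyc t B xi W] its derivatives. As W
    commutes with D and t is a nondegenerate trace, n rotations fix the degree n part of W
    ([rotate_iter]); hence V is invariant under rotation and its second derivatives are symmetric
    ([dl_dl_cyclic_sum]).

    Finite dimension puts all elements of large degree into the ideal J of relations
    ([finite_dim_deg_ge]), which tames the closure and makes the arrow ideal nilpotent. It follows
    that J is the sum of the r_l T and of M J ([closed_ideal_right_strip]). By symmetry, a column c
    with sum_p X_p c_p = 0 in A is, up to vertex idempotents, a combination of columns of second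
    derivatives. A row x orthogonal to all second derivatives therefore annihilates every such c,
    and [double_annihilator] makes x a left multiple of the row of arrows: this is [jacobian_exact].
    The double annihilator property comes from extending a map with values in a socle; it needs a
    socle element at every vertex, which [socle_onto] finds by counting.

    For a cut C, W has degree 1 when arrows of C are counted, so r_xi has degree 0 along arrows of C
    and 1 along the others. Projection and inclusion between the tensor algebras of S and of S_C
    then pass to the quotients, and L is a retract of A. Second derivatives along two arrows of C
    have degree -1 and vanish, so an element of the kernel of the first map, extended by zero,
    solves all equations over A. There it is y times a row of arrows of C, which the projection
    kills ([retract_kernel], [cut_kernel]). Exactness in the middle is the statement that J' is the
    sum of the T' r and of J' M ([closed_ideal_left_strip], [cut_middle]); at P_i the image is the
    radical of a local module ([radicalE]).

    If an arrow a with nonzero bimodule avoids Q_2, then W has degree 0 for {a}, so the relations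
    along a have degree -1 and vanish, against [dcyc_neq0]. *)

Section TensorAlgebraBasics.
Variables (D : pzRingType) (V : zmodType) (M : bimod D D V).
Local Notation T := (ctens M).
Local Notation cD := (ctens_D M).
Local Notation cM := (ctens_M M).

Definition llin (f : V -> D) : Prop :=
  {morph f : x y / x + y} /\ forall d x, f (lact M d x) = d * f x.
Definition rlin (g : V -> D) : Prop :=
  {morph g : x y / x + y} /\ forall d x, g (ract M x d) = g x * d.

Lemma ctens_D_mulE d (w : T) n : (cD d * w) n = d *: w n.
Proof.
rewrite -[LHS]/(ctens_mul _ _ n) /ctens_mul big_ord_recl /= big1 ?addr0 // => i _.
exact: (congr1 (fun z : T => z n) (tact0l i.+1 w)).
Qed.

Lemma ctens_M_mulE m (w : T) : cM m * w = tshift m w.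
Proof.
rewrite -[LHS]/(ctens_mul _ _) /ctens_M ctens_mul_shift.
by rewrite -[ctens_mul _ w]/(1 * w) mul1r.
Qed.

Lemma ctens_DD d d' : cD (d + d') = cD d + cD d'.
Proof. by apply: ctens_ext => -[|n]; rewrite ctensD //= addr0. Qed.
Lemma ctens_D0 : cD 0 = 0.
Proof. by apply: ctens_ext => -[|n]. Qed.
Lemma ctens_D1 : cD 1 = 1. Proof. by []. Qed.
Lemma ctens_DM d d' : cD (d * d') = cD d * cD d'.
Proof. by apply: ctens_ext => -[|n]; rewrite ctens_D_mulE //= scaler0. Qed.
Lemma ctens_D_sum (I : Type) (r : seq I) (P : pred I) F :
  cD (\sum_(i <- r | P i) F i) = \sum_(i <- r | P i) cD (F i).
Proof. exact: (big_morph cD ctens_DD ctens_D0). Qed.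

Lemma ctens_MD m m' : cM (m + m') = cM m + cM m'.
Proof. exact: tshiftDl. Qed.
Lemma ctens_M0 : cM 0 = 0.
Proof. by apply: (addrI (cM 0)); rewrite -ctens_MD !addr0. Qed.
Lemma ctens_M_sum (I : Type) (r : seq I) (P : pred I) F :
  cM (\sum_(i <- r | P i) F i) = \sum_(i <- r | P i) cM (F i).
Proof. exact: (big_morph cM ctens_MD ctens_M0). Qed.
Lemma ctens_M_lact d m : cM (lact M d m) = cD d * cM m.
Proof.
by apply: ctens_ext => -[|n]; rewrite ctens_D_mulE /= ?scaler0 // tpureZ.
Qed.
Lemma ctens_M_ract m d : cM (ract M m d) = cM m * cD d.
Proof.
rewrite ctens_M_mulE; apply: ctens_ext => -[|[|n]] //=.
  by rewrite tpure_bal; congr tpure; rewrite /GRing.scale /= mulr1.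
by rewrite !tpure0r.
Qed.
Lemma ctens_M_mul0 m (w : T) : (cM m * w) 0%N = 0.
Proof. by rewrite ctens_M_mulE. Qed.
Lemma ctens_M_mulS m (w : T) n : (cM m * w) n.+1 = tpure M m (w n).
Proof. by rewrite ctens_M_mulE. Qed.
Lemma ctens_mul_0 (x y : T) : (x * y) 0%N = (x 0%N : D) * y 0%N.
Proof. by rewrite -[LHS]/(ctens_mul _ _ 0%N) /ctens_mul big_ord1. Qed.

Section LeftDerivative.
Variable g : V -> D.
Hypothesis hg : rlin g.

Lemma dl_bal k : balanced M (fun m (u : tpow M k) => g m *: u).
Proof.
case: hg => gD gr; split=> [m m' u|m u u'|m d u]; first by rewrite gD scalerDl.
  by rewrite scalerDr.
by rewrite gr scalerA.
Qed.

Lemma dlD (x y : T) : dl g (x + y) = dl g x + dl g y.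
Proof. apply: ctens_ext => n; exact: (tliftD (@dl_bal n)). Qed.
Lemma dl0 : dl g (0 : T) = 0.
Proof. by apply: (addrI (dl g 0)); rewrite -dlD !addr0. Qed.
Lemma dl_sum (I : Type) (r : seq I) (P : pred I) (F : I -> T) :
  dl g (\sum_(i <- r | P i) F i) = \sum_(i <- r | P i) dl g (F i).
Proof. exact: (big_morph (dl g) dlD dl0). Qed.
Lemma dl_cD d : dl g (cD d) = 0.
Proof. apply: ctens_ext => n; exact: (tlift0 (@dl_bal n)). Qed.
Lemma dl_cM m (w : T) : dl g (cM m * w) = cD (g m) * w.
Proof.
apply: ctens_ext => n; rewrite ctens_D_mulE ctens_M_mulE.
exact: (tliftE (@dl_bal n)).
Qed.
End LeftDerivative.

Section RightDerivative.
Variable f : V -> D.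
Hypothesis hf : llin f.

Lemma dr_pow_lin k :
  (forall x y : tpow M k.+1, dr_pow f (x + y) = dr_pow f x + dr_pow f y) /\
  (forall d (x : tpow M k.+1), dr_pow f (d *: x) = d *: dr_pow f x).
Proof.
case: hf => fD fl; elim: k => [|k [IHD IHZ]].
  have b : balanced M (fun m (d : D^o) => f (ract M m d) : D^o).
    split=> [m m' d|m d d'|m d d']; first by rewrite ractDr fD.
      by rewrite ractDl fD.
    by rewrite ractA.
  have DD (x y : tpow M 1) : dr_pow f (x + y) = dr_pow f x + dr_pow f y.
    exact: (tliftD b).
  split=> // d x; elim/tpowS_ind: x => [|m u x IH].
    by rewrite scaler0 [dr_pow f 0](tlift0 b) scaler0.
  rewrite scalerDr !DD IH scalerDr; congr (_ + _); rewrite tpureZ.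
  by rewrite ![dr_pow f (tpure _ _ _)](tliftE b) -lractA fl.
have b : balanced M (fun m (u : tpow M k.+1) => tpure M m (dr_pow f u)).
  split=> [m m' u|m u u'|m d u]; first by rewrite tpureDl.
    by rewrite IHD tpureDr.
  by rewrite IHZ tpure_bal.
have DD (x y : tpow M k.+2) : dr_pow f (x + y) = dr_pow f x + dr_pow f y.
  exact: (tliftD b).
split=> // d x; elim/tpowS_ind: x => [|m u x IH].
  by rewrite scaler0 [dr_pow f 0](tlift0 b) scaler0.
rewrite scalerDr !DD IH scalerDr; congr (_ + _); rewrite tpureZ.
by rewrite ![dr_pow f (tpure _ _ _)](tliftE b) tpureZ.
Qed.

Lemma dr_pow1 m (d : D) : dr_pow f (tpure M m (d : D^o) : tpow M 1) = f (ract M m d).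
Proof.
case: hf => fD fl.
have b : balanced M (fun m (d : D^o) => f (ract M m d) : D^o).
  split=> [m1 m2 d1|m1 d1 d2|m1 d1 d2]; first by rewrite ractDr fD.
    by rewrite ractDl fD.
  by rewrite ractA.
exact: (tliftE b).
Qed.

Lemma dr_powS k m (u : tpow M k.+1) :
  dr_pow f (tpure M m u : tpow M k.+2) = tpure M m (dr_pow f u).
Proof.
have [IHD IHZ] := dr_pow_lin k.
have b : balanced M (fun m (u : tpow M k.+1) => tpure M m (dr_pow f u)).
  split=> [m1 m2 u1|m1 u1 u2|m1 d u1]; first by rewrite tpureDl.
    by rewrite IHD tpureDr.
  by rewrite IHZ tpure_bal.
exact: (tliftE b).
Qed.

Lemma drD (x y : T) : dr f (x + y) = dr f x + dr f y.
Proof. by apply: ctens_ext => n; apply: (dr_pow_lin n).1. Qed.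
Lemma dr0 : dr f (0 : T) = 0.
Proof. by apply: (addrI (dr f 0)); rewrite -drD !addr0. Qed.
Lemma dr_sum (I : Type) (r : seq I) (P : pred I) (F : I -> T) :
  dr f (\sum_(i <- r | P i) F i) = \sum_(i <- r | P i) dr f (F i).
Proof. exact: (big_morph (dr f) drD dr0). Qed.
Lemma dr_cD d : dr f (cD d) = 0.
Proof.
apply: ctens_ext => n; rewrite /dr /=; apply: (addrI (dr_pow f 0)).
by rewrite -(dr_pow_lin n).1 !addr0.
Qed.
Lemma dr_cDM d (w : T) : dr f (cD d * w) = cD d * dr f w.
Proof.
by apply: ctens_ext => n; rewrite ctens_D_mulE /dr ctens_D_mulE; apply: (dr_pow_lin n).2.
Qed.
Lemma dr_cM m (w : T) :
  dr f (cM m * w) = cD (f (ract M m (w 0%N))) + cM m * dr f w.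
Proof.
apply: ctens_ext => -[|n]; rewrite ctensD /= {1}/dr ctens_M_mulS.
  by rewrite ctens_M_mul0 addr0 dr_pow1.
by rewrite dr_powS ctens_M_mulS add0r.
Qed.
End RightDerivative.

Variables (I : finType) (Y : I -> V) (gY : I -> V -> D).
Hypothesis gY_lin : forall i, rlin (gY i).
Hypothesis casY : forall x, \sum_i ract M (Y i) (gY i x) = x.

(** The dual basis [Y], [gY] stands in for a basis of paths: peeling off the leftmost factor reduces
    identities to multiples of [cM (Y i)] and an induction on the degree. *)
Lemma dl_decomp (w : T) : w = cD (w 0%N) + \sum_i cM (Y i) * dl (gY i) w.
Proof.
apply: ctens_ext => -[|n]; rewrite ctensD ctens_sumE /=.
  by rewrite big1 ?addr0 // => i _; rewrite ctens_M_mul0.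
rewrite add0r.
transitivity (\sum_i tpure M (Y i) (dl_pow (gY i) (w n.+1))); last first.
  by apply: eq_bigr => i _; rewrite ctens_M_mulS.
elim/tpowS_ind: (w n.+1) => [|m u x IH].
  rewrite big1 // => i _; rewrite [dl_pow _ _](tlift0 (dl_bal (gY_lin i) n)).
  by rewrite tpure0r.
rewrite {1}IH -{1}(casY m).
rewrite (big_morph (fun m => tpure M m u) (id1 := 0) (op1 := +%R)); first last.
- by apply: (addrI (tpure M 0 u)); rewrite -tpureDl !addr0.
- by move=> a b; rewrite tpureDl.
rewrite -big_split; apply: eq_bigr => i _ /=.
rewrite [dl_pow _ (_ + x)](tliftD (dl_bal (gY_lin i) n)) tpureDr; congr (_ + _).
by rewrite tpure_bal (tliftE (dl_bal (gY_lin i) n)).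
Qed.

(** If x had a degree 0 part, the leftmost factor of the product could come from y; [dr_mul] has the
    mirror condition. *)
Lemma dl_mul g (x y : T) : rlin g -> x 0%N = 0 -> dl g (x * y) = dl g x * y.
Proof.
move=> hg x0; rewrite (dl_decomp x) x0 ctens_D0 add0r !(mulr_suml, dl_sum hg).
by apply: eq_bigr => i _; rewrite -mulrA !(dl_cM hg) mulrA.
Qed.

Lemma dr_mul f (x y : T) : llin f -> y 0%N = 0 -> dr f (x * y) = x * dr f y.
Proof.
move=> hf y0; apply: ctens_ext => n; elim: n x => [|n IH] x.
  rewrite ctens_mul_0 (dl_decomp x) mulrDl (drD hf) (dr_cDM hf) ctensD ctens_D_mulE ctensD.
  rewrite mulr_suml (dr_sum hf) !ctens_sumE /=.
  rewrite [X in _ + X = _]big1 => [|i _]; last first.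
    rewrite -mulrA (dr_cM hf) ctensD ctens_M_mul0 addr0 /= ctens_mul_0 y0 mulr0.
    rewrite /= -[ract _ _ _]/(ract M (Y i) 0); have [fD fl] := hf.
    have r0 : ract M (Y i) 0 = 0.
      by apply: (addrI (ract M (Y i) 0)); rewrite -ractDl !addr0.
    by rewrite r0; apply: (addrI (f 0)); rewrite -fD !addr0.
  rewrite [X in _ = (_ + X) * _]big1 => [|i _]; last by rewrite ctens_M_mul0.
  by rewrite !addr0.
rewrite (dl_decomp x) !mulrDl (drD hf) (dr_cDM hf) !ctensD; congr (_ + _).
rewrite !mulr_suml (dr_sum hf) !ctens_sumE; apply: eq_bigr => i _.
rewrite -!mulrA (dr_cM hf) ctensD /= add0r !ctens_M_mulS; congr tpure.
exact: IH.
Qed.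

Lemma dl_dr f g (w : T) : llin f -> rlin g -> dl g (dr f w) = dr f (dl g w).
Proof.
move=> hf hg; rewrite [in LHS](dl_decomp w) [in RHS](dl_decomp w).
rewrite (drD hf) (dr_cD hf) add0r (dlD hg) (dl_cD hg) add0r.
rewrite (dr_sum hf) !(dl_sum hg) (dr_sum hf); apply: eq_bigr => i _.
by rewrite (dr_cM hf) (dlD hg) (dl_cD hg) add0r !(dl_cM hg) (dr_cDM hf).
Qed.

Lemma ctens_mul_M_S m (x : T) n : x n = 0 -> (x * cM m) n.+1 = 0.
Proof.
elim: n x => [|n IH] x xn; rewrite (dl_decomp x) mulrDl mulr_suml ctensD ctens_D_mulE;
  rewrite ctens_sumE big1 ?addr0 => [|i _].
- by rewrite xn scale0r.
- by rewrite -mulrA ctens_M_mulS ctens_mul_0 /= mulr0 tpure0r.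
- by rewrite /= tpure0r scaler0.
rewrite -mulrA ctens_M_mulS IH ?tpure0r // /dl xn.
exact: (tlift0 (dl_bal (gY_lin i) n)).
Qed.

Variables (J : finType) (X : J -> V) (fX : J -> V -> D).
Hypothesis fX_lin : forall j, llin (fX j).
Hypothesis casX : forall x, \sum_j lact M (fX j x) (X j) = x.

(** Tensor powers are bracketed to the right, so the last factor is not directly accessible: factors
    are peeled off the left, and the second Casimir identity enters only at the last one. *)
Lemma dr_decomp (w : T) : w = cD (w 0%N) + \sum_j dr (fX j) w * cM (X j).
Proof.
apply: ctens_ext => n; elim: n w => [|n IH] w.
  rewrite ctensD ctens_sumE /= big1 ?addr0 // => j _.
  by rewrite ctens_mul_0 /= [LHS]mulr0.
rewrite [in LHS](dl_decomp w) !ctensD; congr (_ + _).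
rewrite [in RHS](dl_decomp w).
under [in RHS]eq_bigr => j _ do rewrite (drD (fX_lin j)) (dr_cD (fX_lin j)) add0r
  (dr_sum (fX_lin j)) mulr_suml.
rewrite exchange_big /= !ctens_sumE; apply: eq_bigr => i _.
set z := dl _ w; rewrite ctens_M_mulS (IH z).
under [in RHS]eq_bigr => j _ do rewrite (dr_cM (fX_lin j)) mulrDl -ctens_M_lact -mulrA.
rewrite big_split /= -ctens_M_sum casX -mulr_sumr ctens_M_ract !ctensD !ctens_M_mulS.
by rewrite -tpureDr.
Qed.

End TensorAlgebraBasics.

(** * Cyclic invariance *)

Section CyclicInvariance.
Variables (D : pzRingType) (V : zmodType) (M : bimod D D V).
Local Notation T := (ctens M).
Local Notation cD := (ctens_D M).
Local Notation cM := (ctens_M M).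

Variables (Z : zmodType) (t : D -> Z).
Hypothesis trD : {morph t : x y / x + y}.
Hypothesis tC : forall a b, t (a * b) = t (b * a).
Hypothesis t_nondeg : forall x, (forall d, t (x * d) = 0) -> x = 0.

(** Both maps represent one functional on V through t, namely its images under t_l^{-1} and
    t_r^{-1}. *)
Definition dual_pair (f g : V -> D) : Prop :=
  [/\ llin M f, rlin M g & forall x, t (f x) = t (g x)].

Lemma rlin_eq g g' : rlin M g -> rlin M g' -> (forall x, t (g x) = t (g' x)) -> g = g'.
Proof.
move=> [_ gr] [_ gr'] tt; apply: functional_extensionality_dep => x.
have t0 : t 0 = 0 by apply: (addrI (t 0)); rewrite -trD !addr0.
apply/eqP; rewrite -subr_eq0; apply/eqP/t_nondeg => d.
apply: (addrI (t (g' x * d))); rewrite -trD -mulrDl addrC subrK addr0.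
by rewrite -gr -gr' tt.
Qed.

Variables (I : finType) (Y : I -> V) (gY : I -> V -> D).
Hypothesis gY_lin : forall i, rlin M (gY i).
Hypothesis casY : forall x, \sum_i ract M (Y i) (gY i x) = x.
Variables (J : finType) (X : J -> V) (fX gX : J -> V -> D).
Hypothesis fgX : forall j, dual_pair (fX j) (gX j).
Hypothesis casX : forall x, \sum_j lact M (fX j x) (X j) = x.

Let fX_lin j : llin M (fX j). Proof. by case: (fgX j). Qed.
Let gX_lin j : rlin M (gX j). Proof. by case: (fgX j). Qed.

Definition central (w : T) : Prop := forall d, cD d * w = w * cD d.
(** Carries the leftmost factor to the right end; for the bases of a species this is [eps_l], see
    [eps_lE]. *)
Definition rotate (w : T) : T := \sum_j dl (gX j) w * cM (X j).

Lemma dl_cDr g (w : T) d : rlin M g -> dl g (w * cD d) = dl g w * cD d.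
Proof.
move=> hg; rewrite {1}(dl_decomp gY_lin casY w) mulrDl (dlD hg) -ctens_DM (dl_cD hg) add0r.
rewrite (dl_mul gY_lin casY) //; last first.
  by rewrite ctens_sumE big1 // => i _; rewrite ctens_M_mul0.
by rewrite {2}(dl_decomp gY_lin casY w) (dlD hg) (dl_cD hg) add0r.
Qed.

Lemma rlin_lact g d : rlin M g -> rlin M (fun m => g (lact M d m)).
Proof.
move=> [gD gr]; split=> [x y|e x] /=; first by rewrite lactDr gD.
by rewrite lractA gr.
Qed.

Lemma dl_cDl g (w : T) d : rlin M g ->
  dl g (cD d * w) = dl (fun m => g (lact M d m)) w.
Proof.
move=> hg; have hg' := rlin_lact d hg.
rewrite (dl_decomp gY_lin casY w) mulrDr (dlD hg) (dlD hg') -ctens_DM (dl_cD hg) (dl_cD hg').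
rewrite mulr_sumr (dl_sum hg) (dl_sum hg'); congr (_ + _); apply: eq_bigr => i _.
by rewrite mulrA -ctens_M_lact (dl_cM hg) (dl_cM hg').
Qed.

Lemma rlin_sum (h : J -> V -> D) : (forall j, rlin M (h j)) ->
  rlin M (fun m => \sum_j h j m).
Proof.
move=> hl; split=> [x y|d x].
  by rewrite -big_split; apply: eq_bigr => j _; case: (hl j).
by rewrite mulr_suml; apply: eq_bigr => j _; case: (hl j).
Qed.

Lemma dl_fun_sum (h : J -> V -> D) (w : T) : (forall j, rlin M (h j)) ->
  \sum_j dl (h j) w = dl (fun m => \sum_j h j m) w.
Proof.
move=> hl; have hs := rlin_sum hl.
rewrite (dl_decomp gY_lin casY w) (dlD hs) (dl_cD hs) add0r (dl_sum hs).
under eq_bigr => j _ do rewrite (dlD (hl j)) (dl_cD (hl j)) add0r (dl_sum (hl j)).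
rewrite exchange_big; apply: eq_bigr => i _ /=.
rewrite (dl_cM hs) ctens_D_sum mulr_suml; apply: eq_bigr => j _.
by rewrite (dl_cM (hl j)).
Qed.

(** Centrality moves [f (X j)] through w into the argument of the derivative. The resulting map m
    |-> sum_j gX_j(f(X_j) m) is right linear with the same trace as f, hence equals g. *)
Lemma dl_dual f g (w : T) : dual_pair f g -> central w ->
  \sum_j dl (gX j) w * cD (f (X j)) = dl g w.
Proof.
move=> [hf hg tfg] cw.
under eq_bigr => j _ do rewrite -(dl_cDr _ _ (gX_lin j)) -cw (dl_cDl _ _ (gX_lin j)).
rewrite dl_fun_sum => [|j]; last exact: rlin_lact.
congr dl; apply: rlin_eq => //; first by apply: rlin_sum => j; apply: rlin_lact.
move=> x; have t0 : t 0 = 0 by apply: (addrI (t 0)); rewrite -trD !addr0.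
have [fD fl] := hf.
have f0 : f 0 = 0 by apply: (addrI (f 0)); rewrite -fD !addr0.
rewrite -tfg -[in RHS](casX x) (big_morph f fD f0) !(big_morph t trD t0).
apply: eq_bigr => j _; have [[_ fXl] _ <-] := fgX j.
by rewrite fl fXl tC.
Qed.

Lemma dr_rotate f g (w : T) : dual_pair f g -> central w -> dr f (rotate w) = dl g w.
Proof.
move=> fg cw; have [hf _ _] := fg; rewrite -(dl_dual fg cw) (dr_sum hf).
apply: eq_bigr => j _; rewrite (dr_mul gY_lin casY) //; congr (_ * _).
by rewrite -[cM _]mulr1 (dr_cM hf) -ctens_D1 (dr_cD hf) mulr0 addr0 ract1.
Qed.

(** Sliding d through [X j] produces the coefficients fX_k(X_j d); the functional m |-> fX_k(m d) is
    dual to m |-> d gX_k(m), so [dl_dual] resums them. *)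
Lemma rotate_central (w : T) : central w -> central (rotate w).
Proof.
move=> cw d; rewrite /rotate mulr_sumr mulr_suml.
have exp j : cM (ract M (X j) d) = \sum_k cD (fX k (ract M (X j) d)) * cM (X k).
  by rewrite -[in LHS](casX (ract M _ _)) ctens_M_sum; apply: eq_bigr => k _; rewrite ctens_M_lact.
under [RHS]eq_bigr => j _ do rewrite -mulrA -ctens_M_ract exp mulr_sumr.
rewrite exchange_big /=; apply: eq_bigr => k _.
under eq_bigr => j _ do rewrite mulrA.
rewrite -mulr_suml; have [[fD fl] [gD gr] tfg] := fgX k.
have dual' : dual_pair (fun m => fX k (ract M m d)) (fun m => d * gX k m).
  split=> [||x]; last by rewrite tfg gr tC.
    by split=> [x y|e x] /=; [rewrite ractDr fD | rewrite -lractA fl].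
  by split=> [x y|e x] /=; [rewrite gD mulrDr | rewrite gr mulrA].
rewrite (dl_dual dual' cw); have [_ hg' _] := dual'; rewrite mulrA; congr (_ * _).
rewrite (dl_decomp gY_lin casY w) (dlD hg') (dlD (gX_lin k)) (dl_cD hg') !(dl_cD (gX_lin k)).
rewrite !add0r (dl_sum hg') (dl_sum (gX_lin k)) mulr_sumr; apply: eq_bigr => i _.
by rewrite (dl_cM hg') (dl_cM (gX_lin k)) ctens_DM mulrA.
Qed.

(** [dr_seq] starts with the last index and [dl_seq] with the first, so on a tensor of degree
    [size js] both contract the k-th factor with the k-th index. *)
Definition dr_seq (js : seq J) (w : T) : T := foldr (fun j z => dr (fX j) z) w js.
Definition dl_seq (js : seq J) (w : T) : T := foldl (fun z j => dl (gX j) z) w js.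

Lemma dl_dr_seq g js (w : T) : rlin M g -> dl g (dr_seq js w) = dr_seq js (dl g w).
Proof. by move=> hg; elim: js => //= j js <-; rewrite (dl_dr gY_lin casY). Qed.
Lemma dr_dl_seq f js (w : T) : llin M f -> dr f (dl_seq js w) = dl_seq js (dr f w).
Proof. by move=> hf; elim: js w => //= j js IH w; rewrite IH (dl_dr gY_lin casY). Qed.

Lemma dr_seq_rotate js (w : T) : central w ->
  dr_seq js (iter (size js) rotate w) = dl_seq js w.
Proof.
elim: js w => //= j js IH w cw; rewrite -iterS iterSr IH; last exact: rotate_central.
by rewrite dr_dl_seq // (dr_rotate (fgX j)).
Qed.

(** On a tensor of m and d in degree 1 the derivatives are f(m d) and g(m) d = g(m d), which have
    equal traces. *)
Lemma trace_dr_dl f g (w : T) : dual_pair f g ->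
  t ((dr f w : T) 0%N : D) = t ((dl g w : T) 0%N : D).
Proof.
move=> [hf hg tfg]; have t0 : t 0 = 0 by apply: (addrI (t 0)); rewrite -trD !addr0.
rewrite (dl_decomp gY_lin casY w) (drD hf) (dlD hg) (dr_cD hf) (dl_cD hg) !add0r.
rewrite (dr_sum hf) (dl_sum hg) !ctens_sumE /= !(big_morph t trD t0).
apply: eq_bigr => i _; rewrite (dr_cM hf) (dl_cM hg) ctensD ctens_M_mul0 addr0 ctens_D_mulE.
by rewrite tfg (proj2 hg).
Qed.

Lemma trace_dr_dl_seq js (w : T) :
  t ((dr_seq js w) 0%N : D) = t ((dl_seq js w) 0%N : D).
Proof.
elim: js w => //= j js IH w; rewrite (trace_dr_dl _ (fgX j)).
by rewrite dl_dr_seq.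
Qed.

(** The traces of the two contractions agree for all d w = w d; nondegeneracy of t then identifies
    the contractions themselves. *)
Lemma dr_seq_dl_seq0 js (w : T) : central w -> (dr_seq js w) 0%N = (dl_seq js w) 0%N.
Proof.
move=> cw; set a := dr_seq _ _ _; set b := dl_seq _ _ _.
have t0 : t 0 = 0 by apply: (addrI (t 0)); rewrite -trD !addr0.
have dr_l d : dr_seq js (cD d * w) = cD d * dr_seq js w.
  by elim: (js) => //= j s ->; rewrite dr_cDM.
have dl_r d : dl_seq js (w * cD d) = dl_seq js w * cD d.
  by elim: (js) (w) => //= j s IH z; rewrite dl_cDr // IH.
apply/eqP; rewrite -subr_eq0; apply/eqP; apply: (@t_nondeg (a - b : D)) => d.
apply: (addrI (t ((b : D) * d))); rewrite -trD -mulrDl addrC subrK addr0.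
rewrite tC; have := trace_dr_dl_seq js (cD d * w).
by rewrite dr_l cw dl_r ctens_D_mulE ctens_mul_0.
Qed.

(** A tensor is recovered from its contractions with a dual basis by repeated use of [dr_decomp]. *)
Lemma dr_seq_eq0 n (z : T) :
  (forall js, size js = n -> (dr_seq js z) 0%N = 0) -> z n = 0.
Proof.
elim: n z => [z h|n IH z h]; first exact: (h [::]).
rewrite (dr_decomp gY_lin casY fX_lin casX z) ctensD /= add0r ctens_sumE big1 // => j _.
apply: (ctens_mul_M_S gY_lin casY); apply: IH => js sz.
by have := h (rcons js j); rewrite size_rcons sz /dr_seq foldr_rcons; apply.
Qed.

Lemma rotateD (x y : T) : rotate (x + y) = rotate x + rotate y.
Proof.
by rewrite -big_split; apply: eq_bigr => j _; rewrite (dlD (gX_lin j)) mulrDl.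
Qed.
Lemma rotate0 : rotate 0 = 0.
Proof. by apply: (addrI (rotate 0)); rewrite -rotateD !addr0. Qed.

Lemma dr_seqD js (x y : T) : dr_seq js (x + y) = dr_seq js x + dr_seq js y.
Proof. by elim: js => //= j js ->; rewrite drD. Qed.

(* t identifies the complete contractions of w from the left and from the right, *)
(* and each rotation turns a right derivative into a left one.                   *)
Lemma rotate_iter n (w : T) : central w -> iter n rotate w n = w n.
Proof.
move=> cw; apply/eqP; rewrite -subr_eq0; apply/eqP.
rewrite -[LHS]/((iter n rotate w - w) n); apply: dr_seq_eq0 => js sz.
have dN : dr_seq js (- w) = - dr_seq js w.
  apply: (addrI (dr_seq js w)); rewrite -dr_seqD !subrr.
  by apply: (addrI (dr_seq js 0)); rewrite -dr_seqD !addr0.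
rewrite dr_seqD dN ctensD -sz dr_seq_rotate // -dr_seq_dl_seq0 //.
exact: subrr.
Qed.

Lemma rotate_loc (z : T) n : z n = 0 -> rotate z n = 0.
Proof.
rewrite /rotate ctens_sumE; case: n => [|n] zn; apply: big1 => j _.
  by rewrite ctens_mul_0 /= [LHS]mulr0.
apply: (ctens_mul_M_S gY_lin casY); rewrite /dl zn.
exact: (tlift0 (dl_bal (gX_lin j) n)).
Qed.

Lemma mul_cDr_loc (z : T) d n : z n = 0 -> (z * cD d) n = 0.
Proof.
elim: n z => [|n IH] z zn; first by rewrite ctens_mul_0 zn /= [LHS]mul0r.
rewrite (dl_decomp gY_lin casY z) mulrDl ctensD -ctens_DM /= add0r mulr_suml ctens_sumE.
rewrite big1 // => i _; rewrite -mulrA ctens_M_mulS IH ?tpure0r //.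
by rewrite /dl zn; apply: (tlift0 (dl_bal (gY_lin i) n)).
Qed.

Definition cyclic_sum (w : T) : T := fun n => \sum_(k < n) iter k rotate w n.

(** The number of rotations in [cyclic_sum] varies with the degree, so it is no finite sum of
    iterates. [psum w n] is one that agrees with it in degree n, and by [rotate_loc] this suffices
    to rotate it there. *)
Let psum (w : T) n : T := \sum_(k < n) iter k rotate w.

Let cyclic_psum w n : (cyclic_sum w - psum w n) n = 0.
Proof. by rewrite -[LHS]/(_ - psum w n n) /psum ctens_sumE subrr. Qed.

Let iter_central w k : central w -> central (iter k rotate w).
Proof. by move=> cw; elim: k => //= k; apply: rotate_central. Qed.

Lemma cyclic_sum_central (w : T) : central w -> central (cyclic_sum w).
Proof.
move=> cw d; apply: ctens_ext => n; set c := cyclic_sum w.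
rewrite -(subrK (psum w n) c) mulrDl mulrDr !ctensD ctens_D_mulE cyclic_psum scaler0.
rewrite (mul_cDr_loc _ (cyclic_psum w n)) !add0r.
congr (_ n); rewrite mulr_sumr mulr_suml; apply: eq_bigr => k _.
exact: iter_central.
Qed.

(** Rotation shifts the n summands in degree n, and the one pushed past the end is the first one
    again by [rotate_iter]. *)
Lemma rotate_cyclic_sum (w : T) : central w -> rotate (cyclic_sum w) = cyclic_sum w.
Proof.
move=> cw; apply: ctens_ext => n; set c := cyclic_sum w.
rewrite -{1}(subrK (psum w n) c) rotateD ctensD (rotate_loc (cyclic_psum w n)) add0r.
rewrite (big_morph rotate rotateD rotate0) ctens_sumE /c /cyclic_sum.
case: n => [|n]; first by rewrite !big_ord0.
rewrite big_ord_recr [RHS]big_ord_recl addrC /=; congr (_ + _).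
by rewrite -[LHS]/(iter n.+1 rotate w n.+1) rotate_iter.
Qed.

Lemma dr_cyclic_sum f g (w : T) : dual_pair f g -> central w ->
  dr f (cyclic_sum w) = dl g (cyclic_sum w).
Proof.
move=> fg cw; rewrite -{1}(rotate_cyclic_sum cw) (dr_rotate fg) //.
exact: cyclic_sum_central.
Qed.

(** Symmetry of the second derivatives: invariance turns one left derivative into a right one, and
    derivatives at opposite ends commute. *)
Lemma dl_dl_cyclic_sum f g g' (w : T) : dual_pair f g -> rlin M g' -> central w ->
  dl g' (dl g (cyclic_sum w)) = dr f (dl g' (cyclic_sum w)).
Proof.
move=> fg hg' cw; rewrite -(dr_cyclic_sum fg cw).
by case: fg => hf _ _; rewrite (dl_dr gY_lin casY).
Qed.

End CyclicInvariance.

(** * Closed ideals *)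

Section IdealTheory.
Variables (R : pzRingType) (J : ideal R).

Lemma idealN x : J x -> J (- x).
Proof. by move=> Jx; rewrite -sub0r; apply: idealB => //; apply: ideal0. Qed.
Lemma idealD x y : J x -> J y -> J (x + y).
Proof. by move=> Jx Jy; rewrite -[y]opprK; apply: idealB => //; apply: idealN. Qed.
Lemma ideal_sum (I : Type) (r : seq I) (P : pred I) (F : I -> R) :
  (forall i, P i -> J (F i)) -> J (\sum_(i <- r | P i) F i).
Proof. by move=> JF; apply: big_ind => //; [apply: ideal0 | apply: idealD]. Qed.

Lemma rcls0P x : rcls J x = 0 <-> J x.
Proof.
have -> : 0 = rcls J 0.
  by apply: (addrI (rcls J 0)); rewrite -rclsD !addr0.
by split=> [/rcls_eq|Jx]; [rewrite subr0 | apply/rcls_eq; rewrite subr0].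
Qed.
Lemma rcls0 : rcls J 0 = 0. Proof. by apply/rcls0P; apply: ideal0. Qed.
Lemma rcls_sum (I : Type) (r : seq I) (P : pred I) (F : I -> R) :
  rcls J (\sum_(i <- r | P i) F i) = \sum_(i <- r | P i) rcls J (F i).
Proof. exact: (big_morph (rcls J) (@rclsD _ J) rcls0). Qed.
Lemma rclsN x : rcls J (- x) = - rcls J x.
Proof. by apply: (addrI (rcls J x)); rewrite -rclsD !subrr rcls0. Qed.
Lemma rclsX x n : rcls J (x ^+ n) = rcls J x ^+ n.
Proof. by elim: n => [|n IH]; rewrite ?expr0 // !exprS rclsM IH. Qed.
End IdealTheory.

(** * Degree filtration, and stripping arrows off a closed ideal *)

Section ClosedIdeals.
Variables (D : pzRingType) (V : zmodType) (M : bimod D D V).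
Local Notation T := (ctens M).
Local Notation cD := (ctens_D M).
Local Notation cM := (ctens_M M).

Definition deg_ge (n : nat) (w : T) : Prop := forall k, (k < n)%N -> w k = 0.

Lemma deg_geD n x y : deg_ge n x -> deg_ge n y -> deg_ge n (x + y).
Proof. by move=> hx hy k kn; rewrite ctensD hx // hy // addr0. Qed.
Lemma deg_geN n x : deg_ge n x -> deg_ge n (- x).
Proof. by move=> hx k kn; rewrite -[LHS]/(- x k) hx //; apply: oppr0. Qed.
Lemma deg_ge_sum n (I : Type) (r : seq I) (P : pred I) (F : I -> T) :
  (forall i, P i -> deg_ge n (F i)) -> deg_ge n (\sum_(i <- r | P i) F i).
Proof. by move=> JF; apply: big_ind => //; apply: deg_geD. Qed.
Lemma deg_ge_cD n d x : deg_ge n x -> deg_ge n (cD d * x).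
Proof. by move=> hx k kn; rewrite ctens_D_mulE hx // scaler0. Qed.
Lemma deg_geW m n x : (m <= n)%N -> deg_ge n x -> deg_ge m x.
Proof. by move=> mn hx k km; apply: hx; apply: leq_trans mn. Qed.
Lemma deg_ge_dl g n x : rlin M g -> deg_ge n.+1 x -> deg_ge n (dl g x).
Proof. by move=> hg hx k kn; rewrite /dl hx //; apply: (tlift0 (dl_bal hg k)). Qed.
Lemma deg_ge_dr f n x : llin M f -> deg_ge n.+1 x -> deg_ge n (dr f x).
Proof.
move=> hf hx k kn; rewrite /dr hx //; apply: (addrI (dr_pow f 0)).
by rewrite -(dr_pow_lin hf k).1 !addr0.
Qed.

Variable P : T -> Prop.
Local Notation J := (closed_ideal P).

Lemma closed_genW x : P x -> J x.
Proof. by move=> Px n; exists x => // I; apply. Qed.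

Lemma closed_ideal_closed x :
  (forall n, exists2 y, J y & deg_ge n (x - y)) -> J x.
Proof.
move=> h n; have [y /(_ n) [y' gy' yy'] xy] := h n.+1.
exists y' => // k kn; rewrite -yy' //; apply/eqP; rewrite -subr_eq0; apply/eqP.
exact: xy.
Qed.

Lemma closed_ideal_approx x n : J x ->
  exists2 y, gen_ideal P y & deg_ge n (x - y).
Proof.
move=> /(_ n) [y gy xy]; exists y => // k kn.
by rewrite -[LHS]/(x k - y k) (xy k (ltnW kn)); apply: subrr.
Qed.

Lemma gen_ideal_sub (I : ideal T) x : (forall y, P y -> I y) -> gen_ideal P x -> I x.
Proof. by move=> h; apply. Qed.

(* Otherwise, J being closed, one finds elements of increasing degrees that are *)
(* linearly independent modulo J.                                              *)
Lemma finite_dim_deg_ge (K : fieldType) (sc : K -> D) :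
  {morph sc : a b / a + b} -> {morph sc : a b / a * b} -> sc 1 = 1 ->
  finite_dim (fun k => rcls J (cD (sc k))) ->
  exists N, forall w, deg_ge N w -> J w.
Proof.
move=> scD scM sc1 [n [v vP]]; apply: contrapT => noN.
(* Without a bound there is an element of degree at least N and, J being closed, a degree m such
   that no element of J agrees with it below m. *)
have step N : {p : T * nat | deg_ge N p.1 /\
    forall y, J y -> ~ deg_ge p.2 (p.1 - y)}.
  apply: cid; apply: contrapT => h; apply: noN; exists N => w hw.
  apply: closed_ideal_closed => m; apply: contrapT => h'; apply: h.
  by exists (w, m); split=> // y Jy hy; apply: h'; exists y.
pose nx N := sval (step N).
have nx1 N : deg_ge N (nx N).1 by case: (svalP (step N)).
have nx2 N y : J y -> ~ deg_ge (nx N).2 ((nx N).1 - y).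
  by case: (svalP (step N)) => _; apply.
have nx3 N : (N <= (nx N).2)%N.
  rewrite leqNgt; apply/negP => lt; apply: (nx2 N 0); first exact: ideal0.
  by rewrite subr0; apply: deg_geW (ltnW lt) (nx1 N).
(* Each new element starts in the degree below which its predecessor is already separated from J. *)
pose Ns j := iter j (fun N => (nx N).2) 0%N.
have Nsm i j : (i <= j)%N -> (Ns i <= Ns j)%N.
  elim: j => [|j IH]; first by rewrite leqn0 => /eqP ->.
  rewrite leq_eqVlt ltnS => /predU1P [-> //|/IH h].
  exact: leq_trans h (nx3 _).
pose w j := (nx (Ns j)).1.
have [c cP] := boolp.choice (fun j : 'I_n.+1 => vP (rcls J (w j))).
pose C := \matrix_(j < n.+1, i < n) c j i.
have: kermx C != 0.
  rewrite kermx_eq0 /row_free; apply/eqP => e.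
  by have := rank_leq_col C; rewrite e ltnn.
move=> /rowV0Pn [l /sub_kermxP lC /rV0Pn [j0 lj0]].
pose Pj (j : 'I_n.+1) := l 0 j != 0.
(* Solving the relation for its first term writes [w j] modulo J as a combination of later elements,
   all of degree at least [Ns j.+1], against the choice of that degree. *)
have [j lj jmin] := arg_minnP (fun j : 'I_n.+1 => val j) (lj0 : Pj j0).
pose mu k := (l 0 j)^-1 * l 0 k.
have Jz : J (\sum_k cD (sc (mu k)) * w k).
  apply/rcls0P; rewrite rcls_sum.
  under eq_bigr => k _ do rewrite rclsM cP mulr_sumr.
  rewrite exchange_big big1 //= => i _.
  under eq_bigr => k _ do rewrite mulrA -rclsM -ctens_DM -scM.
  rewrite -mulr_suml -rcls_sum -ctens_D_sum.
  have sc0 : sc 0 = 0 by apply: (addrI (sc 0)); rewrite -scD !addr0.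
  have lc : \sum_k l 0 k * c k i = 0.
    have /rowP/(_ i) := lC; rewrite !mxE => lCi.
    by rewrite -[RHS]lCi; apply: eq_bigr => k _; rewrite mxE.
  have -> : \sum_k sc (mu k * c k i) = sc (\sum_k mu k * c k i).
    by rewrite (big_morph sc scD sc0).
  have -> : \sum_k mu k * c k i = (l 0 j)^-1 * \sum_k l 0 k * c k i.
    by rewrite mulr_sumr; apply: eq_bigr => k _; rewrite mulrA.
  by rewrite lc mulr0 sc0 ctens_D0 rcls0 mul0r.
apply: (nx2 (Ns j) _ Jz); rewrite (bigD1 j) //= /mu mulVf // sc1 ctens_D1 mul1r.
rewrite opprD addNKr; apply/deg_geN/deg_ge_sum => k kj.
have [lk0|lk] := eqVneq (l 0 k) 0.
  have sc0 : sc 0 = 0 by apply: (addrI (sc 0)); rewrite -scD !addr0.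
  by rewrite lk0 mulr0 sc0 ctens_D0 mul0r.
apply: deg_ge_cD; apply: deg_geW (nx1 (Ns k)).
rewrite -[X in (X <= _)%N]/(Ns j.+1); apply: Nsm.
by rewrite ltn_neqAle jmin // eq_sym kj.
Qed.

Variable N : nat.
Hypothesis highJ : forall w, deg_ge N w -> J w.

Variables (I : finType) (Y : I -> V) (gY : I -> V -> D).
Hypothesis gY_lin : forall i, rlin M (gY i).
Hypothesis casY : forall x, \sum_i ract M (Y i) (gY i x) = x.

Lemma deg_ge_mul m n (x y : T) : deg_ge m x -> deg_ge n y -> deg_ge (m + n) (x * y).
Proof.
elim: m x => [|m IH] x hx hy.
  move=> k kn; elim: k x kn {hx} => [|k IHk] x kn; rewrite (dl_decomp gY_lin casY x);
    rewrite mulrDl ctensD ctens_D_mulE mulr_suml ctens_sumE hy // scaler0 add0r big1 // => i _.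
    by rewrite -mulrA ctens_M_mul0.
  by rewrite -mulrA ctens_M_mulS IHk ?tpure0r // ltnW.
rewrite (dl_decomp gY_lin casY x) hx // ctens_D0 add0r mulr_suml.
apply: deg_ge_sum => i _ [|k] kn; rewrite -mulrA ?ctens_M_mul0 // ctens_M_mulS IH ?tpure0r //.
exact: deg_ge_dl.
Qed.

Lemma deg_ge_exp (x : T) n : deg_ge 1 x -> deg_ge n (x ^+ n).
Proof. by move=> hx; elim: n => [//|n IH]; rewrite exprS -add1n; apply: deg_ge_mul. Qed.

Lemma deg1P (x : T) : deg_ge 1 x <-> x 0%N = 0.
Proof. by split=> [|x0 [|//]] //; apply. Qed.

Lemma deg_ge_sub0 (x : T) : deg_ge 1 (x - cD (x 0%N)).
Proof. by apply/deg1P; exact: subrr. Qed.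

Section RightStrip.
Variables (L : finType) (r : L -> T).
Hypothesis Jr : forall l, J (r l).
Hypothesis r_cD : forall d l, exists c, cD d * r l = \sum_k r k * cD (c k).
Hypothesis r_gen : forall y, P y -> exists c, y = \sum_k r k * cD (c k).

Let H (z : T) := exists (v : L -> T) (j : I -> T),
  (forall i, J (j i)) /\ z = \sum_l r l * v l + \sum_i cM (Y i) * j i.

Let H0 : H 0.
Proof.
exists (fun=> 0), (fun=> 0); split=> [i|]; first exact: ideal0.
by rewrite !big1 ?addr0 // => *; rewrite mulr0.
Qed.
Let HB x y : H x -> H y -> H (x - y).
Proof.
move=> [v [j [Jj ->]]] [v' [j' [Jj' ->]]].
exists (fun l => v l - v' l), (fun i => j i - j' i).
split=> [i|]; first exact: idealB.
rewrite opprD addrACA -!sumrB; congr (_ + _);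
  by apply: eq_bigr => *; rewrite mulrBr.
Qed.
Let HD x y : H x -> H y -> H (x + y).
Proof. by move=> Hx Hy; rewrite -[y]opprK -[- y]sub0r; apply/HB/HB. Qed.
Let Hsum (A : finType) (F : A -> T) : (forall a, H (F a)) -> H (\sum_a F a).
Proof. by move=> HF; apply: big_ind => //; apply: HD. Qed.
Let HMr a x : H x -> H (x * a).
Proof.
move=> [v [j [Jj ->]]]; exists (fun l => v l * a), (fun i => j i * a).
split=> [i|]; first exact: Defs.idealMr.
by rewrite mulrDl !mulr_suml; congr (_ + _); apply: eq_bigr => *; rewrite mulrA.
Qed.
Let HJ x : H x -> J x.
Proof.
move=> [v [j [Jj ->]]]; apply: idealD; apply: ideal_sum => *.
  by apply: Defs.idealMr.
by apply: idealMl.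
Qed.
Let HY m x : J x -> H (cM m * x).
Proof.
move=> Jx; exists (fun=> 0), (fun i => cD (gY i m) * x).
split=> [i|]; first exact: idealMl.
rewrite [X in _ = X + _]big1 ?add0r => [|*]; last by rewrite mulr0.
rewrite -[in LHS](casY m) ctens_M_sum mulr_suml.
by apply: eq_bigr => i _; rewrite ctens_M_ract mulrA.
Qed.
Let Hr l : H (r l).
Proof.
exists (fun k => (k == l)%:R), (fun=> 0); split=> [i|]; first exact: ideal0.
rewrite [X in _ = _ + X]big1 ?addr0 => [|*]; last by rewrite mulr0.
rewrite (bigD1 l) //= eqxx mulr1 big1 ?addr0 // => k /negPf ->.
by rewrite mulr0.
Qed.
Let HMl a x : H x -> H (a * x).
Proof.
move=> Hx; rewrite (dl_decomp gY_lin casY a) mulrDl mulr_suml; apply: HD; last first.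
  apply: Hsum => i; rewrite -mulrA; apply: HY; apply: idealMl; exact: HJ.
case: Hx => v [j [Jj ->]]; rewrite mulrDr !mulr_sumr; apply: HD; apply: Hsum => i.
  rewrite mulrA; apply: HMr; have [c ->] := r_cD (a 0%N) i.
  by apply: Hsum => k; apply: HMr.
by rewrite mulrA -ctens_M_lact; apply: HY.
Qed.

(** Such sums form a two-sided ideal: D preserves the span of the relations by [r_cD], and a left
    factor of positive degree puts a whole element of J behind an arrow. So the relations generate J
    modulo M J as a right module. *)
Lemma closed_ideal_right_strip z : J z -> exists (v : L -> T) (j : I -> T),
  (forall i, J (j i)) /\ z = \sum_l r l * v l + \sum_i cM (Y i) * j i.
Proof.
(* One degree more than N, because peeling off an arrow must leave coefficients that [highJ] still
   puts into J. *)
move=> /closed_ideal_approx => /(_ N.+1) [y gy zy].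
rewrite -(subrK y z) -/(H _); apply: HD; last first.
  apply: (@gen_ideal_sub (Ideal H0 HB HMl HMr)) gy => x /r_gen [c ->] /=.
  by apply: Hsum => k; apply: HMr.
rewrite (dl_decomp gY_lin casY (z - y)) zy // ctens_D0 add0r; apply: Hsum => i.
by apply: HY; apply: highJ; apply: deg_ge_dl.
Qed.
End RightStrip.

Variables (A : finType) (X : A -> V) (fX : A -> V -> D).
Hypothesis fX_lin : forall j, llin M (fX j).
Hypothesis casX : forall x, \sum_j lact M (fX j x) (X j) = x.

Section LeftStrip.
Variables (L : finType) (r : L -> T).
Hypothesis Jr : forall l, J (r l).
Hypothesis r_cD : forall d l, exists c, r l * cD d = \sum_k cD (c k) * r k.
Hypothesis r_gen : forall y, P y -> exists c, y = \sum_k cD (c k) * r k.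

Let H (z : T) := exists (u : L -> T) (j : A -> T),
  (forall i, J (j i)) /\ z = \sum_l u l * r l + \sum_i j i * cM (X i).

Let H0 : H 0.
Proof.
exists (fun=> 0), (fun=> 0); split=> [i|]; first exact: ideal0.
by rewrite !big1 ?addr0 // => *; rewrite mul0r.
Qed.
Let HB x y : H x -> H y -> H (x - y).
Proof.
move=> [v [j [Jj ->]]] [v' [j' [Jj' ->]]].
exists (fun l => v l - v' l), (fun i => j i - j' i).
split=> [i|]; first exact: idealB.
rewrite opprD addrACA -!sumrB; congr (_ + _);
  by apply: eq_bigr => *; rewrite mulrBl.
Qed.
Let HD x y : H x -> H y -> H (x + y).
Proof. by move=> Hx Hy; rewrite -[y]opprK -[- y]sub0r; apply/HB/HB. Qed.
Let Hsum (B : finType) (F : B -> T) : (forall a, H (F a)) -> H (\sum_a F a).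
Proof. by move=> HF; apply: big_ind => //; apply: HD. Qed.
Let HMl a x : H x -> H (a * x).
Proof.
move=> [v [j [Jj ->]]]; exists (fun l => a * v l), (fun i => a * j i).
split=> [i|]; first exact: idealMl.
by rewrite mulrDr !mulr_sumr; congr (_ + _); apply: eq_bigr => *; rewrite mulrA.
Qed.
Let HJ x : H x -> J x.
Proof.
move=> [v [j [Jj ->]]]; apply: idealD; apply: ideal_sum => *.
  by apply: idealMl.
by apply: Defs.idealMr.
Qed.
Let HX m x : J x -> H (x * cM m).
Proof.
move=> Jx; exists (fun=> 0), (fun i => x * cD (fX i m)).
split=> [i|]; first exact: Defs.idealMr.
rewrite [X in _ = X + _]big1 ?add0r => [|*]; last by rewrite mul0r.
rewrite -[in LHS](casX m) ctens_M_sum mulr_sumr.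
by apply: eq_bigr => i _; rewrite ctens_M_lact mulrA.
Qed.
Let Hr l : H (r l).
Proof.
exists (fun k => (k == l)%:R), (fun=> 0); split=> [i|]; first exact: ideal0.
rewrite [X in _ = _ + X]big1 ?addr0 => [|*]; last by rewrite mul0r.
rewrite (bigD1 l) //= eqxx mul1r big1 ?addr0 // => k /negPf ->.
by rewrite mul0r.
Qed.
Let HMr a x : H x -> H (x * a).
Proof.
move=> Hx; rewrite (dr_decomp gY_lin casY fX_lin casX a) mulrDr mulr_sumr.
apply: HD; last first.
  apply: Hsum => i; rewrite mulrA; apply: HX; apply: Defs.idealMr; exact: HJ.
case: Hx => v [j [Jj ->]]; rewrite mulrDl !mulr_suml; apply: HD; apply: Hsum => i.
  rewrite -mulrA; apply: HMl; have [c ->] := r_cD (a 0%N) i.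
  by apply: Hsum => k; apply: HMl.
by rewrite -mulrA -ctens_M_ract; apply: HX.
Qed.

(** The mirror image, describing J modulo J M; peeling from the right uses both dual bases. *)
Lemma closed_ideal_left_strip z : J z -> exists (u : L -> T) (j : A -> T),
  (forall i, J (j i)) /\ z = \sum_l u l * r l + \sum_i j i * cM (X i).
Proof.
move=> /closed_ideal_approx => /(_ N.+1) [y gy zy].
rewrite -(subrK y z) -/(H _); apply: HD; last first.
  apply: (@gen_ideal_sub (Ideal H0 HB HMl HMr)) gy => x /r_gen [c ->] /=.
  by apply: Hsum => k; apply: HMl.
rewrite (dr_decomp gY_lin casY fX_lin casX (z - y)) zy // ctens_D0 add0r; apply: Hsum => i.
by apply: HX; apply: highJ; apply: deg_ge_dr.
Qed.
End LeftStrip.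

End ClosedIdeals.

Section ClosedIdealMap.
Variables (D : pzRingType) (V V' : zmodType) (M : bimod D D V) (M' : bimod D D V').
Variable phi : ctens M -> ctens M'.
Hypothesis phiB : {morph phi : x y / x - y}.
Hypothesis phiM : {morph phi : x y / x * y}.
Hypothesis phi_loc : forall n w, deg_ge n w -> deg_ge n (phi w).
Variables (P : ctens M -> Prop) (P' : ctens M' -> Prop).
Hypothesis phiP : forall y, P y -> closed_ideal P' (phi y).

Let pre (x : ctens M) := closed_ideal P' (phi x).
Let pre0 : pre 0.
Proof. by rewrite /pre -(subrr 0) phiB subrr; apply: ideal0. Qed.
Let preB x y : pre x -> pre y -> pre (x - y).
Proof. by rewrite /pre phiB; apply: idealB. Qed.
Let preMl a x : pre x -> pre (a * x).
Proof. by rewrite /pre phiM; apply: idealMl. Qed.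
Let preMr a x : pre x -> pre (x * a).
Proof. by rewrite /pre phiM; apply: Defs.idealMr. Qed.

(** The preimage of the target is an ideal containing the generators, and [phi_loc] is the
    continuity that extends the inclusion to the closure. *)
Lemma closed_ideal_map x : closed_ideal P x -> closed_ideal P' (phi x).
Proof.
move=> Jx; apply: closed_ideal_closed => n.
have [y gy xy] := closed_ideal_approx n Jx.
exists (phi y); last by rewrite -phiB; apply: phi_loc.
exact: (@gen_ideal_sub _ _ _ _ (Ideal pre0 preB preMl preMr)) phiP gy.
Qed.
End ClosedIdealMap.

(** * Self-injectivity and annihilators *)

Record submodule (R : pzRingType) (V : lmodType R) := Submodule {
  submodule_car :> V -> Prop;
  submodule0 : submodule_car 0;
  submoduleP : forall a x y,
    submodule_car x -> submodule_car y -> submodule_car (a *: x + y)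
}.

Section SubmoduleTheory.
Variables (R : pzRingType) (V : lmodType R) (L : submodule V).

Lemma submoduleZ a x : L x -> L (a *: x).
Proof. by move=> Lx; rewrite -[_ *: _]addr0; apply/submoduleP/submodule0. Qed.
Lemma submoduleD x y : L x -> L y -> L (x + y).
Proof. by move=> Lx; rewrite -[x]scale1r; apply: submoduleP. Qed.
Lemma submodule_sum (I : finType) (F : I -> V) : (forall i, L (F i)) -> L (\sum_i F i).
Proof.
by move=> LF; apply: big_ind => //; [apply: submodule0 | apply: submoduleD].
Qed.

(** Modulo L one has v = p v = p^2 v = ... = 0: Nakayama's lemma for a nilpotent p. *)
Lemma submodule_nilp v p n : p ^+ n = 0 -> L (v - p *: v) -> L v.
Proof.
move=> pn Lv; suff h k : L (v - p ^+ k *: v).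
  by have := h n; rewrite pn scale0r subr0.
elim: k => [|k IH]; first by rewrite expr0 scale1r subrr; apply: submodule0.
have -> : v - p ^+ k.+1 *: v = p *: (v - p ^+ k *: v) + (v - p *: v).
  by rewrite exprS scalerBr scalerA [RHS]addrC addrA subrK.
exact: submoduleP.
Qed.
End SubmoduleTheory.

Section Adjoin.
Variables (R : pzRingType) (V : lmodType R) (L : submodule V) (v : V).

Definition adjoin : pred V := fun x => `[< exists l a, L l /\ x = l + a *: v >].

Fact adjoin_closed : submod_closed adjoin.
Proof.
split=> [|a x y /asboolP [l [b [Ll ->]]] /asboolP [l' [b' [Ll' ->]]]]; apply/asboolP.
  by exists 0, 0; split; [apply: submodule0 | rewrite scale0r addr0].
exists (a *: l + l'), (a * b + b'); split; first exact: submoduleP.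
by rewrite scalerDr scalerA scalerDl addrACA.
Qed.
HB.instance Definition _ := GRing.isSubmodClosed.Build R V adjoin adjoin_closed.

Record adjoin_sub := AdjoinSub { adjoin_val :> V; _ : adjoin_val \in adjoin }.
HB.instance Definition _ := [isSub for adjoin_val].
HB.instance Definition _ := [Choice of adjoin_sub by <:].
HB.instance Definition _ := [SubChoice_isSubLmodule of adjoin_sub by <:].

Hypothesis injR : self_injective R.
Variable s : R.
Hypothesis vs : forall a, L (a *: v) -> a * s = 0.

Fact adjoin_coef (x : adjoin_sub) : exists a, L (val x - a *: v).
Proof.
case: x => x hx; have /asboolP [l [a [Ll xE]]] := hx.
by exists a => /=; rewrite xE addrK.
Qed.

Definition adjoin_map (x : adjoin_sub) : R^o := sval (cid (adjoin_coef x)) * s.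

Lemma adjoin_mapE (x : adjoin_sub) a : L (val x - a *: v) -> adjoin_map x = a * s.
Proof.
rewrite /adjoin_map; case: cid => b /= Lb La.
apply/eqP; rewrite -subr_eq0 -mulrBl; apply/eqP/vs.
rewrite scalerBl.
have -> : b *: v - a *: v = -1 *: (val x - b *: v) + (val x - a *: v).
  by rewrite scaleN1r opprB addrA subrK.
exact: submoduleP.
Qed.

Fact adjoin_map_linear : linear adjoin_map.
Proof.
move=> a x y; have [b Lb] := adjoin_coef x; have [c Lc] := adjoin_coef y.
rewrite (adjoin_mapE Lb) (adjoin_mapE Lc) (@adjoin_mapE _ (a * b + c)).
  by rewrite mulrDl /GRing.scale /= mulrA.
have -> : val (a *: x + y) - (a * b + c) *: v =
    a *: (val x - b *: v) + (val y - c *: v).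
  by rewrite linearP /= scalerDl opprD addrACA scalerBr scalerA.
exact: submoduleP.
Qed.
HB.instance Definition _ :=
  GRing.isLinear.Build R adjoin_sub R^o *:%R adjoin_map adjoin_map_linear.

(** By [vs] the rule l + a v |-> a s is well defined on L + R v; injectivity of R extends it to
    V. *)
Lemma self_injective_ext :
  exists g : {linear V -> R^o}, g v = s /\ forall l, L l -> g l = 0.
Proof.
have [g gP] := injR (i := val : {linear adjoin_sub -> V})
  (adjoin_map : {linear adjoin_sub -> R^o}) val_inj.
have vin x (h : exists l a, L l /\ x = l + a *: v) : x \in adjoin by apply/asboolP.
exists g; split=> [|l Ll].
  have h : exists l a, L l /\ v = l + a *: v.
    by exists 0, 1; split; [apply: submodule0 | rewrite scale1r add0r].
  rewrite -[X in g X]/(val (AdjoinSub (vin v h))) gP /= (@adjoin_mapE _ 1) ?mul1r //=.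
  by rewrite scale1r subrr; apply: submodule0.
have h : exists l' a, L l' /\ l = l' + a *: v.
  by exists l, 0; split=> //; rewrite scale0r addr0.
rewrite -[X in g X]/(val (AdjoinSub (vin l h))) gP /= (@adjoin_mapE _ 0) ?mul0r //=.
by rewrite scale0r subr0.
Qed.
End Adjoin.

(** * Socles and double annihilators in a self-injective quotient *)

Section BasicAlgebra.
Variables (D : pzRingType) (V : zmodType) (M : bimod D D V).
Local Notation T := (ctens M).
Local Notation cD := (ctens_D M).
Local Notation cM := (ctens_M M).
Variables (P : T -> Prop) (N : nat).
Local Notation J := (closed_ideal P).
Local Notation A := (rquot J).
Local Notation q := (rcls J).
Hypothesis P_deg : forall y, P y -> y 0%N = 0.
Hypothesis highJ : forall w, deg_ge N w -> J w.
Variables (I : finType) (Y : I -> V) (gY : I -> V -> D).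
Hypothesis gY_lin : forall i, rlin M (gY i).
Hypothesis casY : forall x, \sum_i ract M (Y i) (gY i x) = x.

Variables (Q0 : finType) (e : Q0 -> D).
Hypothesis eC : forall i d, e i * d = d * e i.
Hypothesis e_orth : forall i j, i != j -> e i * e j = 0.
Hypothesis e_idem : forall i, e i * e i = e i.
Hypothesis e_sum : \sum_i e i = 1.
Hypothesis e_neq0 : forall i, e i <> 0.
Hypothesis e_div : forall i d, e i * d = 0 \/ exists d', d' * (e i * d) = e i.
Local Notation E i := (q (cD (e i))).

Lemma closed_ideal_deg x : J x -> x 0%N = 0.
Proof.
move=> Jx; have [y gy xy] := closed_ideal_approx 1 Jx.
pose Z (z : T) := z 0%N = 0.
have Z0 : Z 0 by [].
have ZB x' y' : Z x' -> Z y' -> Z (x' - y').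
  by move=> zx zy; rewrite /Z -[LHS]/(x' 0%N - y' 0%N) zx zy; apply: subrr.
have Zl a z : Z z -> Z (a * z) by rewrite /Z ctens_mul_0 => ->; apply: mulr0.
have Zr a z : Z z -> Z (z * a) by rewrite /Z ctens_mul_0 => ->; apply: mul0r.
have : Ideal Z0 ZB Zl Zr y by apply: gen_ideal_sub gy.
by rewrite /= /Z -[x](subrK y) ctensD (xy 0%N isT) add0r.
Qed.

(** It serves as the radical: its elements are nilpotent because high degrees lie in J. *)
Definition arrow_ideal (a : A) : Prop := exists2 w, deg_ge 1 w & q w = a.

Lemma arrow_idealMl a p : arrow_ideal p -> arrow_ideal (a * p).
Proof.
move=> [w hw <-]; have [z <-] := rcls_surj a.
by exists (z * w); rewrite ?rclsM //; apply: (deg_ge_mul gY_lin casY (m := 0)).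
Qed.
Lemma arrow_idealMr a p : arrow_ideal p -> arrow_ideal (p * a).
Proof.
move=> [w hw <-]; have [z <-] := rcls_surj a.
exists (w * z); rewrite ?rclsM //.
by rewrite -[1%N]addn0; apply: (deg_ge_mul gY_lin casY).
Qed.
Lemma arrow_idealN p : arrow_ideal p -> arrow_ideal (- p).
Proof. by move=> [w hw <-]; exists (- w); [apply: deg_geN | rewrite rclsN]. Qed.
Lemma arrow_idealD p p' : arrow_ideal p -> arrow_ideal p' -> arrow_ideal (p + p').
Proof.
by move=> [w hw <-] [w' hw' <-]; exists (w + w'); [apply: deg_geD | rewrite rclsD].
Qed.

Lemma arrow_ideal_nilp p : arrow_ideal p -> p ^+ N = 0.
Proof.
move=> [w hw <-]; rewrite -rclsX; apply/rcls0P/highJ.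
exact: (deg_ge_exp gY_lin casY).
Qed.

Lemma arrow_ideal_decomp a : exists d p, arrow_ideal p /\ a = q (cD d) + p.
Proof.
have [w <-] := rcls_surj a; exists (w 0%N), (q (w - cD (w 0%N))); split.
  by exists (w - cD (w 0%N)) => //; apply: deg_ge_sub0.
by rewrite -rclsD addrC subrK.
Qed.

Lemma sum_E : \sum_i E i = 1.
Proof. by rewrite -rcls_sum -ctens_D_sum e_sum ctens_D1. Qed.
Lemma E_idem i : E i * E i = E i.
Proof. by rewrite -rclsM -ctens_DM e_idem. Qed.

Lemma E_orth i j a : i != j -> arrow_ideal (E i * a * E j).
Proof.
move=> ij; have [w <-] := rcls_surj a.
exists (cD (e i) * w * cD (e j)); last by rewrite !rclsM.
by apply/deg1P; rewrite !ctens_mul_0 /= eC -mulrA e_orth // mulr0.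
Qed.

Lemma E_neq0 i : E i <> 0.
Proof. by move=> /rcls0P /closed_ideal_deg /=; apply: e_neq0. Qed.

Lemma nakayama (U : lmodType A) (L : submodule U) v p :
  arrow_ideal p -> L (v - p *: v) -> L v.
Proof. by move=> pA; apply: submodule_nilp (arrow_ideal_nilp pA). Qed.

(** Write a = d + p with p in the arrow ideal. Either d kills e_i and a s = 0, or d is invertible at
    i and Nakayama would put v into L. This supplies the hypothesis [vs] of [self_injective_ext]. *)
Lemma socle_map (U : lmodType A) (L : submodule U) v i s :
  E i *: v = v -> ~ L v -> E i * s = s ->
  (forall p, arrow_ideal p -> p * s = 0) ->
  forall a, L (a *: v) -> a * s = 0.
Proof.
move=> Ev nLv Es ps a; have [d [p [pA ->]]] := arrow_ideal_decomp a.
have [e0 _|[d' d'P] La] := e_div i d.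
  by rewrite mulrDl (ps p pA) addr0 -Es mulrA -rclsM -ctens_DM -eC e0 ctens_D0 rcls0 mul0r.
case: nLv; have := submoduleZ (q (cD d') * E i) La.
rewrite scalerA mulrDr -(rclsM J (cD d') (cD (e i))) -(rclsM J _ (cD d)) -!ctens_DM.
rewrite -mulrA d'P scalerDl Ev.
set p' := _ * p => L'; apply: (@nakayama _ _ _ (- p')).
  by apply/arrow_idealN/arrow_idealMl.
by rewrite scaleNr opprK.
Qed.

(** A nonzero element of A E_j represented in the largest possible degree is killed by the arrow
    ideal from the left, and some vertex idempotent on the left keeps it nonzero. *)
Lemma socle_exists j : exists si : A * Q0,
  [/\ si.1 <> 0, si.1 * E j = si.1, E si.2 * si.1 = si.1
    & forall p, arrow_ideal p -> p * si.1 = 0].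
Proof.
pose B k := `[< exists2 w, deg_ge k w & ~ J (w * cD (e j)) >].
have exB : exists k, B k.
  exists 0%N; apply/asboolP; exists 1 => //.
  by rewrite mul1r => /rcls0P; apply: E_neq0.
have ubB k : B k -> (k <= N)%N.
  move=> /asboolP [w hw nJ]; rewrite leqNgt; apply/negP => kN; apply: nJ.
  by apply/Defs.idealMr/highJ; apply: deg_geW (ltnW kN) hw.
have [k /asboolP [w hw nJ] kmax] := ex_maxnP exB ubB.
have [i nJi] : exists i, ~ J (cD (e i) * (w * cD (e j))).
  apply: contrapT => h; apply: nJ; rewrite -[w * _]mul1r -ctens_D1 -e_sum ctens_D_sum mulr_suml.
  by apply: ideal_sum => i _; apply: contrapT => nJ; apply: h; exists i.
exists (q (cD (e i) * (w * cD (e j))), i); split=> /=.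
- by move/rcls0P.
- by rewrite -(rclsM J _ (cD (e j))) -!mulrA -ctens_DM e_idem.
- by rewrite -(rclsM J (cD (e i))) [cD _ * (cD _ * _)]mulrA -ctens_DM e_idem.
move=> _ [z hz <-]; rewrite -rclsM; apply/rcls0P; apply: contrapT => nJz.
have : B k.+1.
  apply/asboolP; exists (z * (cD (e i) * w)); last by rewrite -!mulrA.
  by rewrite -add1n; apply: (deg_ge_mul gY_lin casY) => //; apply: deg_ge_cD.
by move/kmax; rewrite ltnn.
Qed.

Hypothesis injA : self_injective A.

Lemma zero_submodule_proof (R : pzRingType) (U : lmodType R) a (x y : U) :
  x = 0 -> y = 0 -> a *: x + y = 0.
Proof. by move=> -> ->; rewrite scaler0 addr0. Qed.
Definition zero_submodule (R : pzRingType) (U : lmodType R) : submodule U :=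
  Submodule (submodule_car := fun x => x = 0) erefl (@zero_submodule_proof R U).

(** As s' is killed by the arrow ideal, s |-> s' is well defined on A s; its extension to A is right
    multiplication by some y. *)
Lemma socle_transfer i (s s' : A) : s <> 0 ->
  E i * s = s -> E i * s' = s' ->
  (forall p, arrow_ideal p -> p * s' = 0) -> exists y, s * y = s'.
Proof.
move=> s0 Es Es' ps'.
have [//|g [gs _]] := @self_injective_ext A A^o (zero_submodule A^o) s injA s'.
  exact: (@socle_map A^o (zero_submodule A^o) s i s').
exists (g 1); rewrite -gs -[in RHS](mulr1 s).
by rewrite -[s * 1]/(s *: (1 : A^o)) linearZ.
Qed.

(* The socles of the modules A e_j are supported at pairwise distinct vertices, *)
(* so by finiteness at every vertex.                                           *)
Lemma socle_onto i : exists s : A,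
  [/\ s <> 0, E i * s = s & forall p, arrow_ideal p -> p * s = 0].
Proof.
have [f fP] := boolp.choice socle_exists.
have f_inj : injective (fun j => (f j).2).
  move=> j k ejk; apply/eqP; apply: contrapT => /negP jk.
  have [sj0 sjE Esj psj] := fP j; have [sk0 skE Esk psk] := fP k.
  rewrite ejk in Esj.
  have [y sjy] := socle_transfer sj0 Esj Esk psk.
  have [z skz] := socle_transfer sk0 Esk Esj psj.
  (* Right multiplication by p z fixes s_j, although p lies in the arrow ideal because j and k
     differ; nilpotency then gives s_j = 0. *)
  pose p := E j * y * E k.
  have sp : (f j).1 * (p * z) = (f j).1.
    by rewrite /p !mulrA sjE sjy skE.
  have pA : arrow_ideal (p * z) by apply/arrow_idealMr/E_orth.
  apply: sj0; have spk n : (f j).1 * (p * z) ^+ n = (f j).1.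
    by elim: n => [|n IH]; rewrite ?mulr1 // exprS mulrA sp.
  by rewrite -(spk N) arrow_ideal_nilp // mulr0.
have [g _ gK] := injF_bij f_inj.
by have [] := fP (g i); rewrite gK => s0 _ Es ps; exists (f (g i)).1.
Qed.

(** If x is not in A b, some E_i x is not. Sending it to a nonzero socle element s = E_i s and A b
    to 0 extends to a map from A^B to A, that is, to a column c with sum b c = 0; then s = E_i sum x
    c = 0, a contradiction. *)
Lemma double_annihilator (B : finType) (b x : B -> A) :
  (forall c : B -> A, \sum_k b k * c k = 0 -> \sum_k x k * c k = 0) ->
  exists y, forall k, x k = y * b k.
Proof.
move=> ann; pose U := dprod (fun _ : B => A^o).
pose Lp (u : U) := exists y, forall k, u k = y * b k.
have L0 : Lp 0 by exists 0 => k; rewrite mul0r.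
have LP a u u' : Lp u -> Lp u' -> Lp (a *: u + u').
  move=> [y uy] [y' uy']; exists (a * y + y') => k.
  by rewrite dprodD dprodZ uy uy' mulrDl -mulrA.
pose L := Submodule L0 LP; apply: contrapT => nLx.
have [i nLi] : exists i, ~ L (E i *: (x : U)).
  apply: contrapT => h; apply: nLx; rewrite -[exists y, _]/(L x).
  have -> : x = \sum_i E i *: (x : U) by rewrite -scaler_suml sum_E scale1r.
  by apply: submodule_sum => i; apply: contrapT => nL; apply: h; exists i.
have [s [s0 Es ps]] := socle_onto i.
have Ev : E i *: (E i *: (x : U)) = E i *: (x : U) by rewrite scalerA E_idem.
have [g [gv gL]] := self_injective_ext injA (socle_map Ev nLi Es ps).
pose c k : A := g (fun l => (l == k)%:R : A^o).
have gE (u : U) : g u = \sum_k u k * c k.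
  have -> : u = \sum_k u k *: ((fun l => (l == k)%:R : A^o) : U).
    apply: functional_extensionality_dep => l; rewrite dprod_sum (bigD1 l) //=.
    rewrite dprodZ eqxx [_ *: _]mulr1 big1 ?addr0 // => k kl.
    by rewrite dprodZ eq_sym (negPf kl) scaler0.
  rewrite linear_sum; apply: eq_bigr => k _; rewrite linearZ /=.
  congr (_ * _); rewrite dprod_sum (bigD1 k) //=.
  rewrite dprodZ eqxx [_ *: _]mulr1 big1 ?addr0 // => l kl.
  by rewrite dprodZ eq_sym (negPf kl) scaler0.
apply: s0; rewrite -gv linearZ gE /=.
rewrite [X in _ *: X](_ : _ = 0) ?scaler0 //; apply: ann.
by rewrite -[LHS](gE (b : U)); apply: gL; exists 1 => k; rewrite mul1r.
Qed.

End BasicAlgebra.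

(** * Species and dual bases *)

Section SpeciesBasics.
Variables (K : fieldType) (Q : quiver) (S : species K Q).
Local Notation Dg := (sD S).
Local Notation Mg := (sM S).
Local Notation bM := (sM_bimod S).

Definition inD (i : Q0 Q) (x : sdiv S i) : Dg := fun j =>
  if @eqP _ i j is ReflectT e then ecast j (sdiv S j) e x else 0.

Lemma inD_id i x : @inD i x i = x.
Proof. by rewrite /inD; case: eqP => // p; rewrite eq_axiomK. Qed.
Lemma inD_neq i j x : i != j -> @inD i x j = 0.
Proof. by rewrite /inD; case: eqP. Qed.
Lemma inM_id a x : @inM _ _ S a x a = x.
Proof. by rewrite /inM; case: eqP => // p; rewrite eq_axiomK. Qed.
Lemma inM_neq a b x : a != b -> @inM _ _ S a x b = 0.
Proof. by rewrite /inM; case: eqP. Qed.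

Lemma inD_linear i k x y : @inD i (k *: x + y) = k *: inD x + inD y.
Proof.
apply: functional_extensionality_dep => j; rewrite dprodD dprodZ.
have [<-|ij] := eqVneq i j; first by rewrite !inD_id.
by rewrite !inD_neq // scaler0 addr0.
Qed.
HB.instance Definition _ i :=
  GRing.isLinear.Build K (sdiv S i) Dg *:%R (@inD i) (@inD_linear i).

Lemma inD_mulr i x (d : Dg) : inD x * d = inD (x * d i).
Proof.
apply: functional_extensionality_dep => j; rewrite dprodM.
have [<-|ij] := eqVneq i j; first by rewrite !inD_id.
by rewrite !inD_neq // mul0r.
Qed.

Lemma sD_decomp (d : Dg) : d = \sum_i inD (d i).
Proof.
apply: functional_extensionality_dep => j; rewrite dprod_sum (bigD1 j) //= inD_id.
by rewrite big1 ?addr0 // => i ij; rewrite inD_neq.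
Qed.

Lemma inMD a x y : @inM _ _ S a (x + y) = inM x + inM y.
Proof.
apply: functional_extensionality_dep => b; rewrite dprodD.
have [<-|ab] := eqVneq a b; first by rewrite !inM_id.
by rewrite !inM_neq // addr0.
Qed.
Lemma inM0 a : inM (0 : smod S a) = 0.
Proof. by apply: (addrI (inM (0 : smod S a))); rewrite -inMD !addr0. Qed.

Lemma sM_decomp (m : Mg) : m = \sum_a inM (m a).
Proof.
apply: functional_extensionality_dep => b; rewrite dprod_sum (bigD1 b) //= inM_id.
by rewrite big1 ?addr0 // => i ij; rewrite inM_neq.
Qed.

Lemma lact0 (a : Q1 Q) d : lact (sbim S a) d 0 = 0.
Proof. by apply: (addrI (lact (sbim S a) d 0)); rewrite -lactDr !addr0. Qed.
Lemma ract0 (a : Q1 Q) d : ract (sbim S a) 0 d = 0.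
Proof. by apply: (addrI (ract (sbim S a) 0 d)); rewrite -ractDr !addr0. Qed.
Lemma lact0l (a : Q1 Q) m : lact (sbim S a) 0 m = 0.
Proof. by apply: (addrI (lact (sbim S a) 0 m)); rewrite -lactDl !addr0. Qed.
Lemma ract0l (a : Q1 Q) m : ract (sbim S a) m 0 = 0.
Proof. by apply: (addrI (ract (sbim S a) m 0)); rewrite -ractDl !addr0. Qed.

Lemma inM_lact a m d : lact bM d (@inM _ _ S a m) = inM (lact (sbim S a) (d (tgt a)) m).
Proof.
apply: functional_extensionality_dep => b; rewrite /= /sM_lact.
have [<-|ab] := eqVneq a b; first by rewrite !inM_id.
by rewrite !inM_neq // lact0.
Qed.
Lemma inM_ract a m d : ract bM (@inM _ _ S a m) d = inM (ract (sbim S a) m (d (src a))).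
Proof.
apply: functional_extensionality_dep => b; rewrite /= /sM_ract.
have [<-|ab] := eqVneq a b; first by rewrite !inM_id.
by rewrite !inM_neq // ract0.
Qed.

Lemma lactZ k d m : lact bM (k *: d) m = k *: lact bM d m.
Proof.
apply: functional_extensionality_dep => a; rewrite dprodZ /= /sM_lact dprodZ.
by rewrite -sbim_lK lactA -scalerAl mul1r.
Qed.
Lemma ractZ k d m : ract bM m (k *: d) = k *: ract bM m d.
Proof.
apply: functional_extensionality_dep => a; rewrite dprodZ /= /sM_ract dprodZ.
by rewrite -sbim_rK ractA -scalerAr mulr1.
Qed.

Lemma idemC i (d : Dg) : idem S i * d = d * idem S i.
Proof.
apply: functional_extensionality_dep => j; rewrite !dprodM /idem.
by case: (j == i); rewrite ?mul1r ?mulr1 ?mul0r ?mulr0.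
Qed.
Lemma idem_orth i j : i != j -> idem S i * idem S j = 0.
Proof.
move=> ij; apply: functional_extensionality_dep => k; rewrite dprodM /idem.
by have [->|] := eqVneq k i; rewrite ?mul0r // (negPf ij) mulr0.
Qed.
Lemma idem_idem i : idem S i * idem S i = idem S i.
Proof.
apply: functional_extensionality_dep => k; rewrite dprodM /idem.
by case: (k == i); rewrite ?mulr1 ?mulr0.
Qed.
Lemma idem_sum : \sum_i idem S i = 1.
Proof.
apply: functional_extensionality_dep => j; rewrite dprod_sum (bigD1 j) //= /idem eqxx.
by rewrite big1 ?addr0 // => i; rewrite eq_sym => /negPf ->.
Qed.
Lemma idem_neq0 i : idem S i <> 0.
Proof.
move/(congr1 (fun f : Dg => f i)); rewrite /idem eqxx => /eqP.
by rewrite dprod0 oner_eq0.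
Qed.
Lemma idem_div i (d : Dg) :
  idem S i * d = 0 \/ exists d', d' * (idem S i * d) = idem S i.
Proof.
have [di|di] := eqVneq (d i) 0; [left | right].
  apply: functional_extensionality_dep => j; rewrite dprodM /idem dprod0.
  by have [->|_] := eqVneq j i; rewrite ?di ?mulr0 ?mul0r.
exists (inD (d i)^-1); rewrite inD_mulr dprodM /idem eqxx mul1r.
rewrite mulVr; last exact: sdivP.
apply: functional_extensionality_dep => j; rewrite eq_sym.
by have [<-|ij] := eqVneq i j; rewrite ?inD_id ?inD_neq.
Qed.

Section Trace.
Variable t : {linear Dg -> K^o}.
Hypothesis t_sym : symmetrizing t.

Lemma trC a b : t (a * b) = t (b * a).
Proof. by case: t_sym. Qed.

(** By symmetry of t the radical of the trace form is a two-sided ideal, and t vanishes on it. *)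
Lemma tr_nondeg x : (forall d, t (x * d) = 0) -> x = 0.
Proof.
case: t_sym => _ h hx.
pose Z (x : Dg) := forall d, t (x * d) = 0.
have Z0 : Z 0 by move=> d; rewrite mul0r linear0.
have ZB u v : Z u -> Z v -> Z (u - v).
  by move=> zu zv d; rewrite mulrBl linearB zu zv subrr.
have Zl a u : Z u -> Z (a * u) by move=> zu d; rewrite -mulrA trC -mulrA.
have Zr a u : Z u -> Z (u * a) by move=> zu d; rewrite -mulrA.
by apply: (h (Ideal Z0 ZB Zl Zr)) => // y /(_ 1); rewrite mulr1.
Qed.

(** The map g |-> t(- g) is injective, since a nonzero g is invertible and t does not vanish on D_i;
    it is onto the dual by dimension. *)
Lemma tr_repr_div i (phi : {linear sdiv S i -> K^o}) :
  exists g, forall d, phi d = t (inD (d * g)).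
Proof.
pose Fg (g : sdiv S i) : sdiv S i -> K^o := fun d => t (inD (d * g)).
have Fg_lin g : linear (Fg g).
  by move=> k x y; rewrite /Fg mulrDl -scalerAl !linearP.
pose FL g : {linear sdiv S i -> K^o} :=
  HB.pack (Fg g) (GRing.isLinear.Build K (sdiv S i) K^o *:%R (Fg g) (Fg_lin g)).
pose G (g : sdiv S i) : 'Hom(sdiv S i, K^o) := linfun (FL g).
have GE g d : G g d = t (inD (d * g)) by rewrite lfunE.
have G_lin : linear G.
  move=> k x y; apply/lfunP => d; rewrite add_lfunE scale_lfunE !GE.
  by rewrite mulrDr -scalerAr !linearP.
pose GL : {linear sdiv S i -> 'Hom(sdiv S i, K^o)} :=
  HB.pack G (GRing.isLinear.Build K (sdiv S i) 'Hom(sdiv S i, K^o) *:%R G G_lin).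
have ker0 : lker (linfun GL) == 0%VS.
  rewrite -subv0; apply/subvP => g; rewrite memv_ker lfunE /= => /eqP Gg.
  rewrite memv0; apply: contraT => g0; have ug := @sdivP _ _ S _ _ g0.
  have t0 (d : sdiv S i) : t (inD d) = 0.
    by have := GE g (d * g^-1); rewrite Gg zero_lfunE mulrVK.
  have: inD (1 : sdiv S i) = 0 by apply: tr_nondeg => d; rewrite inD_mulr t0.
  move/(congr1 (fun f : Dg => f i)); rewrite inD_id dprod0 => /eqP.
  by rewrite oner_eq0.
have full : limg (linfun GL) = fullv.
  apply/eqP; rewrite eqEdim subvf /= limg_dim_eq; last by rewrite (eqP ker0) capv0.
  by rewrite !dimvf /dim /= muln1.
have : linfun phi \in limg (linfun GL) by rewrite full memvf.
case/memv_imgP => g _ /lfunP h; exists g => d.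
by rewrite -[LHS](lfunE phi) h lfunE; apply: GE.
Qed.

Lemma tr_repr (phi : {linear Dg -> K^o}) : exists g, forall d, phi d = t (d * g).
Proof.
have h (i : Q0 Q) : exists g, forall d : sdiv S i, phi (inD d) = t (inD (d * g)).
  by have [g gP] := tr_repr_div (phi \o @inD i)%FUN; exists g => d; rewrite -gP.
have {}h i := cid (h i).
exists (fun i => sval (h i)) => d; rewrite [in LHS](sD_decomp d) [d in RHS]sD_decomp.
rewrite mulr_suml !linear_sum; apply: eq_bigr => i _.
by rewrite (svalP (h i)) inD_mulr.
Qed.

Lemma tr_inj x y : (forall d, t (d * x) = t (d * y)) -> x = y.
Proof.
move=> h; apply/eqP; rewrite -subr_eq0; apply/eqP/tr_nondeg => d.
by rewrite trC mulrBr linearB h subrr.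
Qed.

(** The set from which [tl_inv] chooses is inhabited, so its default value never occurs: g(x) is the
    element representing d |-> xi(d x), and uniqueness of representatives makes g linear. *)
Lemma tl_invP xi : llin bM (tl_inv t xi) /\ forall x, t (tl_inv t xi x) = xi x.
Proof.
have ex : exists g : Mg -> Dg, [/\ forall x y, g (x + y) = g x + g y,
    forall d x, g (sM_lact d x) = d * g x & forall x, t (g x) = xi x].
  have lin x : linear (fun d => xi (lact bM d x) : K^o).
    by move=> k a b; rewrite lactDl lactZ linearP.
  have h x := cid (tr_repr (HB.pack (fun d => xi (lact bM d x) : K^o)
    (GRing.isLinear.Build K Dg K^o *:%R (fun d => xi (lact bM d x)) (lin x)))).
  have hE x d : xi (lact bM d x) = t (d * sval (h x)) by exact: (svalP (h x)).
  exists (fun x => sval (h x)); split=> [x y|d x|x].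
  - by apply: tr_inj => d; rewrite mulrDr linearD -!hE lactDr linearD.
  - by apply: tr_inj => d'; rewrite mulrA -!hE -[sM_lact d x]/(lact bM d x) lactA.
  - by rewrite -[sval _]mul1r -hE lact1.
by rewrite /tl_inv; have [] := @xgetPex _ (fun=> 0) _ ex.
Qed.

Lemma tr_invP xi : rlin bM (tr_inv t xi) /\ forall x, t (tr_inv t xi x) = xi x.
Proof.
have ex : exists g : Mg -> Dg, [/\ forall x y, g (x + y) = g x + g y,
    forall d x, g (sM_ract x d) = g x * d & forall x, t (g x) = xi x].
  have lin x : linear (fun d => xi (ract bM x d) : K^o).
    by move=> k a b; rewrite ractDl ractZ linearP.
  have h x := cid (tr_repr (HB.pack (fun d => xi (ract bM x d) : K^o)
    (GRing.isLinear.Build K Dg K^o *:%R (fun d => xi (ract bM x d)) (lin x)))).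
  have hE x d : xi (ract bM x d) = t (d * sval (h x)) by exact: (svalP (h x)).
  exists (fun x => sval (h x)); split=> [x y|d x|x].
  - by apply: tr_inj => d; rewrite mulrDr linearD -!hE ractDr linearD.
  - apply: tr_inj => d'; rewrite mulrA [RHS]trC mulrA -!hE.
    by rewrite -[sM_ract x d]/(ract bM x d) ractA.
  - by rewrite -[sval _]mul1r -hE ract1.
by rewrite /tr_inv; have [] := @xgetPex _ (fun=> 0) _ ex.
Qed.

Lemma tl_tr_dual xi : dual_pair bM t (tl_inv t xi) (tr_inv t xi).
Proof.
have [hl tl] := tl_invP xi; have [hr tr] := tr_invP xi.
by split=> // x; rewrite tl tr.
Qed.

Lemma tl_inv_local a xi m : in_dual a xi -> m a = 0 -> tl_inv t xi m = 0.
Proof.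
move=> ha ma; have [[_ hl] tl] := tl_invP xi; apply: tr_nondeg => d.
by rewrite trC -hl tl ha //= /sM_lact ma lact0.
Qed.
Lemma tr_inv_local a xi m : in_dual a xi -> m a = 0 -> tr_inv t xi m = 0.
Proof.
move=> ha ma; have [[_ hr] tr] := tr_invP xi; apply: tr_nondeg => d.
by rewrite -hr tr ha //= /sM_ract ma ract0.
Qed.

Lemma tl_inv_inM a xi m : in_dual a xi -> tl_inv t xi m = tl_inv t xi (inM (m a)).
Proof.
move=> ha; have [[hD _] _] := tl_invP xi.
rewrite {1}(_ : m = inM (m a) + (m - inM (m a))); last by rewrite addrC subrK.
rewrite hD [X in _ + X](tl_inv_local ha) ?addr0 //.
by rewrite dprodD dprodN inM_id subrr.
Qed.
Lemma tr_inv_inM a xi m : in_dual a xi -> tr_inv t xi m = tr_inv t xi (inM (m a)).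
Proof.
move=> ha; have [[hD _] _] := tr_invP xi.
rewrite {1}(_ : m = inM (m a) + (m - inM (m a))); last by rewrite addrC subrK.
rewrite hD [X in _ + X](tr_inv_local ha) ?addr0 //.
by rewrite dprodD dprodN inM_id subrr.
Qed.

Lemma idem_lact a m : lact bM (idem S (tgt a)) (@inM _ _ S a m) = inM m.
Proof. by rewrite inM_lact /idem eqxx lact1. Qed.
Lemma idem_ract a m : ract bM (@inM _ _ S a m) (idem S (src a)) = inM m.
Proof. by rewrite inM_ract /idem eqxx ract1. Qed.
Lemma idem_ract_neq a i m : src a != i -> ract bM (@inM _ _ S a m) (idem S i) = 0.
Proof. by move=> h; rewrite inM_ract /idem (negPf h) ract0l inM0. Qed.

Lemma tl_inv_idem a xi m : in_dual a xi ->
  tl_inv t xi m = idem S (tgt a) * tl_inv t xi m.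
Proof.
move=> ha; have [[_ hl] _] := tl_invP xi.
by rewrite (tl_inv_inM m ha) -hl idem_lact.
Qed.
Lemma tr_inv_idem a xi m : in_dual a xi ->
  tr_inv t xi m = tr_inv t xi m * idem S (src a).
Proof.
move=> ha; have [[_ hr] _] := tr_invP xi.
by rewrite (tr_inv_inM m ha) -hr idem_ract.
Qed.

Section DualBases.
Variable B : bases S.
Hypothesis B_dual : dual_bases t B.

Definition und_idx : finType := {a : Q1 Q & 'I_(und_size B a)}.
Definition ovr_idx : finType := {a : Q1 Q & 'I_(ovr_size B a)}.
Definition undX (p : und_idx) : Mg := inM (und B (tagged p)).
Definition ovrX (p : ovr_idx) : Mg := inM (ovr B (tagged p)).
Definition und_r (p : und_idx) := tr_inv t (und_dual B (tagged p)).
Definition ovr_l (p : ovr_idx) := tl_inv t (ovr_dual B (tagged p)).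
Definition ovr_r (p : ovr_idx) := tr_inv t (ovr_dual B (tagged p)).

Lemma und_in_dual (p : und_idx) : in_dual (tag p) (und_dual B (tagged p)).
Proof. by case: (B_dual (tag p)) => -[_ h _] _; apply: h. Qed.
Lemma ovr_in_dual (p : ovr_idx) : in_dual (tag p) (ovr_dual B (tagged p)).
Proof. by case: (B_dual (tag p)) => _ [_ h _]; apply: h. Qed.

Lemma und_r_lin p : rlin bM (und_r p). Proof. exact: (tr_invP _).1. Qed.
Lemma ovr_l_lin p : llin bM (ovr_l p). Proof. exact: (tl_invP _).1. Qed.

Lemma und_casimir (x : Mg) : \sum_p ract bM (undX p) (und_r p x) = x.
Proof.
rewrite [RHS]sM_decomp.
rewrite -(sig_big_dep (fun=> true) (fun _ _ => true)
  (fun a (j : 'I_(und_size B a)) => sM_ract (inM (und B j)) (tr_inv t (und_dual B j) x))) /=.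
apply: eq_bigr => a _; case: (B_dual a) => -[_ _ <-] _.
apply: eq_bigr => j _.
by rewrite (tr_inv_inM x (@und_in_dual (Tagged (fun a => 'I_(und_size B a)) j))).
Qed.
Lemma ovr_casimir (x : Mg) : \sum_p lact bM (ovr_l p x) (ovrX p) = x.
Proof.
rewrite [RHS]sM_decomp.
rewrite -(sig_big_dep (fun=> true) (fun _ _ => true)
  (fun a (j : 'I_(ovr_size B a)) => sM_lact (tl_inv t (ovr_dual B j) x) (inM (ovr B j)))) /=.
apply: eq_bigr => a _; case: (B_dual a) => _ [_ _ <-].
apply: eq_bigr => j _.
by rewrite (tl_inv_inM x (@ovr_in_dual (Tagged (fun a => 'I_(ovr_size B a)) j))).
Qed.

(** Within one arrow, the Casimir identity and the trivial expansion both give coordinates of a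
    basis element; uniqueness equates them at the target vertex, and the other components vanish by
    [tl_inv_idem]. *)
Lemma ovr_l_delta (p q : ovr_idx) :
  ovr_l p (ovrX q) = if p == q then idem S (tgt (tag p)) else 0.
Proof.
have [|pq] := eqVneq (tag p) (tag q); last first.
  rewrite /ovr_l (tl_inv_local (@ovr_in_dual p)); last first.
    by rewrite /ovrX inM_neq // eq_sym.
  by have [e|//] := eqVneq p q; rewrite e eqxx in pq.
case: p q => a j [b k] /= ab; case: _ / ab k => k.
rewrite /ovr_l /ovrX /=; have haj := @ovr_in_dual (Tagged (fun a => 'I_(ovr_size B a)) j).
case: (B_dual a) => _ [/(_ (ovr B k)) [d [_ d_uniq]] _ cas].
have eq1 : d = fun j : 'I_(ovr_size B a) =>
    tl_inv t (ovr_dual B j) (inM (ovr B k)) (tgt a).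
  apply: d_uniq; rewrite -[LHS]inM_id -[in LHS]cas dprod_sum.
  by apply: eq_bigr => l _; rewrite /sM_lact inM_id.
have eq2 : d = fun j : 'I_(ovr_size B a) => (j == k)%:R.
  apply: d_uniq; rewrite (bigD1 k) //= eqxx lact1 big1 ?addr0 // => l /negPf ->.
  exact: lact0l.
rewrite (tl_inv_idem _ haj) /=; apply: functional_extensionality_dep => i.
rewrite dprodM /idem -tag_eqE /tag_eq /= eqxx tagged_asE.
have [->|ia] := eqVneq i (tgt a); last by rewrite mul0r; case: ifP => // _; rewrite (negPf ia).
rewrite mul1r; have := congr1 (fun f => f j) eq1; rewrite eq2 => <-.
by case: (j == k); rewrite //= eqxx.
Qed.

Lemma und_r_delta (p q : und_idx) :
  und_r p (undX q) = if p == q then idem S (src (tag p)) else 0.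
Proof.
have [|pq] := eqVneq (tag p) (tag q); last first.
  rewrite /und_r (tr_inv_local (@und_in_dual p)); last first.
    by rewrite /undX inM_neq // eq_sym.
  by have [e|//] := eqVneq p q; rewrite e eqxx in pq.
case: p q => a j [b k] /= ab; case: _ / ab k => k.
rewrite /und_r /undX /=; have haj := @und_in_dual (Tagged (fun a => 'I_(und_size B a)) j).
case: (B_dual a) => -[/(_ (und B k)) [d [_ d_uniq]] _ cas] _.
have eq1 : d = fun j : 'I_(und_size B a) =>
    tr_inv t (und_dual B j) (inM (und B k)) (src a).
  apply: d_uniq; rewrite -[LHS]inM_id -[in LHS]cas dprod_sum.
  by apply: eq_bigr => l _; rewrite /sM_ract inM_id.
have eq2 : d = fun j : 'I_(und_size B a) => (j == k)%:R.
  apply: d_uniq; rewrite (bigD1 k) //= eqxx ract1 big1 ?addr0 // => l /negPf ->.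
  exact: ract0l.
rewrite (tr_inv_idem _ haj) /=; apply: functional_extensionality_dep => i.
rewrite dprodM /idem -tag_eqE /tag_eq /= eqxx tagged_asE.
have [->|ia] := eqVneq i (src a); last by rewrite mulr0; case: ifP => // _; rewrite (negPf ia).
rewrite mulr1; have := congr1 (fun f => f j) eq1; rewrite eq2 => <-.
by case: (j == k); rewrite //= eqxx.
Qed.

Lemma und_nonempty a (m : smod S a) : m != 0 -> exists p : und_idx, tag p = a.
Proof.
move=> m0; have [//|h] := pselect (exists p : und_idx, tag p = a).
case/eqP: m0; rewrite -(inM_id m) -(und_casimir (inM m)) dprod_sum big1 // => p _.
rewrite /= /sM_ract /undX inM_neq ?ract0 //; apply/eqP => pa; apply: h; by exists p.
Qed.

Lemma eps_lE (w : sT S) : eps_l t B w = rotate (M := bM) ovrX ovr_r w.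
Proof.
rewrite /rotate -(sig_big_dep (fun=> true) (fun _ _ => true)
  (fun a (j : 'I_(ovr_size B a)) =>
     (dl (tr_inv t (ovr_dual B j)) w : sT S) * ctens_M bM (inM (ovr B j)))).
by [].
Qed.
Lemma eps_cE (w : sT S) : eps_c t B w = cyclic_sum (M := bM) ovrX ovr_r w.
Proof.
apply: ctens_ext => n; apply: eq_bigr => k _.
by congr (_ n); elim: (val k) => //= j ->; apply: eps_lE.
Qed.

End DualBases.
End Trace.
End SpeciesBasics.

(** * Exactness over the Jacobian algebra *)

Section Jacobian.
Variables (K : fieldType) (Q : quiver) (S : species K Q).
Variables (t : {linear sD S -> K^o}) (B : bases S) (W : sT S).
Hypothesis t_sym : symmetrizing t.
Hypothesis B_dual : dual_bases t B.
Hypothesis W_pot : is_potential W.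
Local Notation bM := (sM_bimod S).
Local Notation cD := (ctens_D bM).
Local Notation cM := (ctens_M bM).
Local Notation T := (sT S).
Local Notation undX := (@undX K Q S B).
Local Notation ovrX := (@ovrX K Q S B).
Local Notation und_r := (@und_r K Q S t B).
Local Notation ovr_l := (@ovr_l K Q S t B).
Local Notation ovr_r := (@ovr_r K Q S t B).
Local Notation V := (cyclic_sum (M := bM) ovrX ovr_r W).

Lemma trD : {morph t : x y / x + y}. Proof. by move=> x y; rewrite linearD. Qed.
Lemma ovr_pair p : dual_pair bM t (ovr_l p) (ovr_r p).
Proof. exact: tl_tr_dual. Qed.

Lemma potential_central : central W. Proof. by case: W_pot. Qed.

Let uL := und_r_lin t_sym (B := B).
Let uC := und_casimir t_sym B_dual.
Let oL := ovr_l_lin t_sym (B := B).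
Let oC := ovr_casimir t_sym B_dual.

Lemma dcycE xi : dcyc t B xi W = dl (tr_inv t xi) V.
Proof. by rewrite /dcyc eps_cE. Qed.

Lemma cyclic_potential_central : central V.
Proof.
exact: (cyclic_sum_central trD (trC t_sym) (tr_nondeg t_sym) uL uC ovr_pair oC potential_central).
Qed.

Lemma dcyc_dr xi : dcyc t B xi W = dr (tl_inv t xi) V.
Proof.
rewrite dcycE; symmetry.
exact: (dr_cyclic_sum trD (trC t_sym) (tr_nondeg t_sym) uL uC ovr_pair oC
  (tl_tr_dual t_sym xi) potential_central).
Qed.

Lemma dl_dcyc xi xi' :
  dl (tr_inv t xi') (dcyc t B xi W) = dr (tl_inv t xi) (dcyc t B xi' W).
Proof.
rewrite !dcycE.
exact: (dl_dl_cyclic_sum trD (trC t_sym) (tr_nondeg t_sym) uL uC ovr_pair oC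
  (tl_tr_dual t_sym xi) (tr_invP t_sym xi').1 potential_central).
Qed.

Lemma dcyc_deg xi : (dcyc t B xi W) 0%N = 0.
Proof.
rewrite dcycE /dl [V 1%N](_ : _ = 0).
  exact: (tlift0 (dl_bal (tr_invP t_sym xi).1 0)).
by rewrite /cyclic_sum big_ord1 /=; case: W_pot.
Qed.


Lemma dr_cDr f (w : T) d : llin bM f ->
  dr f (w * cD d) = \sum_k dr (ovr_l k) w * cD (f (ract bM (ovrX k) d)).
Proof.
move=> hf; rewrite {1}(dr_decomp uL uC oL oC w) mulrDl (drD hf) -ctens_DM (dr_cD hf) add0r.
rewrite mulr_suml (dr_sum hf); apply: eq_bigr => k _.
rewrite -mulrA -ctens_M_ract (dr_mul uL uC) //; congr (_ * _).
by rewrite -[cM _]mulr1 (dr_cM hf) -ctens_D1 (dr_cD hf) mulr0 addr0 ract1.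
Qed.

Lemma dr_expand f (w : T) : llin bM f ->
  dr f w = \sum_k dr (ovr_l k) w * cD (f (ovrX k)).
Proof.
move=> hf; rewrite -[w in LHS]mulr1 -[1]ctens_D1 (dr_cDr _ _ hf).
by apply: eq_bigr => k _; rewrite ract1.
Qed.

Lemma dl_expand g (w : T) : rlin bM g ->
  dl g w = \sum_k cD (g (undX k)) * dl (und_r k) w.
Proof.
move=> hg; rewrite {1}(dl_decomp uL uC w) (dlD hg) (dl_cD hg) add0r (dl_sum hg).
by apply: eq_bigr => k _; rewrite (dl_cM hg).
Qed.

(** Since d V = V d, a right derivative carries d to the right of the relations, as
    [closed_ideal_right_strip] requires. *)
Lemma dcyc_cDl d (l : ovr_idx B) : exists c, cD d * dcyc t B (ovr_dual B (tagged l)) W =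
  \sum_(k : ovr_idx B) dcyc t B (ovr_dual B (tagged k)) W * cD (c k).
Proof.
exists (fun k => ovr_l l (ract bM (ovrX k) d)).
rewrite dcyc_dr -(dr_cDM (oL l)) cyclic_potential_central (dr_cDr _ _ (oL l)).
by apply: eq_bigr => k _; rewrite dcyc_dr.
Qed.

Lemma dcyc_gen xi : exists c, dcyc t B xi W =
  \sum_(k : ovr_idx B) dcyc t B (ovr_dual B (tagged k)) W * cD (c k).
Proof.
exists (fun k => tl_inv t xi (ovrX k)).
rewrite dcyc_dr (dr_expand _ (tl_invP t_sym xi).1).
by apply: eq_bigr => k _; rewrite dcyc_dr.
Qed.

Local Notation J := (jacobian_ideal t B W).
Local Notation A := (rquot J).
Local Notation q := (rcls J).

Lemma jacobian_deg y : (exists xi, y = dcyc t B xi W) -> y 0%N = 0.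
Proof. by case=> xi ->; apply: dcyc_deg. Qed.

Variable N : nat.
Hypothesis highJ : forall w : T, deg_ge N w -> J w.
Hypothesis injA : self_injective A.

(** By [double_annihilator] it suffices that x kills every column c with sum X_p c_p = 0. Stripping
    the first arrow off this relation writes e_{s(p)} c_p as a combination over l of second
    derivatives at p and l, with coefficients independent of p, and x kills these. *)
Lemma jacobian_exact (x : und_idx B -> A) :
  (forall p, x p * q (cD (idem S (src (tag p)))) = x p) ->
  (forall l : ovr_idx B,
     \sum_p x p * q (dr (ovr_l l) (dcyc t B (und_dual B (tagged p)) W)) = 0) ->
  exists y, forall p, x p = y * q (cM (undX p)).
Proof.
move=> xE xr.
apply: (double_annihilator jacobian_deg highJ uL uC (@idemC _ _ S) (@idem_orth _ _ S)
  (@idem_idem _ _ S) (idem_sum S) (@idem_neq0 _ _ S) (@idem_div _ _ S) injA) => c bc.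
have [c' cE] := boolp.choice (fun p => rcls_surj (c p)).
have Jz : J (\sum_p cM (undX p) * c' p).
  apply/rcls0P; rewrite rcls_sum -[RHS]bc; apply: eq_bigr => p _.
  by rewrite rclsM cE.
have gen y : (exists xi, y = dcyc t B xi W) -> exists c, y =
    \sum_(k : ovr_idx B) dcyc t B (ovr_dual B (tagged k)) W * cD (c k).
  by case=> xi ->; apply: dcyc_gen.
have Jr (l : ovr_idx B) : J (dcyc t B (ovr_dual B (tagged l)) W).
  by apply: closed_genW; exists (ovr_dual B (tagged l)).
have [v [j [Jj zE]]] := closed_ideal_right_strip highJ uL uC Jr dcyc_cDl gen Jz.
(* The left derivative along p isolates c_p: terms from J stay in J, and symmetry rewrites the
   derivative of r_l along p as that of r_p along l. *)
have cE' p : q (cD (idem S (src (tag p)))) * c p =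
    \sum_l q (dr (ovr_l l) (dcyc t B (und_dual B (tagged p)) W)) * q (v l).
  have := congr1 (dl (und_r p)) zE; rewrite (dlD (uL p)) !(dl_sum (uL p)).
  under eq_bigr => k _ do rewrite (dl_cM (uL p)) und_r_delta //.
  rewrite (bigD1 p) //= eqxx big1 ?addr0 => [|k]; last first.
    by rewrite eq_sym => /negPf ->; rewrite ctens_D0 mul0r.
  move/(congr1 q); rewrite rclsM cE => ->; rewrite rclsD.
  rewrite [X in _ + X](_ : _ = 0) ?addr0; last first.
    apply/rcls0P/ideal_sum => k _; rewrite (dl_cM (uL p)); exact: idealMl.
  rewrite rcls_sum; apply: eq_bigr => l _; rewrite -rclsM; congr q.
  rewrite (dl_mul uL uC _ (uL p)) ?dcyc_deg //.
  by congr (_ * _); apply: dl_dcyc.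
under eq_bigr => p _ do rewrite -xE -mulrA cE' mulr_sumr.
rewrite exchange_big big1 //= => l _.
under eq_bigr => p _ do rewrite mulrA.
by rewrite -mulr_suml xr mul0r.
Qed.

(** If the relation vanished, the unit vector at p would satisfy the equations of [jacobian_exact],
    making e_{s(p)} congruent to a multiple of an arrow; degree 0 forbids this. *)
Lemma dcyc_neq0 (p : und_idx B) : dcyc t B (und_dual B (tagged p)) W <> 0.
Proof.
move=> r0; pose x p' : A := if p' == p then q (cD (idem S (src (tag p)))) else 0.
have [p'|l|y yP] := @jacobian_exact x.
- rewrite /x; case: eqP => [->|_]; last by rewrite mul0r.
  by rewrite -rclsM -ctens_DM idem_idem.
- rewrite big1 // => p' _; rewrite /x; case: eqP => [->|_]; last by rewrite mul0r.
  by rewrite r0 (dr0 (oL l)) rcls0 mulr0.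
have := yP p; rewrite /x eqxx; have [v <-] := rcls_surj y; rewrite -rclsM => /rcls_eq.
move=> /(closed_ideal_deg jacobian_deg); rewrite -[LHS]/(idem S _ - (v * _) 0%N).
by rewrite ctens_mul_0 mulr0 subr0; apply: idem_neq0.
Qed.

End Jacobian.

(** * Maps of tensor algebras and the grading of a cut *)

Section TensorMapTheory.
Variables (D : pzRingType) (V V' : zmodType) (M : bimod D D V) (M' : bimod D D V').
Variable p : V -> V'.
Hypothesis pD : {morph p : x y / x + y}.
Hypothesis pl : forall d m, p (lact M d m) = lact M' d (p m).
Hypothesis pr : forall d m, p (ract M m d) = ract M' (p m) d.
Local Notation phi := (ctens_map (M := M) M' p).

Lemma tpow_map_lin k :
  (forall x y : tpow M k, tpow_map M' p (x + y) = tpow_map M' p x + tpow_map M' p y) /\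
  (forall d (x : tpow M k), tpow_map M' p (d *: x) = d *: tpow_map M' p x).
Proof.
elim: k => [|k [IHD IHZ]] //.
have b : balanced M (fun m (u : tpow M k) => tpure M' (p m) (tpow_map M' p u)).
  split=> [m m' u|m u u'|m d u]; first by rewrite pD tpureDl.
    by rewrite IHD tpureDr.
  by rewrite IHZ pr tpure_bal.
have DD (x y : tpow M k.+1) : tpow_map M' p (x + y) = tpow_map M' p x + tpow_map M' p y.
  exact: (tliftD b).
split=> // d x; elim/tpowS_ind: x => [|m u x IH].
  by rewrite scaler0 [tpow_map M' p 0](tlift0 b) scaler0.
rewrite scalerDr !DD IH scalerDr; congr (_ + _); rewrite tpureZ.
have pE m' : tpow_map M' p (tpure M m' u : tpow M k.+1) =
  tpure M' (p m') (tpow_map M' p u) by exact: (tliftE b).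
by rewrite !pE pl -tpureZ.
Qed.

Lemma tpow_mapS k m (u : tpow M k) :
  tpow_map M' p (tpure M m u : tpow M k.+1) = tpure M' (p m) (tpow_map M' p u).
Proof.
have [IHD IHZ] := tpow_map_lin k.
have b : balanced M (fun m (u : tpow M k) => tpure M' (p m) (tpow_map M' p u)).
  split=> [m1 m' u1|m1 u1 u'|m1 d u1]; first by rewrite pD tpureDl.
    by rewrite IHD tpureDr.
  by rewrite IHZ pr tpure_bal.
exact: (tliftE b).
Qed.

Lemma ctens_mapD x y : phi (x + y) = phi x + phi y.
Proof. by apply: ctens_ext => n; apply: (tpow_map_lin n).1. Qed.
Lemma ctens_map0 : phi 0 = 0.
Proof. by apply: (addrI (phi 0)); rewrite -ctens_mapD !addr0. Qed.
Lemma ctens_mapB x y : phi (x - y) = phi x - phi y.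
Proof. by apply: (addIr (phi y)); rewrite -ctens_mapD !subrK. Qed.
Lemma ctens_map_sum (I : Type) (r : seq I) (P : pred I) (F : I -> ctens M) :
  phi (\sum_(i <- r | P i) F i) = \sum_(i <- r | P i) phi (F i).
Proof. exact: (big_morph phi ctens_mapD ctens_map0). Qed.
Lemma tpow_map0 k : tpow_map M' p (0 : tpow M k) = 0.
Proof.
by apply: (addrI (tpow_map M' p (0 : tpow M k))); rewrite -(tpow_map_lin k).1 !addr0.
Qed.
Lemma ctens_map_cD d : phi (ctens_D M d) = ctens_D M' d.
Proof. by apply: ctens_ext => -[|n] //; apply: tpow_map0. Qed.
Lemma ctens_map_cDM d w : phi (ctens_D M d * w) = ctens_D M' d * phi w.
Proof.
by apply: ctens_ext => n; rewrite ctens_D_mulE -(tpow_map_lin n).2 /ctens_map ctens_D_mulE.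
Qed.
Lemma ctens_map_cMM m w : phi (ctens_M M m * w) = ctens_M M' (p m) * phi w.
Proof.
apply: ctens_ext => -[|n]; first by rewrite ctens_M_mul0 /ctens_map ctens_M_mul0.
by rewrite ctens_M_mulS -tpow_mapS /ctens_map ctens_M_mulS.
Qed.
Lemma ctens_map_cM m : phi (ctens_M M m) = ctens_M M' (p m).
Proof. by rewrite -[ctens_M M m]mulr1 ctens_map_cMM -ctens_D1 ctens_map_cD mulr1. Qed.
Lemma ctens_map_deg n w : deg_ge n w -> deg_ge n (phi w).
Proof. by move=> hw k kn; rewrite /ctens_map hw // tpow_map0. Qed.

Variables (I : finType) (Y : I -> V) (gY : I -> V -> D).
Hypothesis gY_lin : forall i, rlin M (gY i).
Hypothesis casY : forall x, \sum_i ract M (Y i) (gY i x) = x.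

Lemma ctens_mapM x y : phi (x * y) = phi x * phi y.
Proof.
apply: ctens_ext => n; elim: n x => [|n IH] x.
  by rewrite ctens_mul_0 /ctens_map ctens_mul_0.
rewrite (dl_decomp gY_lin casY x) !ctens_mapD !mulrDl ctens_mapD ctens_map_cDM.
rewrite ctens_map_cD !ctensD; congr (_ + _).
rewrite mulr_suml !ctens_map_sum mulr_suml !ctens_sumE; apply: eq_bigr => i _.
by rewrite -mulrA !ctens_map_cMM -mulrA !ctens_M_mulS IH.
Qed.

Lemma ctens_map_dr f f' w : llin M f -> llin M' f' -> (forall m, f m = f' (p m)) ->
  phi (dr f w) = dr f' (phi w).
Proof.
move=> hf hf' ff'; apply: ctens_ext => n; elim: n w => [|n IH] w;
  rewrite (dl_decomp gY_lin casY w) ctens_mapD (drD hf) (drD hf') ctens_map_cD;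
  rewrite !dr_cD // !add0r (dr_sum hf) !ctens_map_sum (dr_sum hf') !ctens_sumE;
  apply: eq_bigr => i _; rewrite ctens_map_cMM (dr_cM hf) (dr_cM hf');
  rewrite ctens_mapD ctens_map_cD ctens_map_cMM ff' pr !ctensD //.
- by rewrite !ctens_M_mul0.
- by rewrite !ctens_M_mulS IH.
Qed.
End TensorMapTheory.

(** * The grading by the number of arrows in C *)

Section Grading.
Variables (K : fieldType) (Q : quiver) (S : species K Q).
Variables (t : {linear sD S -> K^o}) (B : bases S) (W : sT S).
Hypothesis t_sym : symmetrizing t.
Hypothesis B_dual : dual_bases t B.
Variable C : {set Q1 Q}.
Local Notation bM := (sM_bimod S).
Local Notation cD := (ctens_D bM).
Local Notation cM := (ctens_M bM).
Local Notation T := (sT S).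
Local Notation undX := (@undX K Q S B).
Local Notation ovrX := (@ovrX K Q S B).
Local Notation und_r := (@und_r K Q S t B).
Local Notation ovr_l := (@ovr_l K Q S t B).
Local Notation ovr_r := (@ovr_r K Q S t B).

Let uL := und_r_lin t_sym (B := B).
Let uC := und_casimir t_sym B_dual.

(** Integer valued, so that derivatives can reach negative degrees, where [cut_graded_lt0] forces
    vanishing. *)
Definition deg_arrow (a : Q1 Q) : int := (a \in C : nat)%:Z.

(* The degree n component of w lies in the span of the paths with z arrows in C. *)
Fixpoint cut_graded (n : nat) (z : int) (w : T) : Prop :=
  if n is n'.+1 then
    forall p, cut_graded n' (z - deg_arrow (tag p)) (dl (und_r p) w)
  else w 0%N = 0 \/ z = 0.

Lemma cut_gradedS n z w :
  (forall p, cut_graded n (z - deg_arrow (tag p)) (dl (und_r p) w)) ->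
  cut_graded n.+1 z w.
Proof. by []. Qed.

Lemma cut_graded_loc n z w : w n = 0 -> cut_graded n z w.
Proof.
elim: n z w => [|n IH] z w w0 /=; first by left.
by move=> p; apply: IH; rewrite /dl w0; apply: (tlift0 (dl_bal (uL p) n)).
Qed.
Lemma cut_gradedD n z w w' :
  cut_graded n z w -> cut_graded n z w' -> cut_graded n z (w + w').
Proof.
elim: n z w w' => [|n IH] z w w' /=; last first.
  by move=> h h' p; rewrite (dlD (uL p)); apply: IH.
by move=> [w0|->] [w0'|z0]; auto; left; rewrite ctensD w0 w0' addr0.
Qed.
Lemma cut_graded_sum n z (I : finType) (F : I -> T) :
  (forall i, cut_graded n z (F i)) -> cut_graded n z (\sum_i F i).
Proof.
move=> h; apply: big_ind => //; [exact: cut_graded_loc | exact: cut_gradedD].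
Qed.
Lemma cut_graded_eq n z (w w' : T) : w n = w' n -> cut_graded n z w -> cut_graded n z w'.
Proof.
move=> e h; rewrite -(subrK w w'); apply: cut_gradedD h.
by apply: cut_graded_loc; rewrite -[LHS]/(w' n - w n) e; apply: subrr.
Qed.

Lemma und_r_inM p a m : tag p != a -> und_r p (inM (m : smod S a)) = 0.
Proof.
move=> pa; apply: (tr_inv_local t_sym (und_in_dual B_dual (p := p))).
by rewrite inM_neq // eq_sym.
Qed.

Lemma cut_graded_cDl n z d w : cut_graded n z w -> cut_graded n z (cD d * w).
Proof.
elim: n z d w => [|n IH] z d w /=.
  by case=> [w0|]; [left; rewrite ctens_D_mulE w0 scaler0 | right].
move=> h p; rewrite (dl_cDl uL uC) // (dl_expand t_sym B_dual); last exact: rlin_lact.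
apply: cut_graded_sum => k; have [e|ne] := eqVneq (tag p) (tag k).
  by apply: IH; rewrite e.
by rewrite inM_lact und_r_inM // ctens_D0 mul0r; apply: cut_graded_loc.
Qed.

Lemma cut_graded_dl n z a xi w : in_dual a xi ->
  cut_graded n.+1 z w -> cut_graded n (z - deg_arrow a) (dl (tr_inv t xi) w).
Proof.
move=> ha h; have hr := (tr_invP t_sym xi).1; rewrite (dl_expand t_sym B_dual _ hr).
apply: cut_graded_sum => k; have [<-|ne] := eqVneq (tag k) a.
  exact/cut_graded_cDl/h.
rewrite (tr_inv_local t_sym ha) ?ctens_D0 ?mul0r; first exact: cut_graded_loc.
by rewrite /undX inM_neq.
Qed.

Lemma cut_graded_cMl n z a (m : smod S a) w :
  cut_graded n z w -> cut_graded n.+1 (z + deg_arrow a) (cM (inM m) * w).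
Proof.
move=> h; apply: cut_gradedS => p; rewrite (dl_cM (uL p)); have [->|ne] := eqVneq (tag p) a.
  by rewrite addrK; apply: cut_graded_cDl.
by rewrite und_r_inM // ctens_D0 mul0r; apply: cut_graded_loc.
Qed.

Lemma cut_graded_cMr n z a (m : smod S a) w :
  cut_graded n z w -> cut_graded n.+1 (z + deg_arrow a) (w * cM (inM m)).
Proof.
elim: n z w => [|n IH] z w h; apply: cut_gradedS => p.
  rewrite (dl_decomp uL uC w) mulrDl (dlD (uL p)) -ctens_M_lact.
  rewrite -[cM _]mulr1 (dl_cM (uL p)) mulr1; apply: cut_gradedD; last first.
    apply: cut_graded_loc; rewrite (dl_mul uL uC) ?ctens_mul_0 /= ?mulr0 //.
    by rewrite ctens_sumE big1 // => k _; rewrite ctens_M_mul0.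
  have [->|ne] := eqVneq (tag p) a; last first.
    by rewrite inM_lact und_r_inM // ctens_D0; apply: cut_graded_loc.
  rewrite addrK; case: h => [->|->]; last by right.
  left; rewrite inM_lact lact0l inM0; case: (uL p) => gD _.
  have -> : und_r p 0 = 0 by apply: (addrI (und_r p 0)); rewrite -gD !addr0.
  by [].
rewrite (dl_decomp uL uC w) mulrDl (dlD (uL p)) -ctens_M_lact.
rewrite -[cM _]mulr1 (dl_cM (uL p)) mulr1; apply: cut_gradedD.
  by apply: cut_graded_loc.
rewrite (dl_mul uL uC) //; last by rewrite ctens_sumE big1 // => k _; rewrite ctens_M_mul0.
rewrite addrAC; apply: IH; apply: cut_graded_eq (h p).
by rewrite {1}(dl_decomp uL uC w) (dlD (uL p)) (dl_cD (uL p)) add0r.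
Qed.

Lemma cut_graded_dr n z a xi w : in_dual a xi ->
  cut_graded n.+1 z w -> cut_graded n (z - deg_arrow a) (dr (tl_inv t xi) w).
Proof.
move=> ha; have hl := (tl_invP t_sym xi).1; elim: n z w => [|n IH] z w h.
  have [->|nz] := eqVneq z (deg_arrow a); first by right; rewrite subrr.
  left; rewrite (dl_decomp uL uC w) (drD hl) (dr_cD hl) add0r (dr_sum hl).
  rewrite ctens_sumE big1 // => p _; rewrite (dr_cM hl) ctensD ctens_M_mul0 addr0.
  rewrite (tl_inv_local t_sym ha) // /undX inM_ract.
  have [pa|ne] := eqVneq (tag p) a; last by rewrite inM_neq.
  case: (h p) => [->|/eqP ze]; last by rewrite subr_eq0 pa (negPf nz) in ze.
  by rewrite ract0l inM0.
apply: cut_gradedS => p; rewrite (dl_dr uL uC _ hl (uL p)).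
by rewrite addrAC; apply: IH.
Qed.

(** Each left derivative lowers the count by 0 or 1, so a negative count never becomes the 0 allowed
    in tensor degree 0. *)
Lemma cut_graded_lt0 n z w : z < 0 -> cut_graded n z w -> w n = 0.
Proof.
elim: n z w => [|n IH] z w z0 /=; first by case=> // ze; rewrite ze in z0.
move=> h; rewrite (dl_decomp uL uC w) ctensD /= add0r ctens_sumE big1 // => p _.
rewrite ctens_M_mulS (IH _ _ _ (h p)) ?tpure0r // /deg_arrow.
by rewrite (le_lt_trans _ z0) // gerBl.
Qed.

Lemma cut_graded_rotate n z w :
  cut_graded n z w -> cut_graded n z (rotate (M := bM) ovrX ovr_r w).
Proof.
case: n => [|n] h.
  by apply: cut_graded_loc; rewrite /rotate ctens_sumE big1 // => k _;
    rewrite ctens_mul_0 /= mulr0.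
apply: cut_graded_sum => k; rewrite -(subrK (deg_arrow (tag k)) z).
apply: cut_graded_cMr; apply: cut_graded_dl h; exact: ovr_in_dual.
Qed.

Lemma cut_graded_cyclic n z w :
  cut_graded n z w -> cut_graded n z (cyclic_sum (M := bM) ovrX ovr_r w).
Proof.
move=> h; apply: (@cut_graded_eq _ _
    (\sum_(k < n) iter k (rotate (M := bM) ovrX ovr_r) w)).
  by rewrite ctens_sumE.
apply: cut_graded_sum => k; elim: (val k) => [//|j IH].
exact: cut_graded_rotate.
Qed.

Lemma cut_graded_dcyc n z a xi : (forall n, cut_graded n z W) -> in_dual a xi ->
  cut_graded n (z - deg_arrow a) (dcyc t B xi W).
Proof.
by move=> hW ha; rewrite dcycE //; apply: cut_graded_dl ha _; apply: cut_graded_cyclic.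
Qed.

Lemma cut_graded_path n c w : path_tensor c w ->
  cut_graded n (count (mem C) c : nat)%:Z w.
Proof.
elim: c n w => [|a c IH] n w /=.
  move=> ->; case: n => [|n]; first by right.
  by apply: cut_graded_loc.
move=> [m [w' [cw' ->]]]; rewrite PoszD addrC; case: n => [|n].
  by apply: cut_graded_loc; rewrite ctens_M_mul0.
exact/cut_graded_cMl/IH.
Qed.

(** Rotating a cycle does not change how many arrows of C it contains. *)
Lemma cut_graded_carried (P : seq (Q1 Q) -> Prop) k n :
  (forall c, P c -> count (mem C) c = k) -> carried_by P W -> cut_graded n k%:Z W.
Proof.
move=> Pk [m [c [r [w [cw ->]]]]]; apply: cut_graded_sum => j.
have [Pc pw] := cw j; rewrite -(Pk _ Pc).
have /permPl/seq.permP <- := perm_rot (r j) (c j).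
exact: cut_graded_path.
Qed.

End Grading.

(** * Extension by zero of families over a set of arrows *)

Section ExtendByZero.
Variables (I : finType) (n : I -> nat) (P : pred I) (R : zmodType).

Lemma big_sig_tagged (H : forall b, 'I_(n b) -> R) :
  \sum_(b : {b : I | P b}) \sum_(k < n (val b)) H (val b) k =
  \sum_(p : {b : I & 'I_(n b)} | P (tag p)) H (tag p) (tagged p).
Proof.
have := sig_big_dep (op := +%R) P (fun _ _ => true) H.
under [RHS]eq_bigl => p do rewrite andbT.
move=> <-; rewrite [RHS](reindex_omap (val : {b | P b} -> I) insub) => [|b Pb].
  by apply: eq_bigl => b; rewrite valK eqxx andbT (valP b).
by rewrite insubT.
Qed.

Definition extend0 (x : forall b : {b : I | P b}, 'I_(n (val b)) -> R)
    (p : {b : I & 'I_(n b)}) : R :=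
  match decP (@idP (P (tag p))) with
  | left h => x (exist _ (tag p) h) (tagged p)
  | right _ => 0
  end.

Lemma extend0_in x (b : {b : I | P b}) (k : 'I_(n (val b))) :
  extend0 x (Tagged (fun b => 'I_(n b)) k) = x b k.
Proof.
case: b k => b Pb k; rewrite /extend0 /=; case: (decP idP) => [h|//].
by rewrite (bool_irrelevance h Pb).
Qed.
Lemma extend0_out x p : ~~ P (tag p) -> extend0 x p = 0.
Proof. by move=> nP; rewrite /extend0; case: (decP idP) => // h; rewrite h in nP. Qed.

Lemma tagged_sig (p : {b : I & 'I_(n b)}) : P (tag p) ->
  exists (b : {b : I | P b}) (k : 'I_(n (val b))), p = Tagged (fun b => 'I_(n b)) k.
Proof. by case: p => b k Pb; exists (exist _ b Pb), k. Qed.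
End ExtendByZero.

(** * Projection to, and inclusion of, the bimodules outside C *)

Section CutMaps.
Variables (K : fieldType) (Q : quiver) (S : species K Q) (C : {set Q1 Q}).
Local Notation SC := (cut_species S C).
Local Notation bM := (sM_bimod S).
Local Notation bC := (sM_bimod (cut_species S C) : bimod (sD S) (sD S) (sM (cut_species S C))).
Local Notation pr := (@cut_proj K Q S C).

Definition cut_ext (x : sM SC) : sM S := fun a =>
  match decP (@idP (a \notin C)) with
  | left h => x (exist _ a h)
  | right _ => 0
  end.

Lemma cut_ext_out x (b : Q1 (cut_quiver C)) : cut_ext x (val b) = x b.
Proof.
case: b => b nb; rewrite /cut_ext /=; case: (decP idP) => [h|//].
by rewrite (bool_irrelevance h nb).
Qed.
Lemma cut_ext_in x a : a \in C -> cut_ext x a = 0.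
Proof. by move=> aC; rewrite /cut_ext; case: (decP idP) => // h; have := h; rewrite aC. Qed.

Lemma cut_ext_notin x a (h : a \notin C) : cut_ext x a = x (exist _ a h).
Proof. exact: (cut_ext_out x (exist _ a h)). Qed.

Lemma cut_projK x : pr (cut_ext x) = x.
Proof. by apply: functional_extensionality_dep => b; apply: cut_ext_out. Qed.
Lemma cut_extK m a : a \notin C -> cut_ext (pr m) a = m a.
Proof. by move=> aC; rewrite cut_ext_notin. Qed.

Lemma cut_projD : {morph pr : x y / x + y}.
Proof. by move=> x y; apply: functional_extensionality_dep. Qed.
Lemma cut_proj_lact d m : pr (lact bM d m) = lact bC d (pr m).
Proof. by apply: functional_extensionality_dep. Qed.
Lemma cut_proj_ract d m : pr (ract bM m d) = ract bC (pr m) d.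
Proof. by apply: functional_extensionality_dep. Qed.

Lemma cut_extD : {morph cut_ext : x y / x + y}.
Proof.
move=> x y; apply: functional_extensionality_dep => a; rewrite dprodD.
have [aC|aC] := boolP (a \in C); first by rewrite !cut_ext_in // addr0.
by rewrite !(cut_ext_notin _ aC).
Qed.
Lemma cut_ext_lact d m : cut_ext (lact bC d m) = lact bM d (cut_ext m).
Proof.
apply: functional_extensionality_dep => a; rewrite /= /sM_lact.
have [aC|aC] := boolP (a \in C); first by rewrite !cut_ext_in // lact0.
by rewrite !(cut_ext_notin _ aC).
Qed.
Lemma cut_ext_ract d m : cut_ext (ract bC m d) = ract bM (cut_ext m) d.
Proof.
apply: functional_extensionality_dep => a; rewrite /= /sM_ract.
have [aC|aC] := boolP (a \in C); first by rewrite !cut_ext_in // ract0.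
by rewrite !(cut_ext_notin _ aC).
Qed.

Lemma cut_proj_inM a m : a \in C -> pr (inM (m : smod S a)) = 0.
Proof.
move=> aC; apply: functional_extensionality_dep => -[b nb]; rewrite /cut_proj inM_neq //.
by apply/eqP => /= e; have := nb; rewrite -e aC.
Qed.
Lemma cut_ext_proj_inM a m : a \notin C -> cut_ext (pr (inM (m : smod S a))) = inM m.
Proof.
move=> aC; apply: functional_extensionality_dep => b.
have [bC|bC] := boolP (b \in C); last by rewrite cut_extK.
by rewrite cut_ext_in // inM_neq //; apply: contraNneq aC => ->.
Qed.

End CutMaps.

(** * Complexes of projective modules *)

Section ProjectiveComplex.
Variables (R : pzRingType) (Q0 A : finType) (e : Q0 -> R).
Variables (P2 P1 : pred A) (n2 n1 : A -> nat) (v2 v1 : A -> Q0) (v0 : Q0).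
Variable c : forall b, 'I_(n2 b) -> forall a, 'I_(n1 a) -> R.
Variable m : forall a, 'I_(n1 a) -> R.
Hypothesis e_idem : forall i, e i * e i = e i.

Definition term2 : Type := dprod (fun b : {b : A | P2 b} =>
  dprod (fun _ : 'I_(n2 (val b)) => lideal (e (v2 (val b))))).
HB.instance Definition _ := GRing.Lmodule.on term2.
Definition term1 : Type := dprod (fun a : {a : A | P1 a} =>
  dprod (fun _ : 'I_(n1 (val a)) => lideal (e (v1 (val a))))).
HB.instance Definition _ := GRing.Lmodule.on term1.
Definition map2 (x : term2) : term1 := fun a j =>
  lideal_mul (e (v1 (val a)))
    (\sum_b \sum_(k < n2 (val b)) (lideal_val (x b k) : R) * c k j).
Definition map1 (y : term1) : lideal (e v0) :=
  lideal_mul (e v0) (\sum_a \sum_(j < n1 (val a)) (lideal_val (y a j) : R) * m j).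

Let I2 : finType := {b : A & 'I_(n2 b)}.
Let I1 : finType := {a : A & 'I_(n1 a)}.

Lemma lideal_valE i (z : lideal (e i)) : (lideal_val z : R) * e i = lideal_val z.
Proof. by case: z => z /= /asboolP [y ->]; rewrite -mulrA e_idem. Qed.


Lemma sum_extend (n : A -> nat) (P : pred A)
    (x : forall b : {b : A | P b}, 'I_(n (val b)) -> R) (G : {b : A & 'I_(n b)} -> R) :
  \sum_b \sum_k x b k * G (Tagged (fun b => 'I_(n b)) k) =
  \sum_p extend0 x p * G p.
Proof.
pose H b (k : 'I_(n b)) := extend0 x (Tagged (fun b => 'I_(n b)) k) *
  G (Tagged (fun b => 'I_(n b)) k).
transitivity (\sum_(b : {b | P b}) \sum_(k < n (val b)) H (val b) k).
  by apply: eq_bigr => b _; apply: eq_bigr => k _; rewrite /H extend0_in.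
rewrite (big_sig_tagged P H) [RHS](bigID (fun p => P (tag p))) /= [X in _ = _ + X]big1.
  by rewrite addr0; apply: eq_bigr => -[b k].
by move=> p nP; rewrite extend0_out // mul0r.
Qed.

Hypothesis c_e : forall (p : I2) (l : I1), c (tagged p) (tagged l) * e (v1 (tag l)) =
  c (tagged p) (tagged l).
Hypothesis m_e : forall l : I1, P1 (tag l) -> m (tagged l) * e v0 = m (tagged l).

Hypothesis kernel : forall x : I2 -> R,
  (forall p, ~~ P2 (tag p) -> x p = 0) ->
  (forall p, x p * e (v2 (tag p)) = x p) ->
  (forall l : I1, P1 (tag l) -> \sum_p x p * c (tagged p) (tagged l) = 0) ->
  forall p, x p = 0.

Let map2E (x : term2) (a : {a : A | P1 a}) (j : 'I_(n1 (val a))) :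
  lideal_val ((map2 x : term1) a j) = \sum_p extend0 (fun b k => lideal_val (x b k) : R) p *
    c (tagged p) j.
Proof.
have /= <- := sum_extend (fun b k => lideal_val (x b k) : R)
  (fun p => c (tagged p) j).
rewrite /map2 /= mulr_suml; apply: eq_bigr => b _; rewrite mulr_suml.
apply: eq_bigr => k _; rewrite -mulrA; congr (_ * _).
exact: (c_e (Tagged (fun b => 'I_(n2 b)) k) (Tagged (fun a => 'I_(n1 a)) j)).
Qed.

Lemma map2_inj : injective map2.
Proof.
move=> x x' xx'.
pose d (b : {b | P2 b}) (k : 'I_(n2 (val b))) : R :=
  (lideal_val (x b k) : R) - lideal_val (x' b k).
have dE p : extend0 d p = extend0 (fun b k => lideal_val (x b k) : R) p -
    extend0 (fun b k => lideal_val (x' b k) : R) p.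
  have [Pp|nP] := boolP (P2 (tag p)); last by rewrite !extend0_out // subr0.
  by have [b [k ->]] := tagged_sig Pp; rewrite !extend0_in.
have d0 p : extend0 d p = 0.
  move: p; apply: kernel => [p|p|[a j] /= Pa]; first exact: extend0_out.
    have [Pp|nP] := boolP (P2 (tag p)); last by rewrite extend0_out // mul0r.
    have [b [k ->]] := tagged_sig Pp.
    by rewrite extend0_in /d mulrBl !lideal_valE.
  under eq_bigr => p _ do rewrite dE mulrBl.
  rewrite sumrB; have := congr1 (fun y : term1 => lideal_val (y (exist _ a Pa) j)) xx'.
  by rewrite !map2E => ->; rewrite subrr.
apply: functional_extensionality_dep => b; apply: functional_extensionality_dep => k.
apply: val_inj; apply/eqP; rewrite -subr_eq0; apply/eqP.
by have := d0 (Tagged (fun b => 'I_(n2 b)) k); rewrite extend0_in.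
Qed.

Hypothesis middle : forall w : I1 -> R,
  (forall l, ~~ P1 (tag l) -> w l = 0) ->
  (forall l, w l * e (v1 (tag l)) = w l) ->
  \sum_l w l * m (tagged l) = 0 ->
  exists u : I2 -> R, (forall (p : I2) (l : I1), u p * e (v2 (tag p)) * c (tagged p) (tagged l) =
      u p * c (tagged p) (tagged l)) /\
    forall l : I1, P1 (tag l) -> w l = \sum_(p : I2 | P2 (tag p)) u p * c (tagged p) (tagged l).
Hypothesis compose0 : forall p : I2, P2 (tag p) ->
  \sum_(l : I1 | P1 (tag l)) c (tagged p) (tagged l) * m (tagged l) = 0.

Let map1E (y : term1) :
  lideal_val (map1 y) = \sum_l extend0 (fun a j => lideal_val (y a j) : R) l * m (tagged l).
Proof.
have /= <- := sum_extend (fun a j => lideal_val (y a j) : R) (fun l => m (tagged l)).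
rewrite /map1 /= mulr_suml; apply: eq_bigr => a _; rewrite mulr_suml.
apply: eq_bigr => j _; rewrite -mulrA; congr (_ * _).
exact: (m_e (l := Tagged (fun a => 'I_(n1 a)) j) (valP a)).
Qed.

Lemma exact_map2_map1 : exact_at map2 map1.
Proof.
move=> y; split=> [y0|[x <-]].
  have := congr1 (fun z : lideal (e v0) => lideal_val z) y0; rewrite map1E => sum0.
  have [||u [ue uE]] := middle _ _ sum0.
  - by move=> l; apply: extend0_out.
  - move=> l; have [Pl|nP] := boolP (P1 (tag l)); last by rewrite extend0_out // mul0r.
    have [a [j ->]] := tagged_sig Pl.
    by rewrite extend0_in; apply: lideal_valE.
  pose x : term2 := fun b k =>
    lideal_mul (e (v2 (val b))) (u (Tagged (fun b => 'I_(n2 b)) k)).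
  exists x; apply: functional_extensionality_dep => a.
  apply: functional_extensionality_dep => j; apply: val_inj.
  rewrite [LHS](map2E x) -[RHS](extend0_in (fun a j => lideal_val (y a j) : R)).
  rewrite uE /=; last exact: valP.
  rewrite [RHS]big_mkcond; apply: eq_bigr => -[b k] _ /=.
  case: ifP => [Pb|nPb]; last by rewrite extend0_out ?mul0r //= nPb.
  rewrite -[b]/(val (exist (fun b => P2 b) b Pb)) extend0_in /=.
  exact: (ue (Tagged (fun b => 'I_(n2 b)) k) (Tagged (fun a => 'I_(n1 a)) j)).
apply: val_inj; rewrite -[LHS]/(lideal_val _) map1E.
transitivity (\sum_p extend0 (fun b k => lideal_val (x b k) : R) p *
   \sum_(l : I1 | P1 (tag l)) c (tagged p) (tagged l) * m (tagged l)).
  under [RHS]eq_bigr => p _ do rewrite mulr_sumr.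
  rewrite exchange_big [RHS]big_mkcond; apply: eq_bigr => -[a j] _ /=.
  case: ifP => [Pa|nPa]; last by rewrite extend0_out ?mul0r //= nPa.
  rewrite -[a]/(val (exist (fun a => P1 a) a Pa)) extend0_in.
  rewrite -[X in X * _]/(lideal_val ((map2 x : term1) (exist _ a Pa) j)) map2E mulr_suml.
  by apply: eq_bigr => p _; rewrite mulrA.
rewrite big1 // => p _; have [Pp|nP] := boolP (P2 (tag p)).
  by rewrite compose0 // mulr0.
by rewrite extend0_out // mul0r.
Qed.

Variable rad : R -> Prop.
Hypothesis rad0 : rad 0.
Hypothesis radD : forall x y, rad x -> rad y -> rad (x + y).
Hypothesis radMl : forall a x, rad x -> rad (a * x).
Hypothesis rad_nilp : forall x, rad x -> exists n, x ^+ n = 0.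
Hypothesis rad_e : ~ rad (e v0).
Hypothesis rad_div : forall x, rad (x * e v0) \/ exists d, rad (d * (x * e v0) - e v0).
Hypothesis rad_m : forall l : I1, P1 (tag l) -> rad (m (tagged l)).
Hypothesis rad_gen : forall x, rad x -> exists w : I1 -> R,
  x * e v0 = \sum_(l : I1 | P1 (tag l)) w l * e (v1 (tag l)) * m (tagged l).

Let U := lideal (e v0).
Let gen : U := lideal_mul (e v0) 1.

Let radp : pred U := fun y => `[< rad (lideal_val y) >].
Fact radp_closed : submod_closed radp.
Proof.
split=> [|a x y /asboolP hx /asboolP hy]; apply/asboolP; first exact: rad0.
by apply: radD => //; apply: radMl.
Qed.
Let radU : submodClosed U :=
  HB.pack radp (GRing.isSubmodClosed.Build R U radp radp_closed).

Let genE (y : U) : y = (lideal_val y : R) *: gen.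
Proof.
by apply: val_inj; rewrite /= -[RHS]/((lideal_val y : R) * (1 * e v0)) mul1r lideal_valE.
Qed.

(** By [rad_div] the module is local: a submodule containing [rad] and any further element contains
    the generator. *)
Lemma rad_maximal : maximal_submod radU.
Proof.
split; first by exists gen; apply/negP => /asboolP; rewrite /= mul1r.
move=> N' sub; have [h|h] := pselect (exists2 x, x \in N' & ~ rad (lideal_val x)); last first.
  by left=> x xN; apply/asboolP; apply: contrapT => nr; apply: h; exists x.
case: h => x xN nrx; right=> y; rewrite (genE y) rpredZ //.
have := rad_div (lideal_val x); rewrite lideal_valE => -[//|[d hd]].
have -> : gen = d *: x - (d *: x - gen) by rewrite subKr.
rewrite -[- (_ - _)]scaleN1r; apply: rpredD; first exact: rpredZ.
apply: rpredZ.
by apply: sub; apply/asboolP; rewrite /= mul1r.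
Qed.

Let addp (N' : submodClosed U) : pred U := fun x =>
  `[< exists n p, [/\ n \in N', rad (lideal_val p) & x = n + p] >].
Fact addp_closed N' : submod_closed (addp N').
Proof.
split=> [|a x y /asboolP [n [p [hn hp ->]]] /asboolP [n' [p' [hn' hp' ->]]]]; apply/asboolP.
  by exists 0, 0; split; rewrite ?rpred0 ?addr0.
exists (a *: n + n'), (a *: p + p'); split.
- by rewrite rpredD ?rpredZ.
- by apply: radD => //; apply: radMl.
by rewrite scalerDr addrACA.
Qed.

(** One inclusion is [rad_maximal]. Conversely, a maximal submodule missing y would span the module
    together with [rad]; writing the generator as n + p, nilpotency of p puts the generator into
    that submodule. *)
Lemma radicalE (y : U) : (y \in radical_submod U) <-> rad (lideal_val y).
Proof.
split=> [/asboolP /(_ _ rad_maximal) /asboolP //|ry].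
apply/asboolP => N' [[z zN] mx]; apply: contrapT => yN.
have sub : {subset N' <= (HB.pack (addp N')
    (GRing.isSubmodClosed.Build R U (addp N') (addp_closed N')) : submodClosed U)}.
  by move=> x xN; apply/asboolP; exists x, 0; split; rewrite ?addr0.
have [sub'|all'] := mx _ sub.
  by apply: yN; apply: sub'; apply/asboolP; exists 0, y; rewrite rpred0 add0r.
have /asboolP [n [p [hn hp gE]]] := all' gen.
have L0 : (fun x => x \in N') (0 : U) by apply: rpred0.
have LP a (x x' : U) : x \in N' -> x' \in N' -> a *: x + x' \in N'.
  by move=> hx hx'; rewrite rpredD ?rpredZ.
have [k pk] := rad_nilp hp.
have: gen \in N'.
  apply: (submodule_nilp (L := Submodule L0 LP) pk) => /=.
  by rewrite -genE gE addrK.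
by move=> gN; rewrite (genE z) rpredZ in zN.
Qed.

Lemma exact_map1_top : exact_at map1 (@mod_top_proj R U).
Proof.
move=> y; rewrite /mod_top_proj.
have -> : (lcls (radical_submod U) y = 0) <-> rad (lideal_val y).
  have -> : 0 = lcls (radical_submod U) 0.
    by apply: (addrI (lcls (radical_submod U) 0)); rewrite -lclsD !addr0.
  by rewrite lcls_eq subr0 radicalE.
split=> [/rad_gen [w wE]|[x <-]].
  exists (fun a j => lideal_mul (e (v1 (val a))) (w (Tagged (fun a => 'I_(n1 a)) j))).
  apply: val_inj; rewrite -[LHS]/(lideal_val _) map1E -[RHS]lideal_valE wE.
  rewrite [RHS]big_mkcond; apply: eq_bigr => -[a j] _ /=.
  case: ifP => [Pa|nPa]; last by rewrite extend0_out ?mul0r //= nPa.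
  by rewrite -[a]/(val (exist (fun a => P1 a) a Pa)) extend0_in.
rewrite map1E; apply: big_ind => //.
move=> l _; have [Pl|nP] := boolP (P1 (tag l)).
  by apply/radMl/rad_m.
by rewrite extend0_out // mul0r; exact: rad0.
Qed.

End ProjectiveComplex.

(* Abstract in R, so that the two convertible presentations of the cut algebra   *)
(* are compared only once.                                                       *)
Definition complex_exact (R : pzRingType) (Q0 A : finType) (e : Q0 -> R)
    (P2 P1 : pred A) (n2 n1 : A -> nat) (v2 v1 : A -> Q0) (v0 : Q0)
    (c : forall b, 'I_(n2 b) -> forall a, 'I_(n1 a) -> R)
    (m : forall a, 'I_(n1 a) -> R) : Prop :=
  [/\ injective (map2 (e := e) (P2 := P2) (P1 := P1) (v2 := v2) v1 c),
      exact_at (map2 (e := e) (P2 := P2) (P1 := P1) (v2 := v2) v1 c)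
        (map1 (e := e) (P1 := P1) (v1 := v1) v0 m)
    & exact_at (map1 (e := e) (P1 := P1) (v1 := v1) v0 m)
        (@mod_top_proj R (lideal (e v0)))].

(** * The complex of a cut *)

Section ScalarD.
Variables (K : fieldType) (Q : quiver) (S : species K Q).

Lemma scalar_DD : {morph scalar_D S : a b / a + b}.
Proof. by move=> a b; rewrite /scalar_D scalerDl. Qed.
Lemma scalar_DM : {morph scalar_D S : a b / a * b}.
Proof.
move=> a b; apply: functional_extensionality_dep => i; rewrite /scalar_D dprodM !dprodZ.
by rewrite -scalerAl mul1r scalerA.
Qed.
Lemma scalar_D1 : scalar_D S 1 = 1.
Proof. by rewrite /scalar_D scale1r. Qed.
End ScalarD.

(** * Descending exactness to a retract *)

Section RetractKernel.
Variables (T T' : pzRingType) (J : ideal T) (J' : ideal T') (res : T -> T') (incl : T' -> T).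
Hypothesis resB : {morph res : x y / x - y}.
Hypothesis resM : {morph res : x y / x * y}.
Hypothesis inclB : {morph incl : x y / x - y}.
Hypothesis inclM : {morph incl : x y / x * y}.
Hypothesis res_incl : forall w, res (incl w) = w.
Hypothesis res_ideal : forall w, J w -> J' (res w).
Hypothesis incl_ideal : forall w, J' w -> J (incl w).
Local Notation q := (rcls J).
Local Notation q' := (rcls J').

Variables (I L : finType) (PI : pred I) (PL : pred L).
Variables (e : I -> T) (e' : I -> T') (b : I -> T) (d : L -> I -> T).
Hypothesis incl_e : forall p, incl (e' p) = e p.
Hypothesis e_idem : forall p, e' p * e' p = e' p.
Hypothesis res_b : forall p, PI p -> res (b p) = 0.
Hypothesis d_incl : forall l p, PL l -> PI p -> incl (res (d l p)) = d l p.
Hypothesis d_eq0 : forall l p, ~~ PL l -> PI p -> d l p = 0.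
Hypothesis exactJ : forall X : I -> rquot J,
  (forall p, X p * q (e p) = X p) ->
  (forall l, \sum_p X p * q (d l p) = 0) -> exists y, forall p, X p = y * q (b p).

(* An element x of the kernel becomes y b in the larger quotient; restricting  *)
(* back kills b.                                                               *)
Lemma retract_kernel (x : I -> rquot J') :
  (forall p, ~~ PI p -> x p = 0) -> (forall p, x p * q' (e' p) = x p) ->
  (forall l, PL l -> \sum_p x p * q' (res (d l p)) = 0) ->
  forall p, x p = 0.
Proof.
move=> x0 xE xr.
have incl0 : incl 0 = 0 by rewrite -(subrr 0) inclB subrr.
have inclD : {morph incl : u v / u + v}.
  by move=> u v; rewrite -{1}[v]opprK -[- v]sub0r !inclB incl0 sub0r opprK.
(* Representatives are chosen fixed by e'_p and zero outside [PI], so that their inclusions have the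
   same properties exactly. *)
have lift p : exists w : T', [/\ q' w = x p, w * e' p = w & ~~ PI p -> w = 0].
  have [w wE] := rcls_surj (x p); have [Pp|nPp] := boolP (PI p).
    exists (w * e' p); split=> //; first by rewrite rclsM wE xE.
    by rewrite -mulrA e_idem.
  by exists 0; split; rewrite ?mul0r // rcls0 x0.
have [w wP] := boolp.choice lift.
pose X p := q (incl (w p)).
have XE p : X p * q (e p) = X p.
  by have [_ we _] := wP p; rewrite -rclsM -incl_e -inclM we.
have X0 p : ~~ PI p -> X p = 0.
  by move=> nP; have [_ _ /(_ nP) w0] := wP p; rewrite /X w0 incl0 rcls0.
have Xr l : \sum_p X p * q (d l p) = 0.
  have [Pl|nPl] := boolP (PL l); last first.
    rewrite big1 // => p _; have [Pp|/X0 ->] := boolP (PI p); last by rewrite mul0r.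
    by rewrite d_eq0 // rcls0 mulr0.
  have := xr l Pl.
  under eq_bigr => p _ do rewrite -(let: And3 eq _ _ := wP p in eq) -rclsM.
  rewrite -rcls_sum => /rcls0P /incl_ideal.
  rewrite (big_morph incl inclD incl0) => /rcls0P.
  rewrite rcls_sum => sum0; rewrite -[RHS]sum0; apply: eq_bigr => p _.
  rewrite -rclsM inclM; have [Pp|nP] := boolP (PI p); first by rewrite d_incl.
  by have [_ _ /(_ nP) ->] := wP p; rewrite incl0 !mul0r.
have [y yP] := exactJ XE Xr; have [v vE] := rcls_surj y.
move=> p; have [Pp|/x0 //] := boolP (PI p).
have [<- _ _] := wP p; apply/rcls0P; rewrite -(res_incl (w p)).
have := yP p; rewrite /X -vE -rclsM => /rcls_eq /res_ideal.
by rewrite resB resM res_b // mulr0 subr0.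
Qed.
End RetractKernel.

(** * The cut algebra as a retract, and exactness of its complex *)

Section CutExact.
Variables (K : fieldType) (Q : quiver) (S : species K Q).
Variables (t : {linear sD S -> K^o}) (B : bases S) (W : sT S) (C : {set Q1 Q}).
Hypothesis t_sym : symmetrizing t.
Hypothesis B_dual : dual_bases t B.
Hypothesis W_pot : is_potential W.
Local Notation SC := (cut_species S C).
Local Notation bM := (sM_bimod S).
Local Notation bC := (sM_bimod (cut_species S C) : bimod (sD S) (sD S) (sM (cut_species S C))).
Local Notation cD := (ctens_D bM).
Local Notation cM := (ctens_M bM).
Local Notation cD' := (ctens_D bC).
Local Notation cM' := (ctens_M bC).
Local Notation T := (ctens bM).
Local Notation T' := (ctens bC).
Local Notation pr := (@cut_proj K Q S C).
Local Notation ext := (@cut_ext K Q S C).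
Local Notation undX := (@undX K Q S B).
Local Notation ovrX := (@ovrX K Q S B).
Local Notation und_r := (@und_r K Q S t B).
Local Notation ovr_l := (@ovr_l K Q S t B).
Local Notation ovr_r := (@ovr_r K Q S t B).
Local Notation res := (ctens_map (M := bM) bC pr).
Local Notation incl := (ctens_map (M := bC) bM ext).
Local Notation graded := (@cut_graded K Q S t B C).

Let uL := und_r_lin t_sym (B := B).
Let uC := und_casimir t_sym B_dual.
Let oL := ovr_l_lin t_sym (B := B).
Let oC := ovr_casimir t_sym B_dual.

(** Projecting the bases of all arrows gives dual bases of S_C over the same index sets; members
    over arrows of C become 0. *)
Definition cut_undX p := pr (undX p).
Definition cut_und_r p x := und_r p (ext x).
Definition cut_ovrX l := pr (ovrX l).
Definition cut_ovr_l l x := ovr_l l (ext x).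

Lemma cut_und_lin p : rlin bC (cut_und_r p).
Proof.
have [gD gr] := uL p; split=> [x y|d x].
  by rewrite /cut_und_r cut_extD gD.
by rewrite /cut_und_r cut_ext_ract gr.
Qed.
Lemma cut_und_casimir x : \sum_p ract bC (cut_undX p) (cut_und_r p x) = x.
Proof.
rewrite -[RHS]cut_projK -(uC (ext x)); apply: functional_extensionality_dep => a.
by rewrite /cut_proj !dprod_sum.
Qed.
Lemma cut_ovr_lin l : llin bC (cut_ovr_l l).
Proof.
have [gD gr] := oL l; split=> [x y|d x].
  by rewrite /cut_ovr_l cut_extD gD.
by rewrite /cut_ovr_l cut_ext_lact gr.
Qed.
Lemma cut_ovr_casimir x : \sum_l lact bC (cut_ovr_l l x) (cut_ovrX l) = x.
Proof.
rewrite -[RHS]cut_projK -(oC (ext x)); apply: functional_extensionality_dep => a.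
by rewrite /cut_proj !dprod_sum.
Qed.

Let prD := @cut_projD K Q S C.
Let prl := @cut_proj_lact K Q S C.
Let prr := @cut_proj_ract K Q S C.
Let exD := @cut_extD K Q S C.
Let exl := @cut_ext_lact K Q S C.
Let exr := @cut_ext_ract K Q S C.

Lemma resD x y : res (x + y) = res x + res y. Proof. exact: ctens_mapD. Qed.
Lemma resB x y : res (x - y) = res x - res y. Proof. exact: ctens_mapB. Qed.
Lemma res_sum (I : Type) (r : seq I) (P : pred I) (F : I -> T) :
  res (\sum_(i <- r | P i) F i) = \sum_(i <- r | P i) res (F i).
Proof. exact: ctens_map_sum. Qed.
Lemma resM x y : res (x * y) = res x * res y.
Proof. exact: (ctens_mapM prD prl prr uL uC). Qed.
Lemma res_cD d : res (cD d) = cD' d. Proof. exact: ctens_map_cD. Qed.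
Lemma res_cM m : res (cM m) = cM' (pr m). Proof. exact: ctens_map_cM. Qed.
Lemma res_dr l w : tag l \notin C -> res (dr (ovr_l l) w) = dr (cut_ovr_l l) (res w).
Proof.
move=> lC; apply: (ctens_map_dr prD prl prr uL uC _ (oL l) (cut_ovr_lin l)) => m.
rewrite /cut_ovr_l /ovr_l (tl_inv_inM t_sym m (ovr_in_dual B_dual (p := l))).
rewrite [RHS](tl_inv_inM t_sym _ (ovr_in_dual B_dual (p := l))).
by rewrite cut_extK.
Qed.

Lemma inclB x y : incl (x - y) = incl x - incl y. Proof. exact: ctens_mapB. Qed.
Lemma inclM x y : incl (x * y) = incl x * incl y.
Proof. exact: (ctens_mapM exD exl exr cut_und_lin cut_und_casimir). Qed.
Lemma incl_cD d : incl (cD' d) = cD d. Proof. exact: ctens_map_cD. Qed.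

Lemma cut_res_incl w : res (incl w) = w.
Proof.
apply: ctens_ext => n; elim: n w => [|n IH] w //.
rewrite (dl_decomp cut_und_lin cut_und_casimir w) (ctens_mapD exD exl exr) resD.
rewrite (ctens_map_cD exD exl exr) res_cD !ctensD; congr (_ + _).
rewrite (ctens_map_sum exD exl exr) res_sum !ctens_sumE; apply: eq_bigr => p _.
rewrite (ctens_map_cMM exD exl exr) (ctens_map_cMM prD prl prr) !ctens_M_mulS.
by rewrite cut_projK -[X in tpure _ _ X]/(res (incl _) n) IH.
Qed.

Lemma cut_graded_res n z w : 0 < z -> graded n z w -> res w n = 0.
Proof.
elim: n z w => [|n IH] z w z0 /=; first by case=> [//|ze]; rewrite ze in z0.
move=> h; rewrite (dl_decomp uL uC w) resD res_cD ctensD /= add0r res_sum ctens_sumE.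
rewrite big1 // => p _; rewrite resM res_cM ctens_M_mulS.
have [pC|pC] := boolP (tag p \in C).
  rewrite /undX cut_proj_inM // -[LHS](ctens_M_mulS (M := bC)) ctens_M0 mul0r //.
rewrite (IH _ _ _ (h p)) ?tpure0r // /deg_arrow (negPf pC) subr0 //.
Qed.

(** A tensor of degree 0 contains no arrow of C, because stripping one off would leave negative
    degree; so the passage to S_C and back loses nothing. *)
Lemma cut_graded_incl n w : graded n 0 w -> incl (res w) n = w n.
Proof.
elim: n w => [//|n IH] w /= h.
rewrite [in LHS](dl_decomp uL uC w) [in RHS](dl_decomp uL uC w).
rewrite resD res_cD (ctens_mapD exD exl exr) (ctens_map_cD exD exl exr) !ctensD.
congr (_ + _); rewrite res_sum (ctens_map_sum exD exl exr) !ctens_sumE.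
apply: eq_bigr => p _; rewrite resM res_cM (ctens_map_cMM exD exl exr) !ctens_M_mulS.
have := h p; rewrite sub0r /deg_arrow; have [pC|pC] := boolP (tag p \in C) => hp.
  rewrite (cut_graded_lt0 t_sym B_dual _ hp) // tpure0r /undX cut_proj_inM //.
  have -> : ext 0 = 0 by apply: (addrI (ext 0)); rewrite -cut_extD !addr0.
  by rewrite -[LHS](ctens_M_mulS (M := bM)) ctens_M0 mul0r.
rewrite /undX cut_ext_proj_inM //; congr tpure.
by rewrite oppr0 in hp; rewrite -[RHS](IH _ hp).
Qed.

Hypothesis W_graded : forall n, graded n 1 W.
Definition cut_gen (y : T') : Prop := exists a (xi : sMdual S),
  [/\ a \in C, in_dual a xi & y = res (dcyc t B xi W)].
Local Notation J :=
  (closed_ideal (M := bM) (fun y : T => exists xi : sMdual S, y = dcyc t B xi W)).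
Local Notation J' := (closed_ideal cut_gen).
Local Notation q := (rcls J).
Local Notation q' := (rcls J').
Local Notation Lam := (rquot J').
Local Notation r xi := (dcyc t B xi W : T).

Lemma cut_ideal_gen a xi : a \in C -> in_dual a xi -> J' (res (r xi)).
Proof. by move=> aC ha; apply: closed_genW; exists a, xi. Qed.

Lemma res_dcyc_notin a xi : a \notin C -> in_dual a xi -> res (r xi) = 0.
Proof.
move=> aC ha; apply: ctens_ext => n; apply: (@cut_graded_res n 1) => //.
have := cut_graded_dcyc t_sym B_dual n W_graded ha.
by rewrite /deg_arrow (negPf aC) subr0.
Qed.

Lemma incl_res_dcyc a xi : a \in C -> in_dual a xi -> incl (res (r xi)) = r xi.
Proof.
move=> aC ha; apply: ctens_ext => n; apply: cut_graded_incl.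
by have := cut_graded_dcyc t_sym B_dual n W_graded ha; rewrite /deg_arrow aC subrr.
Qed.

Lemma incl_res_dr_dcyc a xi (l : ovr_idx B) : a \in C -> in_dual a xi -> tag l \notin C ->
  incl (res (dr (ovr_l l) (r xi))) = dr (ovr_l l) (r xi).
Proof.
move=> aC ha lC; apply: ctens_ext => n; apply: cut_graded_incl.
have := cut_graded_dcyc t_sym B_dual n.+1 W_graded ha; rewrite /deg_arrow aC subrr.
move=> /(cut_graded_dr t_sym B_dual (ovr_in_dual B_dual (p := l))).
by rewrite /deg_arrow (negPf lC) subr0.
Qed.

(** Differentiating a potential of degree 1 along two arrows of C gives degree -1. *)
Lemma dr_dcyc_cut a xi (l : ovr_idx B) : a \in C -> in_dual a xi -> tag l \in C ->
  dr (ovr_l l) (r xi) = 0.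
Proof.
move=> aC ha lC; apply: ctens_ext => n.
apply: (@cut_graded_lt0 _ _ _ _ _ t_sym B_dual C n (- 1)) => //.
have := cut_graded_dcyc t_sym B_dual n.+1 W_graded ha; rewrite /deg_arrow aC subrr.
move=> /(cut_graded_dr t_sym B_dual (ovr_in_dual B_dual (p := l))).
by rewrite /deg_arrow lC sub0r.
Qed.

(** Relations along arrows outside C have degree 1 and die in S_C; those along C become generators
    of the cut ideal. *)
Lemma res_ideal x : J x -> J' (res x).
Proof.
apply: (closed_ideal_map (phi := res) resB resM).
  by move=> n w; apply: ctens_map_deg.
move=> y [xi ->]; have [c ->] := dcyc_gen t_sym B_dual W_pot xi.
rewrite res_sum; apply: ideal_sum => l _; rewrite resM; apply: Defs.idealMr.
have hl := ovr_in_dual B_dual (p := l).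
have [lC|lC] := boolP (tag l \in C); first exact: cut_ideal_gen lC hl.
by rewrite (res_dcyc_notin lC hl); apply: ideal0.
Qed.

(** Relations along C have degree 0 and survive the round trip; with [res_ideal] this makes L a
    retract of A. *)
Lemma incl_ideal x : J' x -> J (incl x).
Proof.
apply: (closed_ideal_map (phi := incl) inclB inclM).
  by move=> n w; apply: ctens_map_deg.
move=> _ [a [xi [aC ha ->]]].
rewrite -[X in J X]/(incl (res (r xi))) (incl_res_dcyc aC ha).
by apply: closed_genW; exists xi.
Qed.

Lemma dcyc_cDr a xi : in_dual a xi -> r xi * cD (idem S (tgt a)) = r xi.
Proof.
move=> ha; have hr := (tr_invP t_sym xi).1.
rewrite dcycE -(dl_cDr uL uC _ _ hr) -(cyclic_potential_central t_sym B_dual W_pot).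
rewrite (dl_cDl uL uC) //; congr dl; apply: functional_extensionality_dep => m.
rewrite (tr_inv_inM t_sym m ha) (tr_inv_inM t_sym (lact _ _ _) ha).
by rewrite /= /sM_lact /idem eqxx lact1.
Qed.

Lemma dcyc_cDl_src a xi : in_dual a xi -> cD (idem S (src a)) * r xi = r xi.
Proof.
move=> ha; have hr := (tr_invP t_sym xi).1.
rewrite dcycE (dl_expand t_sym B_dual _ hr) mulr_sumr; apply: eq_bigr => p _.
by rewrite mulrA -ctens_DM idemC -(tr_inv_idem t_sym _ ha).
Qed.

(** As r_xi e_{t(a)} = r_xi, its rightmost factors start at t(a). *)
Lemma dr_dcyc_src a xi (l : ovr_idx B) : in_dual a xi -> src (tag l) != tgt a ->
  dr (ovr_l l) (r xi) = 0.
Proof.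
move=> ha la; rewrite -(dcyc_cDr ha) (dr_cDr t_sym B_dual) // big1 // => k _.
have [lk|lk] := eqVneq l k.
  rewrite -lk /ovrX idem_ract_neq // /ovr_l.
  have [gD _] := oL l; have -> : tl_inv t (ovr_dual B (tagged l)) 0 = 0.
    by apply: (addrI (ovr_l l 0)); rewrite -gD !addr0.
  by rewrite ctens_D0 mulr0.
rewrite inM_ract.
have -> : ovr_l l (inM (ract (sbim S (tag k)) (ovr B (tagged k))
    (idem S (tgt a) (src (tag k))))) = 0.
  have := ovr_l_delta t_sym B_dual l k; rewrite (negPf lk) => h0.
  have := idem S (tgt a) (src (tag k)).
  rewrite /idem; case: (_ == _) => _; last first.
    rewrite ract0l inM0; have [gD _] := oL l.
    by apply: (addrI (ovr_l l 0)); rewrite -gD !addr0.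
  by rewrite ract1.
by rewrite ctens_D0 mulr0.
Qed.

Lemma dr_tgt (l : ovr_idx B) (w : T) :
  dr (ovr_l l) w * cD (idem S (tgt (tag l))) = dr (ovr_l l) w.
Proof.
rewrite (dr_expand t_sym B_dual) // mulr_suml; apply: eq_bigr => k _.
by rewrite -mulrA -ctens_DM -idemC -(tl_inv_idem t_sym _ (ovr_in_dual B_dual (p := l))).
Qed.

Variable N : nat.
Hypothesis highJ : forall w : T, deg_ge N w -> J w.

Lemma cut_ideal_deg_ge (w : T') : deg_ge N w -> J' w.
Proof.
move=> hw; rewrite -(cut_res_incl w); apply: res_ideal; apply: highJ.
exact: ctens_map_deg.
Qed.

Lemma cut_gen_deg (y : T') : cut_gen y -> y 0%N = 0.
Proof.
case=> a [xi [_ _ ->]]; rewrite -[LHS]/(r xi 0%N).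
exact: dcyc_deg.
Qed.

Lemma cut_finite_dim :
  finite_dim (fun k => q (cD (scalar_D S k))) ->
  finite_dim (fun k => q' (cD' (scalar_D S k))).
Proof.
move=> [n [v vP]]; exists n, (fun i => q' (res (rquot_repr (v i)))) => x.
have [w <-] := rcls_surj x; have [c cE] := vP (q (incl w)).
exists c; transitivity (q' (\sum_i cD' (scalar_D S (c i)) * res (rquot_repr (v i)))); last first.
  by rewrite rcls_sum; apply: eq_bigr => i _; rewrite rclsM.
apply/rcls_eq; rewrite -[w]cut_res_incl.
under eq_bigr => i _ do rewrite -res_cD -resM.
rewrite -res_sum -resB; apply: res_ideal; apply/rcls_eq; rewrite cE rcls_sum.
by apply: eq_bigr => i _; rewrite rclsM rquot_reprK.
Qed.

Local Notation E' i := (q' (cD' (idem S i))).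

(** The equations missing from the cut complex hold automatically: at arrows of C by degree, at
    arrows with another source by composability. So [retract_kernel] applies to [jacobian_exact]. *)
Lemma cut_kernel i (x : und_idx B -> Lam) :
  self_injective (rquot J) ->
  (forall p, ~~ ((tag p \in C) && (tgt (tag p) == i)) -> x p = 0) ->
  (forall p, x p * E' (src (tag p)) = x p) ->
  (forall l : ovr_idx B, (tag l \notin C) && (src (tag l) == i) ->
     \sum_p x p * q' (res (dr (ovr_l l) (r (und_dual B (tagged p))))) = 0) ->
  forall p, x p = 0.
Proof.
move=> injA x0 xE xr.
pose dd (l : ovr_idx B) (p : und_idx B) : T := dr (ovr_l l) (r (und_dual B (tagged p))).
have xact := jacobian_exact t_sym B_dual W_pot highJ injA.
pose PI (p : und_idx B) := (tag p \in C) && (tgt (tag p) == i).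
pose PL (l : ovr_idx B) := (tag l \notin C) && (src (tag l) == i).
refine (@retract_kernel T T' J J' res incl resB resM inclB inclM cut_res_incl
  res_ideal incl_ideal (und_idx B) (ovr_idx B) PI PL
  (fun p => cD (idem S (src (tag p)))) (fun p => cD' (idem S (src (tag p))))
  (fun p => cM (undX p)) dd _ _ _ _ _ xact x x0 xE xr).
- by move=> p; apply: incl_cD.
- by move=> p; rewrite -ctens_DM idem_idem.
- by move=> p /andP[pC _]; rewrite res_cM /undX cut_proj_inM // ctens_M0.
- move=> l p /andP[lC _] /andP[pC _].
  exact: incl_res_dr_dcyc pC (und_in_dual B_dual (p := p)) lC.
move=> l p; rewrite negb_and negbK => Pl /andP[pC /eqP pi].
have hp := und_in_dual B_dual (p := p).
case/orP: Pl => [lC|li]; first exact: dr_dcyc_cut pC hp lC.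
by apply: (dr_dcyc_src hp); rewrite pi.
Qed.

Lemma cut_ovr_l_delta (l k : ovr_idx B) : tag l \notin C ->
  cut_ovr_l l (cut_ovrX k) = if l == k then idem S (tgt (tag l)) else 0.
Proof.
move=> lC; rewrite -(ovr_l_delta t_sym B_dual) /cut_ovr_l /ovr_l.
rewrite (tl_inv_inM t_sym _ (ovr_in_dual B_dual (p := l))).
rewrite [RHS](tl_inv_inM t_sym _ (ovr_in_dual B_dual (p := l))).
by rewrite cut_extK.
Qed.

(** Applying the right derivative along l to the identity of [closed_ideal_left_strip] isolates w_l
    modulo J'. *)
Lemma cut_middle i (w : ovr_idx B -> T') :
  (forall l, ~~ ((tag l \notin C) && (src (tag l) == i)) -> w l = 0) ->
  (forall l, w l * cD' (idem S (tgt (tag l))) = w l) ->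
  J' (\sum_l w l * cM' (cut_ovrX l)) ->
  exists u : und_idx B -> T', forall l : ovr_idx B,
    (tag l \notin C) && (src (tag l) == i) -> J' (w l -
      \sum_(p | (tag p \in C) && (tgt (tag p) == i))
         u p * res (dr (ovr_l l) (r (und_dual B (tagged p))))).
Proof.
move=> w0 wE Jz.
(* Zero off C, so that the relations are indexed by all of [und_idx B] and [dl_expand] applies as it
   is. *)
pose rr (p : und_idx B) : T' :=
  if tag p \in C then res (r (und_dual B (tagged p))) else 0.
have Jr p : J' (rr p).
  rewrite /rr; case: ifP => pC; last exact: ideal0.
  exact: cut_ideal_gen pC (und_in_dual B_dual (p := p)).
have r_cD d p : exists c, rr p * cD' d = \sum_k cD' (c k) * rr k.
  have [pC|pC] := boolP (tag p \in C); last first.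
    exists (fun=> 0); rewrite /rr (negPf pC) mul0r big1 // => k _.
    by rewrite ctens_D0 mul0r.
  exists (fun k => und_r p (lact bM d (undX k))).
  have hp := und_in_dual B_dual (p := p).
  rewrite {1}/rr pC -res_cD -resM dcycE -(dl_cDr uL uC _ _ (uL p)).
  rewrite -(cyclic_potential_central t_sym B_dual W_pot) (dl_cDl uL uC _ _ (uL p)).
  rewrite (dl_expand t_sym B_dual) ?res_sum; last exact/rlin_lact/uL.
  apply: eq_bigr => k _; rewrite resM res_cD /rr.
  have [kp|kp] := eqVneq (tag k) (tag p); first by rewrite ifT ?kp // dcycE.
  by rewrite /undX inM_lact (und_r_inM t_sym B_dual) ?ctens_D0 ?mul0r // eq_sym.
have r_gen y : cut_gen y -> exists c, y = \sum_k cD' (c k) * rr k.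
  case=> a [xi [aC ha ->]]; exists (fun k => tr_inv t xi (undX k)).
  rewrite dcycE (dl_expand t_sym B_dual) ?res_sum; last exact: (tr_invP t_sym xi).1.
  apply: eq_bigr => k _; rewrite resM res_cD /rr.
  have [ka|ka] := eqVneq (tag k) a; first by rewrite ifT ?ka // dcycE.
  by rewrite (tr_inv_local t_sym ha) ?ctens_D0 ?mul0r // /undX inM_neq.
have [u [j [Jj zE]]] :=
  closed_ideal_left_strip cut_ideal_deg_ge cut_und_lin cut_und_casimir
    cut_ovr_lin cut_ovr_casimir Jr r_cD r_gen Jz.
exists u => l Pl; have [lC /eqP li] := andP Pl.
have dr_cMX (a : T') k : dr (cut_ovr_l l) (a * cM' (cut_ovrX k)) =
    a * cD' (if l == k then idem S (tgt (tag l)) else 0).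
  rewrite (dr_mul cut_und_lin cut_und_casimir) //; last exact: cut_ovr_lin.
  rewrite -(cut_ovr_l_delta _ lC) -[cM' _]mulr1 (dr_cM (cut_ovr_lin l)).
  rewrite -[1]ctens_D1 (dr_cD (cut_ovr_lin l)).
  by rewrite mulr0 addr0 ract1.
have := congr1 (dr (cut_ovr_l l)) zE; rewrite (drD (cut_ovr_lin l)) !(dr_sum (cut_ovr_lin l)).
under eq_bigr => k _ do rewrite dr_cMX.
rewrite (bigD1 l) //= eqxx wE big1 ?addr0 => [|k]; last first.
  by rewrite eq_sym => /negPf ->; rewrite ctens_D0 mulr0.
have rr0 p : rr p 0%N = 0.
  by rewrite /rr; case: ifP => // _; apply: (dcyc_deg B t_sym W_pot).
have -> : \sum_p dr (cut_ovr_l l) (u p * rr p) =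
    \sum_(p | (tag p \in C) && (tgt (tag p) == i))
       u p * res (dr (ovr_l l) (r (und_dual B (tagged p)))).
  rewrite [RHS]big_mkcond; apply: eq_bigr => p _ /=.
  have hp := und_in_dual B_dual (p := p).
  rewrite (dr_mul cut_und_lin cut_und_casimir _ (cut_ovr_lin l)) // /rr.
  have [pC|pC] := boolP (tag p \in C); last first.
    by rewrite (dr0 (cut_ovr_lin l)) mulr0.
  rewrite -(res_dr _ lC) /=; case: eqVneq => [//|pi].
  by rewrite (dr_dcyc_src hp) ?(ctens_map0 prD prl prr) ?mulr0 // li eq_sym.
move=> ->; rewrite addrAC subrr add0r; apply: (@ideal_sum _ J') => k _.
by rewrite dr_cMX; apply/Defs.idealMr.
Qed.

Section CutComplex.
Variable i : Q0 Q.
Let P2 : pred (Q1 Q) := fun b => (b \in C) && (tgt b == i).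
Let P1 : pred (Q1 Q) := fun a => (a \notin C) && (src a == i).
Let e j : Lam := q' (cD' (idem S j)).
Let c (b : Q1 Q) (k : 'I_(und_size B b)) (a : Q1 Q) (j : 'I_(ovr_size B a)) : Lam :=
  q' (res (dr (tl_inv t (ovr_dual B j)) (r (und_dual B k)))).
Let m (a : Q1 Q) (j : 'I_(ovr_size B a)) : Lam := q' (res (cM (inM (ovr B j)))).

Let e_idem j : e j * e j = e j.
Proof. by rewrite /e -rclsM -ctens_DM idem_idem. Qed.

Let c_e (p : und_idx B) (l : ovr_idx B) :
  c (tagged p) (tagged l) * e (tgt (tag l)) = c (tagged p) (tagged l).
Proof. by rewrite /c /e -rclsM -res_cD -resM (dr_tgt l). Qed.

Let m_e (l : ovr_idx B) : P1 (tag l) -> m (tagged l) * e i = m (tagged l).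
Proof.
by move=> /andP[_ /eqP <-]; rewrite /m /e -rclsM -res_cD -resM -ctens_M_ract idem_ract.
Qed.

Lemma map2_cut_inj : self_injective (rquot J) ->
  injective (map2 (e := e) (P2 := P2) (P1 := P1) (v2 := src) tgt c).
Proof.
move=> injA; apply: (map2_inj e_idem c_e) => x x0 xE xr.
exact: (cut_kernel injA x0 xE xr).
Qed.

Let middle (w : ovr_idx B -> Lam) :
  (forall l, ~~ P1 (tag l) -> w l = 0) ->
  (forall l, w l * e (tgt (tag l)) = w l) ->
  \sum_l w l * m (tagged l) = 0 ->
  exists u : und_idx B -> Lam, (forall (p : und_idx B) (l : ovr_idx B),
      u p * e (src (tag p)) * c (tagged p) (tagged l) = u p * c (tagged p) (tagged l)) /\
    forall l : ovr_idx B, P1 (tag l) ->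
      w l = \sum_(p : und_idx B | P2 (tag p)) u p * c (tagged p) (tagged l).
Proof.
move=> w0 wE sum0.
have lift l : exists v : T', [/\ q' v = w l, v * cD' (idem S (tgt (tag l))) = v
    & ~~ P1 (tag l) -> v = 0].
  have [v vE] := rcls_surj (w l); have [Pl|nPl] := boolP (P1 (tag l)).
    exists (v * cD' (idem S (tgt (tag l)))); split=> //; first by rewrite rclsM vE wE.
    by rewrite -mulrA -ctens_DM idem_idem.
  by exists 0; split; rewrite ?mul0r // rcls0 w0.
have [v vP] := boolp.choice lift.
have v0 l : ~~ P1 (tag l) -> v l = 0 by case: (vP l).
have vE l : v l * cD' (idem S (tgt (tag l))) = v l by case: (vP l).
have vw l : q' (v l) = w l by case: (vP l).
have [|u uE] := cut_middle v0 vE.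
  apply/rcls0P; rewrite rcls_sum -[RHS]sum0; apply: eq_bigr => l _.
  by rewrite rclsM vw /m res_cM.
exists (fun p => q' (u p)); split=> [p l|l Pl].
  rewrite -mulrA; congr (_ * _); rewrite /e /c -rclsM -res_cD -resM.
  by rewrite -(dr_cDM (oL l)) (dcyc_cDl_src (und_in_dual B_dual (p := p))).
have /rcls_eq := uE l Pl; rewrite vw => ->; rewrite rcls_sum.
by apply: eq_bigr => p _; rewrite rclsM.
Qed.

Let compose0 (p : und_idx B) : P2 (tag p) ->
  \sum_(l : ovr_idx B | P1 (tag l)) c (tagged p) (tagged l) * m (tagged l) = 0.
Proof.
move=> /andP[pC /eqP pi]; have hp := und_in_dual B_dual (p := p).
have /rcls0P := cut_ideal_gen pC hp.
rewrite [X in res X](dr_decomp uL uC oL oC) (dcyc_deg B t_sym W_pot) ctens_D0 add0r.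
rewrite res_sum rcls_sum => sum0; rewrite -[RHS]sum0 big_mkcond; apply: eq_bigr => l _.
rewrite resM rclsM; case: ifP => // /negbT; rewrite negb_and negbK => /orP[lC|li].
  by rewrite res_cM /ovrX cut_proj_inM // ctens_M0 rcls0 mulr0.
rewrite (dr_dcyc_src hp) ?pi //.
by rewrite (ctens_map0 prD prl prr) rcls0 mul0r.
Qed.

Lemma exact_map2_map1_cut :
  exact_at (map2 (e := e) (P2 := P2) (P1 := P1) (v2 := src) tgt c)
    (map1 (e := e) (P1 := P1) (v1 := tgt) i m).
Proof. exact: (exact_map2_map1 e_idem c_e m_e middle compose0). Qed.

Let rad : Lam -> Prop := @arrow_ideal _ _ bC cut_gen.

Let rad_e : ~ rad (e i).
Proof.
move=> [w w1 /rcls_eq /(closed_ideal_deg cut_gen_deg)].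
rewrite -[LHS]/(w 0%N - idem S i) w1 // sub0r => e0.
by apply: (@idem_neq0 _ _ S i); rewrite -[LHS]opprK e0 oppr0.
Qed.

Let rad_div (x : Lam) : rad (x * e i) \/ exists d, rad (d * (x * e i) - e i).
Proof.
have [d [p [pr ->]]] := arrow_ideal_decomp x.
have pe a : rad (a * (p * e i)).
  apply: (arrow_idealMl cut_und_lin cut_und_casimir).
  exact: (arrow_idealMr cut_und_lin cut_und_casimir).
have [d0|[d' d'P]] := idem_div i d; [left | right].
  by rewrite mulrDl /e -rclsM -ctens_DM -idemC d0 ctens_D0 rcls0 add0r -[X in rad X]mul1r.
exists (q' (cD' d')); rewrite mulrDl mulrDr {1}/e -rclsM -ctens_DM -idemC -rclsM -ctens_DM d'P.
by rewrite addrAC subrr add0r.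
Qed.

Let rad_m (l : ovr_idx B) : P1 (tag l) -> rad (m (tagged l)).
Proof.
by move=> _; exists (res (cM (ovrX l))) => //; apply/deg1P; rewrite res_cM.
Qed.

Let rad_gen (x : Lam) : rad x -> exists w : ovr_idx B -> Lam,
  x * e i = \sum_(l : ovr_idx B | P1 (tag l)) w l * e (tgt (tag l)) * m (tagged l).
Proof.
move=> [w w1 <-]; exists (fun l => q' (dr (cut_ovr_l l) w)).
rewrite {1}(dr_decomp cut_und_lin cut_und_casimir cut_ovr_lin cut_ovr_casimir w).
rewrite w1 // ctens_D0 add0r.
rewrite rcls_sum mulr_suml.
rewrite [RHS]big_mkcond; apply: eq_bigr => l _.
rewrite rclsM -mulrA /e -rclsM -ctens_M_ract /cut_ovrX -cut_proj_ract.
case: ifP => [/andP[_ /eqP li]|/negbT]; last first.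
  rewrite negb_and negbK => /orP[lC|li].
    by rewrite /ovrX inM_ract cut_proj_inM // ctens_M0 rcls0 mulr0.
  by rewrite idem_ract_neq // (_ : pr 0 = 0) ?ctens_M0 ?rcls0 ?mulr0.
rewrite -li idem_ract -mulrA; congr (_ * _).
by rewrite /m -rclsM -res_cD -resM -ctens_M_lact idem_lact res_cM.
Qed.

Lemma exact_map1_top_cut :
  exact_at (map1 (e := e) (P1 := P1) (v1 := tgt) i m) (@mod_top_proj Lam (lideal (e i))).
Proof.
apply: (exact_map1_top e_idem m_e (rad := rad)) => //.
- by exists 0 => //; apply: rcls0.
- exact: arrow_idealD.
- by move=> a x; apply: (arrow_idealMl cut_und_lin cut_und_casimir).
by move=> x rx; exists N; apply: (arrow_ideal_nilp cut_ideal_deg_ge cut_und_lin cut_und_casimir).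
Qed.

Lemma cut_complex_exact : self_injective (rquot J) ->
  complex_exact e P2 P1 src tgt i c m.
Proof.
move=> injA; split; first exact: map2_cut_inj.
  exact: exact_map2_map1_cut.
exact: exact_map1_top_cut.
Qed.
End CutComplex.

End CutExact.

(** * Cuts are algebraic, and arrows with nonzero bimodule lie on cycles *)

Theorem proposition5p5 (K : fieldType) (Q : quiver) (S : species K Q)
    (t : {linear sD S -> K^o}) (B : bases S) (W : sT S)
    (Q2 : seq (Q1 Q) -> Prop) :
  perfect_field K ->
  no_multiple_arrows Q ->
  quiver_connected Q ->
  symmetrizing t ->
  dual_bases t B ->
  is_potential W ->
  self_injective_species t B W ->
  minimal_cycles W Q2 ->
  (forall C : {set Q1 Q}, is_cut Q2 C -> algebraic_cut t B W C) /\
  (forall a : Q1 Q, (exists m : smod S a, m != 0) ->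
     exists c : seq (Q1 Q), Q2 c /\ a \in c).
Proof.
move=> _ _ _ t_sym B_dual W_pot [fdA injA] [_ car _].
have [N highJ] := finite_dim_deg_ge (@scalar_DD _ _ S) (@scalar_DM _ _ S)
  (scalar_D1 S) fdA.
split=> [C cutC|a [m m0]].
  (* Every cycle of Q_2 meets C exactly once, so W has degree 1. *)
  have gr n := cut_graded_carried t_sym B_dual n cutC car.
  split; first exact: (cut_finite_dim t_sym B_dual W_pot gr fdA).
  move=> i.
  have h := cut_complex_exact t_sym B_dual W_pot gr highJ i injA.
  have {}h : complex_exact (R := cut_jacobian t B W C) (cidem t B W C)
    (fun b => (b \in C) && (tgt b == i)) (fun a => (a \notin C) && (src a == i))
    src tgt i
    (fun b (k : 'I_(und_size B b)) a (j : 'I_(ovr_size B a)) =>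
       ccls t B W (cut_res C (dr (tl_inv t (ovr_dual B j)) (dcyc t B (und_dual B k) W))))
    (fun a (j : 'I_(ovr_size B a)) => ccls t B W (cut_res C (sT_M (inM (ovr B j))))).
    exact: h.
  case: h => h2 h1 h0; split.
  - exact: h2.
  - exact: h1.
  - exact: h0.
  - exact: lcls_surj.
apply: contrapT => noc; have [p pa] := und_nonempty t_sym B_dual m0.
(* With {a} in the place of C, no cycle is counted and W has degree 0; the relations along a then
   have degree -1. *)
have gr n : cut_graded t B [set a] n 0 W.
  apply: (cut_graded_carried t_sym B_dual n _ car (k := 0)) => c Q2c.
  apply/eqP; rewrite -leqn0 leqNgt -has_count; apply/hasPn => b bc /=.
  by rewrite inE; apply: contra_notN noc => /eqP ba; exists c; rewrite -ba.
apply: (dcyc_neq0 t_sym B_dual W_pot highJ injA (p := p)); apply: ctens_ext => n.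
apply: (cut_graded_lt0 t_sym B_dual (C := [set a]) (z := - 1)) => //.
have := cut_graded_dcyc t_sym B_dual n gr (und_in_dual B_dual (p := p)).
by rewrite /deg_arrow (_ : tag p \in [set a]) ?sub0r // pa set11.
Qed.
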